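(* Let $n\geq 2$ and $D(a)=\{z\in\mathbb{C}^n: ||z_k|^2-|z_n|^2|<(|z_n|^2+1)^{-a}\text{ for } k=1,\ldots,n-1\}$. If $\frac{2}{n-1}<a\leq\frac{3}{n-1}$, then every holomorphic automorphism $\varphi\in\mathrm{Aut}(D(a))$ is linear.
   Context: $\mathrm{Aut}(\Omega)$ denotes the group of biholomorphic self-maps of a domain $\Omega$. *)

(* Defs.v *)
From HB Require Import structures.
From mathcomp Require Import all_boot all_order all_algebra.
From mathcomp Require Import all_classical all_reals all_analysis.
From mathcomp Require Import complex.

Set Implicit Arguments.
Unset Strict Implicit.
Unset Printing Implicit Defensive.

Import Order.TTheory GRing.Theory Num.Theory.
Local Open Scope ring_scope.
Local Open Scope classical_set_scope.

Definition csqabs (R : realType) (z : R[i]) : R :=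
  (@complex.Re R z) ^+ 2 + (@complex.Im R z) ^+ 2.

Definition cabs (R : realType) (z : R[i]) : R := Num.sqrt (csqabs z).

Definition vnorm (R : realType) (n : nat) (h : 'rV[R[i]]_n) : R :=
  \sum_(i < n) cabs (h ord0 i).

Definition copen (R : realType) (n : nat) (U : set 'rV[R[i]]_n) : Prop :=
  forall z, U z -> exists2 r : R, 0 < r &
    forall w, vnorm (w - z) < r -> U w.

Definition cdifferentiable_at (R : realType) (n : nat)
    (f : 'rV[R[i]]_n -> 'rV[R[i]]_n) (z : 'rV[R[i]]_n) : Prop :=
  exists L : 'M[R[i]]_n, forall eps : R, 0 < eps ->
    exists2 delta : R, 0 < delta & forall h : 'rV[R[i]]_n,
      vnorm h < delta ->
      vnorm (f (z + h) - f z - h *m L) <= eps * vnorm h.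

Definition holomorphic_on (R : realType) (n : nat)
    (U : set 'rV[R[i]]_n) (f : 'rV[R[i]]_n -> 'rV[R[i]]_n) : Prop :=
  forall z, U z -> cdifferentiable_at f z.

Definition is_automorphism (R : realType) (n : nat)
    (U : set 'rV[R[i]]_n) (phi : 'rV[R[i]]_n -> 'rV[R[i]]_n) : Prop :=
  holomorphic_on U phi /\ (forall z, U z -> U (phi z)) /\
  exists psi : 'rV[R[i]]_n -> 'rV[R[i]]_n,
    [/\ holomorphic_on U psi, (forall z, U z -> U (psi z)),
        (forall z, U z -> psi (phi z) = z) &
        (forall z, U z -> phi (psi z) = z)].

(* D(a) = { z in C^n : | |z_k|^2 - |z_n|^2 | < (|z_n|^2 + 1)^(-a), k = 1..n-1 }.
   Indices are 0-based: z_n is the coordinate of index n-1. *)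
Definition Dom (R : realType) (n : nat) (a : R) : set 'rV[R[i]]_n :=
  [set z | forall (k j : 'I_n), (val j = n.-1)%N -> (val k < n.-1)%N ->
     `| csqabs (z ord0 k) - csqabs (z ord0 j) |
       < (csqabs (z ord0 j) + 1) `^ (- a)].

Definition linear_on (R : realType) (n : nat)
    (U : set 'rV[R[i]]_n) (phi : 'rV[R[i]]_n -> 'rV[R[i]]_n) : Prop :=
  exists A : 'M[R[i]]_n, forall z, U z -> phi z = z *m A.

(* Main.v *)
(* The domain contains every line C.v with |v_1| = ... = |v_n| = 1.  If (h, g) is a
   pair of coordinates of an entire curve in the domain, then |h|^2 - |g|^2 is
   O(|g|^(-2a)), so log |h/g| is so small where g is large that |W|^2, W = h g' - g h',
   can be weighted into a conformal metric on C of curvature <= -c < 0.  By Ahlfors'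
   lemma there is none, hence W = 0: every nonconstant entire curve in the domain is
   t |-> g(t) w, with w again on the torus.  An automorphism therefore permutes these
   lines, and it is a biholomorphism of C on each of them, so it is affine on each.
   Injectivity forces it to fix the origin, hence it agrees with its differential at
   0 on the cone |z_1| = ... = |z_n|; the identity theorem in one variable at a time
   extends this to the whole domain. *)
Require Import Defs.
From HB Require Import structures.
From mathcomp Require Import all_boot all_order all_algebra.
From mathcomp Require Import all_classical all_reals all_analysis.
From mathcomp Require Import complex ring lra.
Import Order.TTheory GRing.Theory Num.Theory.
Import numFieldNormedType.Exports.
Local Open Scope classical_set_scope.
Local Open Scope ring_scope.

Set Implicit Arguments.
Unset Strict Implicit.
Unset Printing Implicit Defensive.

(** * Complex differentiability *)

(** The weight comes from one computation. With [M = h / g] one has [M' = - W / g^2], and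
    [eta = |M|^2 - 1] is O(|g|^(-2-2a)). The mixed derivative of [eta^2] is [2 |M'|^2 (1 + 2 eta)];
    multiplied by [|g|^(2b)], [b = 2 + a], it is comparable to [|W|^2 |g|^(2a)], whereas
    [eta^2 |g|^(2b)] itself is only O(|g|^(-2a)). So a bounded correction of the exponent turns the
    flat metric [|W|^2 |g|^(2a)] into a negatively curved one. The obstacle is that this makes no
    sense near the zeros of [g]. There [|h|^2 + |g|^2] is bounded, and a multiple of it serves as
    the exponent; the two metrics are compared where both are defined. The larger of the two is not
    smooth, but Ahlfors' argument looks at a single maximum point, so a second-order expansion at
    one point replaces the Laplacian. As [holomorphic_on] asks only for differentiability at each
    point, the regularity behind these expansions has to start from Goursat's theorem. *)

Section Modulus.
Variable R : realType.
Implicit Types (x y z : R[i]).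

Lemma cabs_normc z : cabs z = ComplexField.Normc.normc z.
Proof. by case: z. Qed.

Lemma cabs_ge0 z : 0 <= cabs z.
Proof. exact: sqrtr_ge0. Qed.

Lemma csqabs_ge0 z : 0 <= csqabs z.
Proof. by rewrite addr_ge0 ?sqr_ge0. Qed.

Lemma sqr_cabs z : cabs z ^+ 2 = csqabs z.
Proof. by rewrite sqr_sqrtr ?csqabs_ge0. Qed.

Lemma cabs0 : cabs (0 : R[i]) = 0.
Proof. by rewrite /cabs /csqabs /= expr0n addr0 sqrtr0. Qed.

Lemma cabs1 : cabs (1 : R[i]) = 1.
Proof. by rewrite /cabs /csqabs /= expr0n addr0 expr1n sqrtr1. Qed.

Lemma cabsM x y : cabs (x * y) = cabs x * cabs y.
Proof. by rewrite !cabs_normc ComplexField.Normc.normcM. Qed.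

Lemma cabsX x n : cabs (x ^+ n) = cabs x ^+ n.
Proof. by elim: n => [|n IH]; rewrite ?expr0 ?cabs1 // !exprS cabsM IH. Qed.

Lemma cabsV x : cabs x^-1 = (cabs x)^-1.
Proof. by rewrite !cabs_normc ComplexField.Normc.normcV. Qed.

Lemma cabsN x : cabs (- x) = cabs x.
Proof. by case: x => a b; rewrite /cabs /csqabs /= !sqrrN. Qed.

Lemma cabsBC x y : cabs (x - y) = cabs (y - x).
Proof. by rewrite -cabsN opprB. Qed.

Lemma cabsD x y : cabs (x + y) <= cabs x + cabs y.
Proof. by rewrite !cabs_normc; exact: le_normcD. Qed.

Lemma cabsB x y : cabs (x - y) <= cabs x + cabs y.
Proof. by rewrite -(cabsN y) cabsD. Qed.

Lemma cabs_distD z x y : cabs (x - y) <= cabs (x - z) + cabs (z - y).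
Proof. by rewrite -[x - y](subrKA z) cabsD. Qed.

Lemma cabs_eq0 x : (cabs x == 0) = (x == 0).
Proof.
apply/eqP/eqP => [|->]; last exact: cabs0.
by rewrite cabs_normc => /ComplexField.Normc.eq0_normc.
Qed.

Lemma cabs_gt0 x : (0 < cabs x) = (x != 0).
Proof. by rewrite lt_def cabs_ge0 andbT cabs_eq0. Qed.

Lemma csqabs_gt0 x : (0 < csqabs x) = (x != 0).
Proof. by rewrite -sqr_cabs exprn_even_gt0 //= cabs_eq0. Qed.

Lemma csqabsM x y : csqabs (x * y) = csqabs x * csqabs y.
Proof. by rewrite -!sqr_cabs cabsM exprMn. Qed.

Lemma csqabsV x : csqabs x^-1 = (csqabs x)^-1.
Proof. by rewrite -!sqr_cabs cabsV exprVn. Qed.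

Lemma cabsR (r : R) : cabs (r%:C)%C = `|r|.
Proof. by rewrite /cabs /csqabs /= expr0n addr0 sqrtr_sqr. Qed.

Lemma cabs_le_Re x : `|complex.Re x| <= cabs x.
Proof.
rewrite -(ler_pXn2r (n := 2)) ?nnegrE ?cabs_ge0 ?normr_ge0 //.
by rewrite sqr_cabs real_normK ?num_real // lerDl sqr_ge0.
Qed.

Lemma cabs_le_Im x : `|complex.Im x| <= cabs x.
Proof.
rewrite -(ler_pXn2r (n := 2)) ?nnegrE ?cabs_ge0 ?normr_ge0 //.
by rewrite sqr_cabs real_normK ?num_real // lerDr sqr_ge0.
Qed.

Lemma cabs_le_ReIm x : cabs x <= `|complex.Re x| + `|complex.Im x|.
Proof.
rewrite -(ler_pXn2r (n := 2)) ?nnegrE ?cabs_ge0 ?addr_ge0 //.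
rewrite sqr_cabs sqrrD !real_normK ?num_real // /csqabs -addrA.
by rewrite lerD2l lerDr mulrn_wge0 // mulr_ge0.
Qed.

Lemma cabs_lt_csqabs x (r : R) : 0 <= r -> (cabs x < r) = (csqabs x < r ^+ 2).
Proof.
by move=> r0; rewrite -sqr_cabs ltr_pXn2r // nnegrE ?cabs_ge0.
Qed.

Lemma cabs_le_csqabs x (r : R) : 0 <= r -> (cabs x <= r) = (csqabs x <= r ^+ 2).
Proof.
by move=> r0; rewrite -sqr_cabs ler_pXn2r // nnegrE ?cabs_ge0.
Qed.

End Modulus.

Section Nearby.
Variable R : realType.
Local Notation C := R[i].

(** The increment, not the point, is the variable, so that all epsilon-delta statements in [cabs]
    share one filter and combine through [near0_and] and [near0_imp]. *)
Definition near0 (P : C -> Prop) : Prop :=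
  exists2 d : R, 0 < d & forall h, cabs h < d -> P h.

Lemma near0_true (P : C -> Prop) : (forall h, P h) -> near0 P.
Proof. by move=> H; exists 1. Qed.

Lemma near0_and (P Q : C -> Prop) :
  near0 P -> near0 Q -> near0 (fun h => P h /\ Q h).
Proof.
move=> [d d0 HP] [e e0 HQ]; exists (Num.min d e); first by rewrite lt_min d0.
by move=> h; rewrite lt_min => /andP[/HP ? /HQ].
Qed.

Lemma near0_imp (P Q : C -> Prop) :
  (forall h, P h -> Q h) -> near0 P -> near0 Q.
Proof. by move=> H [d d0 HP]; exists d => // h /HP /H. Qed.

Lemma near0_small (d : R) : 0 < d -> near0 (fun h => cabs h < d).
Proof. by move=> d0; exists d. Qed.

Lemma near0_ball (z a : C) (r : R) :
  cabs (z - a) < r -> near0 (fun h => cabs (z + h - a) < r).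
Proof.
move=> H; exists (r - cabs (z - a)); first by rewrite subr_gt0.
move=> h Hh; rewrite (_ : z + h - a = (z - a) + h); last by ring.
by apply: le_lt_trans (cabsD _ _) _; rewrite addrC -ltrBrDr.
Qed.

Definition ccont (f : C -> C) (z : C) : Prop :=
  forall e : R, 0 < e -> near0 (fun h => cabs (f (z + h) - f z) < e).

Definition rcont (f : C -> R) (z : C) : Prop :=
  forall e : R, 0 < e -> near0 (fun h => `|f (z + h) - f z| < e).

Definition cderiv (f : C -> C) (z l : C) : Prop :=
  forall e : R, 0 < e ->
    near0 (fun h => cabs (f (z + h) - f z - l * h) <= e * cabs h).

Lemma ccont_cst (c z : C) : ccont (fun=> c) z.
Proof. by move=> e e0; apply: near0_true => h; rewrite subrr cabs0. Qed.

Lemma ccontD f g z : ccont f z -> ccont g z -> ccont (fun x => f x + g x) z.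
Proof.
move=> Hf Hg e e0; have e2 : 0 < e / 2 by rewrite divr_gt0.
move: (near0_and (Hf _ e2) (Hg _ e2)); apply: near0_imp => h [H1 H2].
rewrite (_ : _ - _ = (f (z + h) - f z) + (g (z + h) - g z)); last by ring.
by apply: le_lt_trans (cabsD _ _) _; rewrite [e]splitr ltrD.
Qed.

Lemma ccont_bnd f z : ccont f z -> near0 (fun h => cabs (f (z + h)) < cabs (f z) + 1).
Proof.
move=> Hf; move: (Hf 1 ltr01); apply: near0_imp => h H.
rewrite -[f (z + h)](subrK (f z)) addrC; apply: le_lt_trans (cabsD _ _) _.
by rewrite ltrD2l.
Qed.

Lemma ccontM f g z : ccont f z -> ccont g z -> ccont (fun x => f x * g x) z.
Proof.
move=> Hf Hg e e0.
have Mg : 0 < cabs (g z) + 1 by rewrite ltr_wpDl ?cabs_ge0.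
have Mf : 0 < cabs (f z) + 1 by rewrite ltr_wpDl ?cabs_ge0.
have e1 : 0 < e / 2 / (cabs (g z) + 1) by rewrite !divr_gt0.
have e2 : 0 < e / 2 / (cabs (f z) + 1) by rewrite !divr_gt0.
move: (near0_and (ccont_bnd Hg) (near0_and (Hf _ e1) (Hg _ e2))).
apply: near0_imp => h [H0 [H1 H2]].
rewrite (_ : _ - _ = (f (z + h) - f z) * g (z + h) + f z * (g (z + h) - g z)); last by ring.
apply: le_lt_trans (cabsD _ _) _; rewrite [e]splitr !cabsM.
rewrite ltr_pdivlMr // in H1; rewrite ltr_pdivlMr // in H2.
apply: ltrD.
  by apply: le_lt_trans H1; rewrite ler_wpM2l ?cabs_ge0 // ltW.
by apply: le_lt_trans H2; rewrite mulrC ler_wpM2l ?cabs_ge0 // lerDl ler01.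
Qed.

Lemma ccont_comp f g z : ccont f z -> ccont g (f z) -> ccont (fun x => g (f x)) z.
Proof.
move=> Hf Hg e e0; have [d d0 Hd] := Hg e e0.
move: (Hf d d0); apply: near0_imp => h /Hd.
by rewrite [f z + _]addrC subrK.
Qed.

Lemma ccont_neq0 f z : ccont f z -> f z != 0 ->
  near0 (fun h => cabs (f z) / 2 < cabs (f (z + h))).
Proof.
move=> Hf f0; have e0 : 0 < cabs (f z) / 2 by rewrite divr_gt0 // cabs_gt0.
move: (Hf _ e0); apply: near0_imp => h H.
have := cabsD (f (z + h)) (f z - f (z + h)); rewrite [f (z + h) + _]addrC subrK.
rewrite cabsBC => H1; move: (cabs (f z)) (cabs (f (z + h))) (cabs _) H H1 => x y w; lra.
Qed.

Lemma ccontV f z : ccont f z -> f z != 0 -> ccont (fun x => (f x)^-1) z.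
Proof.
move=> Hf f0 e e0; have a0 : 0 < cabs (f z) by rewrite cabs_gt0.
have e1 : 0 < e * (cabs (f z) ^+ 2 / 2) by rewrite mulr_gt0 // divr_gt0 // exprn_gt0.
move: (near0_and (ccont_neq0 Hf f0) (Hf _ e1)); apply: near0_imp => h [H1 H2].
have b0 : 0 < cabs (f (z + h)) by apply: lt_trans H1; rewrite divr_gt0.
have fh0 : f (z + h) != 0 by rewrite -cabs_gt0.
rewrite (_ : _ - _ = - (f (z + h) - f z) / (f (z + h) * f z)); last first.
  by field; rewrite f0 fh0.
rewrite cabsM cabsN cabsV cabsM ltr_pdivrMr ?mulr_gt0 //.
apply: lt_le_trans H2 _; rewrite ler_pM2l //.
by move: (cabs (f z)) (cabs (f (z + h))) a0 H1 => x y; nra.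
Qed.

(** The factorisation is asked only near 0: for [x^-1] the formula for the slope fails at the
    increment that reaches 0. *)
Lemma cderiv_intro f z q : ccont q 0 ->
  near0 (fun h => f (z + h) = f z + q h * h) -> cderiv f z (q 0).
Proof.
move=> cq Hq e e0; move: (near0_and Hq (cq e e0)); apply: near0_imp => h.
rewrite add0r => -[-> Hh].
rewrite (_ : _ - _ = (q h - q 0) * h); last by ring.
by rewrite cabsM ler_wpM2r ?cabs_ge0 // ltW.
Qed.

(* Caratheodory's form of differentiability: the closure properties of [cderiv]
   reduce to those of [ccont]. *)
Lemma cderivP f z l : cderiv f z l <->
  exists q : C -> C, [/\ ccont q 0, q 0 = l & forall h, f (z + h) = f z + q h * h].
Proof.
split=> [H|[q [cq <- Hq]]]; last first.
  by apply: cderiv_intro => //; exact: near0_true.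
exists (fun h => if h == 0 then l else (f (z + h) - f z) / h); split.
- move=> e e0; have e2 : 0 < e / 2 by rewrite divr_gt0.
  move: (H _ e2); apply: near0_imp => h; rewrite eqxx add0r.
  case: eqP => [_ _|/eqP h0 Hh]; first by rewrite subrr cabs0.
  rewrite (_ : _ - _ = (f (z + h) - f z - l * h) / h); last by field.
  rewrite cabsM cabsV ltr_pdivrMr ?cabs_gt0 //; apply: le_lt_trans Hh _.
  by rewrite ltr_pM2r ?cabs_gt0 // ltr_pdivrMr // mulr_natr mulr2n ltrDl.
- by rewrite eqxx.
- move=> h; case: eqP => [->|/eqP h0]; first by rewrite addr0 mulr0 addr0.
  by rewrite divfK // [f z + _]addrC subrK.
Qed.

Lemma ccont_id z : ccont id z.
Proof. by move=> e e0; exists e => // h; rewrite addrAC subrr add0r. Qed.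

Lemma cderiv_cont f z l : cderiv f z l -> ccont f z.
Proof.
move=> /cderivP[q [cq q0 Hq]] e e0.
have := ccontM cq (ccont_id 0) e0; apply: near0_imp => h.
by rewrite !add0r mulr0 subr0 Hq addrAC subrr add0r.
Qed.

Lemma cderiv_cst (c z : C) : cderiv (fun=> c) z 0.
Proof. by apply/cderivP; exists (fun=> 0); split => [||h]; [exact: ccont_cst|by []|rewrite mul0r addr0]. Qed.

Lemma cderiv_id z : cderiv id z 1.
Proof. by apply/cderivP; exists (fun=> 1); split => [||h]; [exact: ccont_cst|by []|rewrite mul1r]. Qed.

Lemma cderivD f g z l m : cderiv f z l -> cderiv g z m ->
  cderiv (fun x => f x + g x) z (l + m).
Proof.
move=> /cderivP[q [cq <- Hq]] /cderivP[r [cr <- Hr]]; apply/cderivP.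
exists (fun h => q h + r h); split => [||h]; [exact: ccontD|by []|].
by rewrite Hq Hr; ring.
Qed.

Lemma cderivM f g z l m : cderiv f z l -> cderiv g z m ->
  cderiv (fun x => f x * g x) z (l * g z + f z * m).
Proof.
move=> Hf Hg; have cf := cderiv_cont Hf.
move: Hf Hg => /cderivP[q [cq <- Hq]] /cderivP[r [cr <- Hr]]; apply/cderivP.
exists (fun h => q h * g z + (f z + q h * h) * r h); split.
- apply: ccontD; first by apply: ccontM => //; exact: ccont_cst.
  apply: ccontM => //; apply: ccontD; first exact: ccont_cst.
  by apply: ccontM => //; exact: ccont_id.
- by rewrite mulr0 addr0.
- by move=> h; rewrite Hq Hr; ring.
Qed.

Lemma cderivZ c f z l : cderiv f z l -> cderiv (fun x => c * f x) z (c * l).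
Proof.
by move=> H; move: (cderivM (cderiv_cst c z) H); rewrite mul0r add0r.
Qed.

Lemma cderivB f g z l m : cderiv f z l -> cderiv g z m ->
  cderiv (fun x => f x - g x) z (l - m).
Proof.
move=> Hf Hg; move: (cderivD Hf (cderivZ (-1) Hg)); rewrite mulN1r.
by congr cderiv; apply: funext => x; rewrite mulN1r.
Qed.

Lemma cderiv_comp f g z l m : cderiv f z l -> cderiv g (f z) m ->
  cderiv (fun x => g (f x)) z (m * l).
Proof.
move=> /cderivP[q [cq <- Hq]] /cderivP[r [cr <- Hr]]; apply/cderivP.
exists (fun h => r (q h * h) * q h); split.
- apply: ccontM => //; apply: (@ccont_comp (fun h => q h * h)).
    by apply: ccontM => //; exact: ccont_id.
  by rewrite mulr0.
- by rewrite mulr0.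
- by move=> h; rewrite Hq Hr mulrA.
Qed.

Lemma cderivV f z l : cderiv f z l -> f z != 0 ->
  cderiv (fun x => (f x)^-1) z (- l / f z ^+ 2).
Proof.
move=> Hf f0; have cf := cderiv_cont Hf.
move/cderivP: Hf => [q [cq <- Hq]].
suff H : cderiv (fun x => x^-1) (f z) (- (f z ^+ 2)^-1).
  have Hf : cderiv f z (q 0) by apply/cderivP; exists q.
  by move: (cderiv_comp Hf H); rewrite mulrC mulrN mulNr.
move: {q cq Hq cf} (f z) f0 => w w0.
have ci : ccont (fun h => w + h) 0 by apply: ccontD; [exact: ccont_cst|exact: ccont_id].
have w00 : w + 0 != 0 by rewrite addr0.
have cq : ccont (fun h => - w^-1 * (w + h)^-1) 0.
  by apply: ccontM; [exact: ccont_cst|exact: ccontV].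
have -> : - (w ^+ 2)^-1 = - w^-1 * (w + 0)^-1 by rewrite addr0; field.
apply: (cderiv_intro (f := fun x => x^-1) cq).
move: (ccont_neq0 ci w00); apply: near0_imp => h; rewrite add0r => H.
have wh0 : w + h != 0.
  by rewrite -cabs_gt0; apply: lt_trans H; rewrite divr_gt0 ?cabs_gt0.
by field; rewrite w0 wh0.
Qed.

Lemma cderiv_uniq f z l m : cderiv f z l -> cderiv f z m -> l = m.
Proof.
move=> Hl Hm; apply/eqP; rewrite -subr_eq0 -cabs_eq0; apply/eqP/le_anti.
rewrite cabs_ge0 andbT; apply/ler_addgt0Pl => e e0; rewrite addr0.
have e2 : 0 < e / 2 by rewrite divr_gt0.
have [d d0 Hd] := near0_and (Hl _ e2) (Hm _ e2).
pose h : C := ((d / 2)%:C)%C.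
have h0 : cabs h = d / 2 by rewrite cabsR gtr0_norm // divr_gt0.
have [|H1 H2] := Hd h; first by rewrite h0 ltr_pdivrMr // mulr_natr mulr2n ltrDl.
have hp : 0 < cabs h by rewrite h0 divr_gt0.
rewrite -(ler_pM2r hp) -cabsM.
rewrite (_ : _ * h = (f (z + h) - f z - m * h) - (f (z + h) - f z - l * h)); last by ring.
by apply: le_trans (cabsB _ _) _; rewrite [e]splitr mulrDl lerD.
Qed.

Lemma eq_cderiv f g z l : near0 (fun h => f (z + h) = g (z + h)) ->
  cderiv f z l -> cderiv g z l.
Proof.
move=> Hfg H e e0; have Hz : f z = g z.
  by case: Hfg => d d0 /(_ 0); rewrite cabs0 addr0; apply.
by move: (near0_and Hfg (H e e0)); apply: near0_imp => h [<-]; rewrite Hz.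
Qed.

Lemma cderiv_sub f g z l : f =1 g -> cderiv f z l -> cderiv g z l.
Proof. by move=> H; apply: eq_cderiv; apply: near0_true => h; rewrite H. Qed.

Lemma cderiv_scale (c z : C) : cderiv (fun x => c * x) z c.
Proof. by rewrite -{2}[c]mulr1; exact: cderivZ (cderiv_id z). Qed.

Lemma cderiv_subc (c z : C) : cderiv (fun x => x - c) z 1.
Proof. by rewrite -[1]subr0; exact: cderivB (cderiv_id z) (cderiv_cst c z). Qed.

Lemma cderiv_addc (c z : C) : cderiv (fun x => c + x) z 1.
Proof. by rewrite -[1]add0r; exact: cderivD (cderiv_cst c z) (cderiv_id z). Qed.

Lemma cderiv_affine (a b z : C) : cderiv (fun x => a + b * x) z b.
Proof.
move: (cderivD (cderiv_cst a z) (cderivZ b (cderiv_id z))).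
by rewrite add0r mulr1.
Qed.

End Nearby.

Section RealDerivative.
Variable R : realType.

Definition rderiv (f : R -> R) (x l : R) : Prop :=
  forall e : R, 0 < e -> exists2 d : R, 0 < d &
    forall h, `|h| < d -> `|f (x + h) - f x - l * h| <= e * `|h|.

Lemma rderiv_is_derive f x l : rderiv f x l -> is_derive x 1 f l.
Proof.
move=> H.
have cv : h^-1 *: (f (h *: 1 + x) - f x) @[h --> 0^'] --> l.
  apply/cvgrPdist_le => e e0; have [d d0 Hd] := H e e0.
  exists d => //= h; rewrite /ball /= sub0r normrN => hd h0.
  rewrite /GRing.scale /= mulr1 [h + x]addrC.
  have -> : l - h^-1 * (f (x + h) - f x) = - ((f (x + h) - f x - l * h) / h).
    by field.
  by rewrite normrN normrM normfV ler_pdivrMr ?normr_gt0 // Hd.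
by apply: DeriveDef; [apply/cvg_ex; exists l|exact/cvg_lim].
Qed.

Lemma is_derive_rderiv (f : R -> R) (x l : R) : is_derive x 1 f l -> rderiv f x l.
Proof.
move=> [df dv] e e0.
have : h^-1 *: (f (h *: 1 + x) - f x) @[h --> 0^'] --> l by rewrite -dv.
move/cvgrPdist_le => /(_ e e0) [d /= d0 Hd]; exists d => // h hd.
have [->|h0] := eqVneq h 0.
  by rewrite addr0 subrr mulr0 subr0 normr0 mulr0.
have := Hd h; rewrite /ball /= sub0r normrN => /(_ hd h0).
rewrite /GRing.scale /= mulr1 [h + x]addrC.
have -> : l - h^-1 * (f (x + h) - f x) = - ((f (x + h) - f x - l * h) / h).
  by field.
by rewrite normrN normrM normfV ler_pdivrMr ?normr_gt0.
Qed.

Lemma rderiv_continuous f x l : rderiv f x l -> {for x, continuous f}.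
Proof.
move=> /rderiv_is_derive [df _].
exact/differentiable_continuous/derivable1_diffP.
Qed.

Lemma rderiv_MVT f df a b : a <= b ->
  (forall x, a <= x <= b -> rderiv f x (df x)) ->
  exists2 c, a <= c <= b & f b - f a = df c * (b - a).
Proof.
move=> ab H.
have [||c] := @MVT_segment R f df a b ab.
- by move=> x; rewrite in_itv /= => /andP[/ltW ax /ltW xb]; apply/rderiv_is_derive/H; rewrite ax.
- apply: continuous_in_subspaceT => x; rewrite inE /= in_itv /= => /H.
  exact: rderiv_continuous.
- by rewrite in_itv /= => cab E; exists c.
Qed.

End RealDerivative.

Section MeanValue.
Variable R : realType.
Local Notation C := R[i].

Lemma cderiv_line (f : C -> C) (p h c l : C) (s : R) :
  cderiv f (p + (s%:C)%C * h) l ->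
  rderiv (fun s => complex.Re (c * f (p + (s%:C)%C * h))) s (complex.Re (c * (l * h))).
Proof.
move=> H.
have H1 : cderiv (fun w => c * f (p + w * h)) (s%:C)%C (c * (l * h)).
  apply: cderivZ; apply: (@cderiv_comp _ (fun w => p + w * h) f _ h l); last by [].
  by apply: cderiv_sub (cderiv_affine p h _) => w; rewrite mulrC.
move=> e e0; have [d d0 Hd] := H1 e e0; exists d => // k kd.
have := Hd (k%:C)%C; rewrite cabsR => /(_ kd); apply: le_trans.
apply: le_trans (cabs_le_Re _); rewrite -rmorphD /=.
case: (c * f _) => a1 b1; case: (c * f _) => a2 b2; case: (c * (l * h)) => a3 b3 /=.
by rewrite !mulr0 subr0.
Qed.

(** There is no mean value equality for complex values. The real one is applied to [Re (c f)] along
    the segment, where [c] is the conjugate of the total increment [d], so that this real function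
    increases by exactly [|d|^2]. *)
Lemma cderiv_mvt (f f' : C -> C) (p h : C) (M : R) :
  (forall s : R, 0 <= s <= 1 ->
     cderiv f (p + (s%:C)%C * h) (f' (p + (s%:C)%C * h)) /\
     cabs (f' (p + (s%:C)%C * h)) <= M) ->
  cabs (f (p + h) - f p) <= M * cabs h.
Proof.
move=> H; set d := f (p + h) - f p.
have [d0|d0] := eqVneq d 0.
  rewrite d0 cabs0 mulr_ge0 ?cabs_ge0 //.
  by have [|_] := H 0; [rewrite lexx ler01|apply: le_trans; exact: cabs_ge0].
pose c := (conjc d).
have [s /H[_ Hs]] := rderiv_MVT (f := fun s => complex.Re (c * f (p + (s%:C)%C * h))) ler01
  (fun s Hs => cderiv_line c (proj1 (H s Hs))).
rewrite /= mul1r mul0r addr0 subr0 mulr1 => E.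
have E2 : csqabs d = complex.Re (c * (f' (p + (s%:C)%C * h) * h)).
  rewrite -E /c /d; case: (f (p + h)) => a1 b1; case: (f p) => a2 b2.
  by rewrite /csqabs /=; ring.
have : csqabs d <= cabs d * (M * cabs h).
  rewrite E2; apply: le_trans (ler_norm _) _; apply: le_trans (cabs_le_Re _) _.
  rewrite !cabsM; have -> : cabs c = cabs d by rewrite /cabs /c; case: (d) => a b; rewrite /csqabs /= sqrrN.
  by rewrite ler_wpM2l ?cabs_ge0 // ler_wpM2r ?cabs_ge0.
by rewrite -sqr_cabs expr2 ler_pM2l // cabs_gt0.
Qed.

End MeanValue.

(** * Nested rectangles *)

Section Bisection.
Variable R : realType.

Variable P : R -> R -> R -> R -> Prop.
Hypothesis Pquarter : forall x y p q, 0 < p -> 0 < q -> P x y p q ->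
  exists b : bool * bool, P (x + b.1%:R * (p / 2)) (y + b.2%:R * (q / 2)) (p / 2) (q / 2).

(** A property of rectangles that always passes to one of the four quarters concentrates at a point.
    It serves twice: for the existence of maxima and for Goursat's theorem. *)
Lemma bisection x0 y0 p0 q0 : 0 < p0 -> 0 < q0 -> P x0 y0 p0 q0 ->
  exists X Y, [/\ x0 <= X <= x0 + p0, y0 <= Y <= y0 + q0 &
    forall d : R, 0 < d -> exists x y p q, [/\ P x y p q, x0 <= x, x + p <= x0 + p0,
      y0 <= y & y + q <= y0 + q0] /\ [/\ x <= X <= x + p, y <= Y <= y + q, 0 < p, 0 < q & p + q < d]].
Proof.
move=> p00 q00 P0.
have pn n : 0 < p0 / 2 ^+ n by rewrite divr_gt0 // exprn_gt0.
have qn n : 0 < q0 / 2 ^+ n by rewrite divr_gt0 // exprn_gt0.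
pose St n := {xy : R * R | P xy.1 xy.2 (p0 / 2 ^+ n) (q0 / 2 ^+ n)}.
have step n (s : St n) : {s' : St n.+1 | [/\ (sval s).1 <= (sval s').1,
   (sval s').1 + p0 / 2 ^+ n.+1 <= (sval s).1 + p0 / 2 ^+ n, (sval s).2 <= (sval s').2 &
   (sval s').2 + q0 / 2 ^+ n.+1 <= (sval s).2 + q0 / 2 ^+ n]}.
  case: s => -[x y] Ps; apply: cid => /=.
  have [[b1 b2] /= Hb] := Pquarter (pn n) (qn n) Ps.
  have E z : z / 2 ^+ n / 2 = z / 2 ^+ n.+1 :> R by rewrite exprSr invfM mulrA.
  rewrite !E in Hb; exists (exist _ (_, _) Hb) => /=.
  rewrite -!E; move: (pn n) (qn n); rewrite /=.
  by move: (p0 / 2 ^+ n) (q0 / 2 ^+ n) => p q; case: (b1); case: (b2) => /=; split; lra.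
have P0' : P (x0, y0).1 (x0, y0).2 (p0 / 2 ^+ 0) (q0 / 2 ^+ 0) by rewrite !expr0 !divr1.
pose s := fix s n : St n := if n is m.+1 then sval (step m (s m)) else exist _ (x0, y0) P0'.
pose xs n := (sval (s n)).1; pose ys n := (sval (s n)).2.
have xsS n : xs n <= xs n.+1 /\ xs n.+1 + p0 / 2 ^+ n.+1 <= xs n + p0 / 2 ^+ n.
  by rewrite /xs /=; case: (step n (s n)) => s' [].
have ysS n : ys n <= ys n.+1 /\ ys n.+1 + q0 / 2 ^+ n.+1 <= ys n + q0 / 2 ^+ n.
  by rewrite /ys /=; case: (step n (s n)) => s' [].
(* Nested intervals in one coordinate, used for both: the supremum of the left ends lies in every
   interval. *)
have key (u : nat -> R) (r : R) : (forall n, u n <= u n.+1 /\ u n.+1 + r / 2 ^+ n.+1 <= u n + r / 2 ^+ n) ->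
    (forall n, 0 < r / 2 ^+ n) ->
    exists U, forall n, u n <= U <= u n + r / 2 ^+ n.
  move=> Hu r0.
  have mono n k : u n <= u (n + k)%N.
    elim: k => [|k IH]; first by rewrite addn0.
    by apply: le_trans IH _; rewrite addnS; case: (Hu (n + k)%N).
  have mono2 n k : u (n + k)%N + r / 2 ^+ (n + k) <= u n + r / 2 ^+ n.
    elim: k => [|k IH]; first by rewrite addn0.
    by apply: le_trans IH; rewrite addnS; case: (Hu (n + k)%N).
  have ub n m : u m <= u n + r / 2 ^+ n.
    case: (leqP n m) => [/subnKC <-|/ltnW /subnKC E].
      by apply: le_trans (mono2 n (m - n)%N); rewrite lerDl ltW.
    by apply: (@le_trans _ _ (u n)); [rewrite -E|rewrite lerDl ltW].
  exists (sup (range u)) => n; apply/andP; split.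
    by apply: ub_le_sup; [exists (u 0 + r / 2 ^+ 0) => _ [m _ <-]|exists n].
  by apply: ge_sup; [exists (u 0), 0|move=> _ [m _ <-]].
have [X HX] := key xs p0 xsS pn; have [Y HY] := key ys q0 ysS qn.
have inx n : x0 <= xs n /\ xs n + p0 / 2 ^+ n <= x0 + p0.
  elim: n => [|n [I1 I2]]; first by rewrite expr0 divr1.
  by have [H1 H2] := xsS n; split; [exact: le_trans H1|exact: le_trans I2].
have iny n : y0 <= ys n /\ ys n + q0 / 2 ^+ n <= y0 + q0.
  elim: n => [|n [I1 I2]]; first by rewrite expr0 divr1.
  by have [H1 H2] := ysS n; split; [exact: le_trans H1|exact: le_trans I2].
exists X, Y; split.
- by have := HX 0; rewrite expr0 divr1.
- by have := HY 0; rewrite expr0 divr1.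
move=> d d0.
have [n Hn] : exists n, p0 / 2 ^+ n + q0 / 2 ^+ n < d.
  (* This [n] exceeds [(p0 + q0) / d], and [n < 2 ^ n]. *)
  exists (Num.truncn ((p0 + q0) / d)).+1; rewrite -mulrDl.
  have pq : 0 < p0 + q0 by rewrite addr_gt0.
  rewrite ltr_pdivrMr ?exprn_gt0 // mulrC -ltr_pdivrMr //.
  apply: lt_trans (_ : _ < (Num.truncn ((p0 + q0) / d)).+1%:R) _; first exact: truncnS_gt.
  by rewrite -natrX ltr_nat ltn_expl.
exists (xs n), (ys n), (p0 / 2 ^+ n), (q0 / 2 ^+ n).
have [I1 I2] := inx n; have [I3 I4] := iny n.
by split; split => //; exact: (svalP (s n)).
Qed.

End Bisection.

(** * Maxima on closed bounded sets *)

Section Extremum.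
Variable R : realType.
Local Notation C := R[i].

(** Bisection applies to the property that inside the rectangle [v] reaches, on [S], every level
    that it reaches on [S] at all. If each quarter failed, with a witness each, the largest of the
    four witnesses would contradict the property of the whole rectangle. Upper semicontinuity is the
    right assumption, because the function maximised for the two metrics jumps. *)
Lemma compact_max (S : C -> Prop) (v : C -> R) (B : R) :
  (exists t, S t) -> (forall t, S t -> cabs t <= B) ->
  (forall p, (forall d : R, 0 < d -> exists2 t, S t & cabs (t - p) < d) -> S p) ->
  (forall p, S p -> forall e : R, 0 < e ->
     exists2 d : R, 0 < d & forall t, S t -> cabs (t - p) < d -> v t < v p + e) ->
  exists2 p, S p & forall t, S t -> v t <= v p.
Proof.
move=> [t0 S0] SB Scl vc.
pose P x y p q := forall t, S t -> exists t', [/\ S t', x <= complex.Re t' <= x + p,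
  y <= complex.Im t' <= y + q & v t <= v t'].
have Pq x y p q : 0 < p -> 0 < q -> P x y p q ->
    exists b : bool * bool, P (x + b.1%:R * (p / 2)) (y + b.2%:R * (q / 2)) (p / 2) (q / 2).
  move=> p0 q0 HP; apply: contrapT => /forallNP H.
  have Hb (b : bool * bool) : exists2 t, S t & forall t', S t' ->
      x + b.1%:R * (p / 2) <= complex.Re t' <= x + b.1%:R * (p / 2) + p / 2 ->
      y + b.2%:R * (q / 2) <= complex.Im t' <= y + b.2%:R * (q / 2) + q / 2 -> v t' < v t.
    move/existsNP: (H b) => [t /not_implyP[St Ht]]; exists t => // t' St' Hx Hy.
    by rewrite ltNge; apply/negP => Hv; apply: Ht; exists t'.
  have [t1 S1 H1] := Hb (false, false); have [t2 S2 H2] := Hb (false, true).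
  have [t3 S3 H3] := Hb (true, false); have [t4 S4 H4] := Hb (true, true).
  have mx s t : S s -> S t -> exists2 u, S u & v s <= v u /\ v t <= v u.
    by move=> Ss St; case: (leP (v s) (v t)) => [|/ltW] H'; [exists t|exists s].
  have [u Su [u1 u2]] := mx _ _ S1 S2; have [w Sw [w1 w2]] := mx _ _ S3 S4.
  have [z Sz [z1 z2]] := mx _ _ Su Sw.
  have [t' [St' /andP[a1 a2] /andP[b1 b2] Hv]] := HP z Sz.
  have ax : x <= complex.Re t' <= x + p / 2 \/ x + p / 2 <= complex.Re t' <= x + p.
    by case: (leP (complex.Re t') (x + p / 2)) => [h|/ltW h]; [left|right]; apply/andP.
  have ay : y <= complex.Im t' <= y + q / 2 \/ y + q / 2 <= complex.Im t' <= y + q.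
    by case: (leP (complex.Im t') (y + q / 2)) => [h|/ltW h]; [left|right]; apply/andP.
  move: (H1 t' St') (H2 t' St') (H3 t' St') (H4 t' St') => /=.
  rewrite !mul0r !mul1r !addr0 -!addrA -!splitr.
  have no s : v t' < v s -> v s <= v z -> False.
    by move=> lt1 le1; have := lt_le_trans lt1 (le_trans le1 Hv); rewrite ltxx.
  case: ax => ax; case: ay => ay h1 h2 h3 h4.
  - exact: no (h1 ax ay) (le_trans u1 z1).
  - exact: no (h2 ax ay) (le_trans u2 z1).
  - exact: no (h3 ax ay) (le_trans w1 z2).
  - exact: no (h4 ax ay) (le_trans w2 z2).
have B0 : 0 <= B by apply: le_trans (SB _ S0); exact: cabs_ge0.
have [|||X [Y [_ _ HXY]]] := bisection Pq (x0 := - B - 1) (y0 := - B - 1) (p0 := 2 * B + 2) (q0 := 2 * B + 2).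
- by lra.
- by lra.
- move=> t St; exists t; split => //.
    by have := le_trans (cabs_le_Re t) (SB t St); rewrite ler_norml => /andP[? ?]; lra.
  by have := le_trans (cabs_le_Im t) (SB t St); rewrite ler_norml => /andP[? ?]; lra.
pose p := Complex X Y.
have Hp d : 0 < d -> forall t, S t -> exists t', [/\ S t', cabs (t' - p) < d & v t <= v t'].
  move=> d0 t St; have [x [y [a [b [[HP _ _ _ _] [X1 Y1 a0 b0 ab]]]]]] := HXY d d0.
  have [t' [St' H1 H2 Hv]] := HP t St; exists t'; split => //.
  apply: le_lt_trans ab; apply: le_trans (cabs_le_ReIm _) _.
  move: H1 H2 X1 Y1; case: (t') => c1 c2 /= /andP[? ?] /andP[? ?] /andP[? ?] /andP[? ?].
  by apply: lerD; rewrite ler_norml; lra.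
have Sp : S p.
  by apply: Scl => d d0; have [t' [St' H _]] := Hp d d0 t0 S0; exists t'.
exists p => // t St; apply/ler_addgt0Pr => e e0.
have [d d0 Hd] := vc p Sp e e0; have [t' [St' H Hv]] := Hp d d0 t St.
by apply: le_trans Hv _; apply/ltW/Hd.
Qed.

Lemma cball_bounded (f : C -> C) (a : C) (r : R) : 0 <= r ->
  (forall t, cabs (t - a) <= r -> ccont f t) ->
  exists2 M, 0 <= M & forall t, cabs (t - a) <= r -> cabs (f t) <= M.
Proof.
move=> r0 Hf.
have [||||p Sp Hp] := @compact_max (fun t => cabs (t - a) <= r) (fun t => cabs (f t)) (r + cabs a).
- by exists a; rewrite subrr cabs0.
- by move=> t Ht; rewrite -[t](subrK a); apply: le_trans (cabsD _ _) _; rewrite lerD2r.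
- move=> p Hp; apply/ler_addgt0Pr => e e0; have [t Ht /ltW Ht2] := Hp e e0.
  by apply: le_trans (cabs_distD t _ _) _; rewrite addrC lerD // cabsBC.
- move=> p Hp e e0; have [d d0 Hd] := Hf p Hp e e0; exists d => // t _ Ht.
  have := Hd _ Ht; rewrite [p + _]addrC subrK => H.
  rewrite -[f t](subrK (f p)); apply: le_lt_trans (cabsD _ _) _.
  by rewrite addrC ltrD2l.
by exists (cabs (f p)) => //; exact: cabs_ge0.
Qed.

End Extremum.

(** * Integrals of complex functions of a real variable *)

Section ComplexIntegral.
Variable R : realType.
Local Notation C := R[i].
Implicit Types f g : R -> C.

(** The points [x + k] may leave the interval: continuity is two-sided even at the ends, which suits
    paths coming from functions continuous at each point of a closed set in the plane. *)
Definition pcont f (a b : R) : Prop := forall x, a <= x <= b ->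
  forall e : R, 0 < e -> exists2 d : R, 0 < d & forall k, `|k| < d -> cabs (f (x + k) - f x) < e.

Lemma pcontB f g a b : pcont f a b -> pcont g a b -> pcont (fun s => f s - g s) a b.
Proof.
move=> Hf Hg s Hs e e1; have e2 : 0 < e / 2 by rewrite divr_gt0.
have [d1 d10 H1] := Hf s Hs _ e2; have [d2 d20 H2] := Hg s Hs _ e2.
exists (Num.min d1 d2); first by rewrite lt_min d10.
move=> k; rewrite lt_min => /andP[/H1 k1 /H2 k2].
rewrite (_ : _ - _ = (f (s + k) - f s) - (g (s + k) - g s)); last by ring.
by apply: le_lt_trans (cabsB _ _) _; rewrite [e]splitr ltrD.
Qed.

Lemma pcont_cont (F : C -> R) f a b : pcont f a b ->
  (forall x y, `|F x - F y| <= cabs (x - y)) ->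
  {within `[a, b], continuous (F \o f)}.
Proof.
move=> Hf HF; apply: continuous_in_subspaceT => x; rewrite inE /= in_itv /= => Hx.
apply/cvgrPdist_lt => e e0; have [d d0 Hd] := Hf x Hx e e0.
exists d => //= y; rewrite /ball /= => Hy.
apply: le_lt_trans (HF _ _) _; rewrite cabsBC.
by have := Hd (y - x); rewrite [x + _]addrC subrK distrC; apply.
Qed.

Lemma Re_lip (x y : C) : `|complex.Re x - complex.Re y| <= cabs (x - y).
Proof. by apply: le_trans (cabs_le_Re _); case: x; case: y. Qed.

Lemma Im_lip (x y : C) : `|complex.Im x - complex.Im y| <= cabs (x - y).
Proof. by apply: le_trans (cabs_le_Im _); case: x; case: y. Qed.

Local Notation mu := (@lebesgue_measure R).
Definition rint (a b : R) (f : R -> R) : R := \int[mu]_(x in `[a, b]) f x.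

Definition cint (a b : R) f : C :=
  Complex (rint a b (fun x => complex.Re (f x))) (rint a b (fun x => complex.Im (f x))).

Lemma pcont_integrable (F : C -> R) f a b : pcont f a b ->
  (forall x y, `|F x - F y| <= cabs (x - y)) ->
  mu.-integrable `[a, b] (EFin \o (fun x => F (f x))).
Proof.
move=> Hf HF; apply: continuous_compact_integrable; first exact: segment_compact.
exact: (pcont_cont Hf HF).
Qed.

Lemma cintB f g a b : pcont f a b -> pcont g a b ->
  cint a b (fun x => f x - g x) = cint a b f - cint a b g.
Proof.
move=> Hf Hg.
have E : forall F : C -> R, (forall x y, `|F x - F y| <= cabs (x - y)) ->
   (forall x y, F (x - y) = F x - F y) ->
   rint a b (fun x => F (f x - g x)) = rint a b (fun x => F (f x)) - rint a b (fun x => F (g x)).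
  move=> F HF FB; rewrite /rint -RintegralB //; try exact: pcont_integrable.
  by apply: eq_Rintegral => x _; rewrite FB.
rewrite /cint (E _ Re_lip) ?(E _ Im_lip) //.
  by move=> x y; case: x; case: y.
by move=> x y; case: x; case: y.
Qed.

Lemma rint_integrableZ (u : R -> R) c a b : mu.-integrable `[a, b] (EFin \o u) ->
  mu.-integrable `[a, b] (EFin \o (fun x => c * u x)).
Proof.
move=> Iu; have -> : EFin \o (fun x => c * u x) = (fun x => c%:E * (EFin \o u) x)%E.
  by apply: funext => x /=; rewrite EFinM.
exact: integrableZl.
Qed.

Lemma cintZ f c a b : pcont f a b -> cint a b (fun x => c * f x) = c * cint a b f.
Proof.
move=> Hf; have I1 := pcont_integrable Hf Re_lip; have I2 := pcont_integrable Hf Im_lip.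
case: c => c d; rewrite /cint /rint.
have E1 : \int[mu]_(x in `[a, b]) complex.Re (Complex c d * f x) =
    c * (\int[mu]_(x in `[a, b]) complex.Re (f x)) - d * (\int[mu]_(x in `[a, b]) complex.Im (f x)).
  rewrite -!RintegralZl // -RintegralB //; try exact: rint_integrableZ.
  by apply: eq_Rintegral => x _; case: (f x).
have E2 : \int[mu]_(x in `[a, b]) complex.Im (Complex c d * f x) =
    c * (\int[mu]_(x in `[a, b]) complex.Im (f x)) + d * (\int[mu]_(x in `[a, b]) complex.Re (f x)).
  rewrite -!RintegralZl // -RintegralD //; try exact: rint_integrableZ.
  by apply: eq_Rintegral => x _; case: (f x).
by rewrite E1 E2.
Qed.

Lemma rint_bnd (u : R -> R) a b c M : a <= b -> mu.-integrable `[a, b] (EFin \o u) ->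
  (forall x, a <= x <= b -> `|u x - c| <= M) -> `|rint a b u - c * (b - a)| <= M * (b - a).
Proof.
move=> ab Iu Hu.
have cst k : rint a b (fun=> k) = k * (b - a).
  rewrite /rint Rintegral_cst //= lebesgue_measure_itv /= lte_fin.
  have [//|ba] := ltP a b; rewrite (_ : a = b) ?subrr //.
  by apply/le_anti; rewrite ab ba.
have icst k : mu.-integrable `[a, b] (EFin \o (fun=> k)).
  by apply: continuous_compact_integrable; [exact: segment_compact|move=> x; exact: cst_continuous].
rewrite ler_norml; apply/andP; split.
  rewrite lerBrDr -mulNr -mulrDl -cst; apply: le_Rintegral => // x.
  by rewrite /= in_itv /= => /Hu; rewrite ler_norml lerBrDr => /andP[].
rewrite lerBlDr -mulrDl -cst; apply: le_Rintegral => // x.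
by rewrite /= in_itv /= => /Hu; rewrite ler_norml lerBlDr => /andP[].
Qed.

(** The factor 2 is the price of estimating the real and the imaginary part separately. It
    propagates into the constants of all Cauchy estimates. *)
Lemma cint_bnd f a b c M : a <= b -> pcont f a b ->
  (forall x, a <= x <= b -> cabs (f x - c) <= M) ->
  cabs (cint a b f - c * ((b - a)%:C)%C) <= 2 * M * (b - a).
Proof.
move=> ab Hf Hc; apply: le_trans (cabs_le_ReIm _) _.
have H1 := rint_bnd ab (pcont_integrable Hf Re_lip) (fun x Hx => le_trans (Re_lip _ _) (Hc x Hx)).
have H2 := rint_bnd ab (pcont_integrable Hf Im_lip) (fun x Hx => le_trans (Im_lip _ _) (Hc x Hx)).
rewrite -mulrA mulr_natl mulr2n; apply: lerD.
  by move: H1; congr (_ <= _); congr (`| _ |); case: (c) => x y /=; rewrite mulr0 subr0.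
by move: H2; congr (_ <= _); congr (`| _ |); case: (c) => x y /=; rewrite mulr0 add0r.
Qed.

Lemma cint_bnd0 f a b M : a <= b -> pcont f a b ->
  (forall x, a <= x <= b -> cabs (f x) <= M) -> cabs (cint a b f) <= 2 * M * (b - a).
Proof.
move=> ab Hf HM; have := cint_bnd (c := 0) ab Hf; rewrite mul0r subr0; apply.
by move=> x /HM; rewrite subr0.
Qed.

Lemma rint_split (u : R -> R) a b c : a <= c -> c <= b -> mu.-integrable `[a, b] (EFin \o u) ->
  rint a b u = rint a c u + rint c b u.
Proof.
move=> ac cb Iu; rewrite /rint; apply/eqP; rewrite addrC -subr_eq; apply/eqP.
rewrite (@Rintegral_itvB _ _ (BLeft a) (BRight b) c) // ?bnd_simp //.
rewrite Rintegral_itv_obnd_cbnd //; apply: integrableS Iu => //.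
by apply: subset_itvr; rewrite bnd_simp.
Qed.

Lemma cint_split f a b c : a <= c -> c <= b -> pcont f a b ->
  cint a b f = cint a c f + cint c b f.
Proof.
move=> ac cb Hf; rewrite /cint (rint_split ac cb (pcont_integrable Hf Re_lip)).
by rewrite (rint_split ac cb (pcont_integrable Hf Im_lip)).
Qed.

Lemma eq_cint f g a b : (forall x, a <= x <= b -> f x = g x) -> cint a b f = cint a b g.
Proof.
move=> H; rewrite /cint /rint; congr Complex; apply: eq_Rintegral => x;
  by rewrite inE /= in_itv /= => /H ->.
Qed.

End ComplexIntegral.

(** * Goursat's theorem and its consequences *)

Section Goursat.
Variable R : realType.
Local Notation C := R[i].
Variable F : C -> C.

Definition rect (x y p q : R) (w : C) : Prop :=
  x <= complex.Re w <= x + p /\ y <= complex.Im w <= y + q.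

(** The counterclockwise contour integral of [F dz]: bottom minus top, and right minus left with
    [dz = i dt]. *)
Definition bdry (x y p q : R) : C :=
  cint x (x + p) (fun s => F (Complex s y)) - cint x (x + p) (fun s => F (Complex s (y + q)))
  + 'i%C * (cint y (y + q) (fun t => F (Complex (x + p) t)) - cint y (y + q) (fun t => F (Complex x t))).

Lemma rectW x0 y0 p0 q0 x y p q w : x0 <= x -> x + p <= x0 + p0 -> y0 <= y ->
  y + q <= y0 + q0 -> rect x y p q w -> rect x0 y0 p0 q0 w.
Proof.
move=> hx hp hy hq [/andP[a b] /andP[c d]]; split; apply/andP; split.
- exact: le_trans a.
- exact: le_trans hp.
- exact: le_trans c.
- exact: le_trans hq.
Qed.

Lemma rect_edges x y p q s : 0 <= p -> 0 <= q ->
  (x <= s <= x + p -> rect x y p q (Complex s y) /\ rect x y p q (Complex s (y + q))) /\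
  (y <= s <= y + q -> rect x y p q (Complex x s) /\ rect x y p q (Complex (x + p) s)).
Proof. by move=> p0 q0; split=> H; split; split => //=; rewrite ?lexx ?lerDl ?p0 ?q0. Qed.

Lemma ccont_pcont_h (y a b : R) : (forall s, a <= s <= b -> ccont F (Complex s y)) ->
  pcont (fun s => F (Complex s y)) a b.
Proof.
move=> H x Hx e e0; have [d d0 Hd] := H x Hx e e0; exists d => // k Hk.
have := Hd (Complex k 0); rewrite -[Complex k 0]/((k%:C)%C) cabsR => /(_ Hk).
by rewrite (_ : Complex x y + _ = Complex (x + k) y) //; apply/eqP; rewrite eq_complex /= addr0 !eqxx.
Qed.

Lemma ccont_pcont_v (x a b : R) : (forall t, a <= t <= b -> ccont F (Complex x t)) ->
  pcont (fun t => F (Complex x t)) a b.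
Proof.
move=> H y Hy e e0; have [d d0 Hd] := H y Hy e e0; exists d => // k Hk.
have := Hd (Complex 0 k).
rewrite (_ : cabs _ = `|k|); last by rewrite /cabs /csqabs /= expr0n add0r sqrtr_sqr.
move=> /(_ Hk).
by rewrite (_ : Complex x y + _ = Complex x (y + k)) //; apply/eqP; rewrite eq_complex /= addr0 !eqxx.
Qed.

(** Each inner edge is traversed twice in opposite directions. *)
Lemma bdry_quarter (x y p q : R) : 0 < p -> 0 < q ->
  (forall w, rect x y p q w -> ccont F w) ->
  bdry x y p q = bdry x y (p / 2) (q / 2) + bdry (x + p / 2) y (p / 2) (q / 2)
    + bdry x (y + q / 2) (p / 2) (q / 2) + bdry (x + p / 2) (y + q / 2) (p / 2) (q / 2).
Proof.
move=> p0 q0 H.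
have Hh y' : y <= y' <= y + q -> cint x (x + p) (fun s => F (Complex s y')) =
   cint x (x + p / 2) (fun s => F (Complex s y')) + cint (x + p / 2) (x + p) (fun s => F (Complex s y')).
  move=> Hy; apply: cint_split; try lra.
  by apply: ccont_pcont_h => s Hs; apply: H.
have Hv x' : x <= x' <= x + p -> cint y (y + q) (fun s => F (Complex x' s)) =
   cint y (y + q / 2) (fun s => F (Complex x' s)) + cint (y + q / 2) (y + q) (fun s => F (Complex x' s)).
  move=> Hx; apply: cint_split; try lra.
  by apply: ccont_pcont_v => s Hs; apply: H.
rewrite /bdry -!addrA -!splitr !Hh; try (apply/andP; split; lra).
rewrite !Hv; try (apply/andP; split; lra).
by ring.
Qed.

Theorem goursat (x0 y0 p0 q0 : R) : 0 < p0 -> 0 < q0 ->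
  (forall w, rect x0 y0 p0 q0 w -> exists l, cderiv F w l) ->
  bdry x0 y0 p0 q0 = 0.
Proof.
move=> p00 q00 dF.
have cF w : rect x0 y0 p0 q0 w -> ccont F w.
  by move=> /dF[l]; exact: cderiv_cont.
apply/eqP; rewrite -cabs_eq0; apply/eqP/le_anti; rewrite cabs_ge0 andbT.
(* The bound is quadratic in the size because quartering divides it by 4: if a rectangle exceeds it,
   so does one of its quarters. *)
suff key K : 0 < K -> cabs (bdry x0 y0 p0 q0) <= K * (p0 + q0) ^+ 2.
  apply/ler_addgt0Pl => e e0; rewrite addr0.
  have s0 : 0 < (p0 + q0) ^+ 2 by rewrite exprn_gt0 // addr_gt0.
  by have := key (e / (p0 + q0) ^+ 2); rewrite divr_gt0 // divfK ?gt_eqF //; apply.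
move=> K0; rewrite leNgt; apply/negP => Hbad.
pose P x y p q := [/\ x0 <= x, x + p <= x0 + p0, y0 <= y, y + q <= y0 + q0 &
  K * (p + q) ^+ 2 < cabs (bdry x y p q)].
have Pq x y p q : 0 < p -> 0 < q -> P x y p q ->
    exists b : bool * bool, P (x + b.1%:R * (p / 2)) (y + b.2%:R * (q / 2)) (p / 2) (q / 2).
  move=> p1 q1 [X0 X1 Y0 Y1].
  have sub (b : bool * bool) : [/\ x0 <= x + b.1%:R * (p / 2), x + b.1%:R * (p / 2) + p / 2 <= x0 + p0,
      y0 <= y + b.2%:R * (q / 2) & y + b.2%:R * (q / 2) + q / 2 <= y0 + q0].
    by case: b => -[] [] /=; rewrite ?mul1r ?mul0r; split; lra.
  move=> Hb; apply: contrapT => /forallNP HN.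
  have Hq (b : bool * bool) : cabs (bdry (x + b.1%:R * (p / 2)) (y + b.2%:R * (q / 2)) (p / 2) (q / 2))
      <= K * (p / 2 + q / 2) ^+ 2.
    by rewrite leNgt; apply/negP => Hlt; apply: (HN b); case: (sub b).
  have := Hq (false, false); have := Hq (false, true); have := Hq (true, false); have := Hq (true, true).
  rewrite /= !mul0r !mul1r !addr0 => h1 h2 h3 h4.
  have cF' w : rect x y p q w -> ccont F w by move=> Hw; exact: cF (rectW X0 X1 Y0 Y1 Hw).
  move: Hb; rewrite (bdry_quarter p1 q1 cF') ltNge => /negP; apply.
  have -> : K * (p + q) ^+ 2 = K * (p / 2 + q / 2) ^+ 2 + K * (p / 2 + q / 2) ^+ 2
    + K * (p / 2 + q / 2) ^+ 2 + K * (p / 2 + q / 2) ^+ 2 by field.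
  apply: le_trans (cabsD _ _) _; apply: lerD h1.
  apply: le_trans (cabsD _ _) _; apply: lerD h3.
  exact: le_trans (cabsD _ _) (lerD h4 h2).
have [//|X [Y [HX HY HXY]]] := bisection Pq p00 q00 (x0 := x0) (y0 := y0).
pose w0 := Complex X Y.
have [l Hl] : exists l, cderiv F w0 l by apply: dF.
have e0 : 0 < K / 4 by rewrite divr_gt0.
have [d d0 Hd] := Hl _ e0.
have [x [y [p [q [[[X0 X1 Y0 Y1 HP] _ _ _ _] [Xx Yy p1 q1 pq]]]]]] := HXY d d0.
move: HP; rewrite ltNge => /negP; apply.
have est w : rect x y p q w -> cabs (F w - F w0 - l * (w - w0)) <= K / 4 * (p + q).
  move=> [Hw1 Hw2]; have Hn : cabs (w - w0) <= p + q.
    apply: le_trans (cabs_le_ReIm _) _; case: w Hw1 Hw2 => a b /= Hw1 Hw2.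
    by apply: lerD; rewrite ler_norml; lra.
  have := Hd (w - w0) (le_lt_trans Hn pq); rewrite [w0 + _]addrC subrK => /le_trans; apply.
  by rewrite ler_pM2l.
have cr w : rect x y p q w -> ccont F w by move=> Hw; exact: cF (rectW X0 X1 Y0 Y1 Hw).
have pp := ltW p1; have qq := ltW q1.
have ch y' : y <= y' <= y + q -> pcont (fun s => F (Complex s y')) x (x + p).
  by move=> Hy; apply: ccont_pcont_h => s Hs; apply: cr.
have cv x' : x <= x' <= x + p -> pcont (fun s => F (Complex x' s)) y (y + q).
  by move=> Hx; apply: ccont_pcont_v => s Hs; apply: cr.
have chs : pcont (fun s => F (Complex s y)) x (x + p) /\
    pcont (fun s => F (Complex s (y + q))) x (x + p).
  by split; apply: ch; rewrite lexx ?andbT lerDl.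
have cvs : pcont (fun s => F (Complex x s)) y (y + q) /\
    pcont (fun s => F (Complex (x + p) s)) y (y + q).
  by split; apply: cv; rewrite lexx ?andbT lerDl.
case: chs => ch1 ch2; case: cvs => cv1 cv2.
rewrite /bdry -!cintB //.
have B1 := @cint_bnd _ (fun s => F (Complex s y) - F (Complex s (y + q))) x (x + p)
   (- l * Complex 0 q) (K / 2 * (p + q)).
have B2 := @cint_bnd _ (fun s => F (Complex (x + p) s) - F (Complex x s)) y (y + q)
   (l * Complex p 0) (K / 2 * (p + q)).
(* The affine part of [F] contributes [- l i q p] along the horizontal sides and [i l p q] along the
   vertical ones; these cancel. What is left is the error of each pair of opposite sides: twice
   [K / 4 * (p + q)], doubled again by [cint_bnd]. *)
have -> : forall A B : C, A + 'i%C * B = (A - (- l * Complex 0 q) * ((x + p - x)%:C)%C)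
    + 'i%C * (B - (l * Complex p 0) * ((y + q - y)%:C)%C).
  move=> A B; rewrite [x + p]addrC [y + q]addrC !addrK.
  have E : (Complex 0 q) * (p%:C)%C = 'i%C * (Complex p 0) * (q%:C)%C.
    by apply/eqP; rewrite eq_complex /=; apply/andP; split; apply/eqP; ring.
  rewrite -[- l * _ * _]mulrA E; ring.
apply: le_trans (cabsD _ _) _; rewrite cabsM.
have -> : cabs ('i%C : C) = 1 by rewrite /cabs /csqabs /= expr0n add0r expr1n sqrtr1.
rewrite mul1r.
have -> : K * (p + q) ^+ 2 = 2 * (K / 2 * (p + q)) * (x + p - x) + 2 * (K / 2 * (p + q)) * (y + q - y).
  by field.
have hK : K / 2 * (p + q) = K / 4 * (p + q) + K / 4 * (p + q) by field.
apply: lerD.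
  apply: B1; [by rewrite lerDl|exact: pcontB|].
  move=> s Hs; rewrite hK.
  have -> : F (Complex s y) - F (Complex s (y + q)) - - l * Complex 0 q =
    (F (Complex s y) - F w0 - l * (Complex s y - w0)) -
    (F (Complex s (y + q)) - F w0 - l * (Complex s (y + q) - w0)).
    have -> : Complex 0 q = Complex s (y + q) - Complex s y.
      by apply/eqP; rewrite eq_complex /=; apply/andP; split; apply/eqP; ring.
    by ring.
  have [/(_ Hs)[e1 e2] _] := rect_edges x y s pp qq.
  exact: le_trans (cabsB _ _) (lerD (est _ e1) (est _ e2)).
apply: B2; [by rewrite lerDl|exact: pcontB|].
move=> s Hs; rewrite hK.
have -> : F (Complex (x + p) s) - F (Complex x s) - l * Complex p 0 =
  (F (Complex (x + p) s) - F w0 - l * (Complex (x + p) s - w0)) -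
  (F (Complex x s) - F w0 - l * (Complex x s - w0)).
  have -> : Complex p 0 = Complex (x + p) s - Complex x s.
    by apply/eqP; rewrite eq_complex /=; apply/andP; split; apply/eqP; ring.
  by ring.
have [_ /(_ Hs)[e1 e2]] := rect_edges x y s pp qq.
exact: le_trans (cabsB _ _) (lerD (est _ e2) (est _ e1)).
Qed.

End Goursat.

(** * The complex exponential *)

Section ComplexExponential.
Variable R : realType.
Local Notation C := R[i].

Definition cexp (w : C) : C :=
  Complex (expR (complex.Re w) * cos (complex.Im w)) (expR (complex.Re w) * sin (complex.Im w)).

Lemma cexpD (w h : C) : cexp (w + h) = cexp w * cexp h.
Proof.
case: w => a b; case: h => c d; rewrite /cexp /= expRD cosD sinD.
by apply/eqP; rewrite eq_complex /=; apply/andP; split; apply/eqP; ring.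
Qed.

Lemma csqabs_cexp (w : C) : csqabs (cexp w) = expR (complex.Re w) ^+ 2.
Proof. by rewrite /csqabs /= !exprMn -mulrDr cos2Dsin2 mulr1. Qed.

Lemma cabs_cexp (w : C) : cabs (cexp w) = expR (complex.Re w).
Proof. by rewrite /cabs csqabs_cexp sqrtr_sqr ger0_norm // expR_ge0. Qed.

Lemma cexp_neq0 (w : C) : cexp w != 0.
Proof. by rewrite -cabs_gt0 cabs_cexp expR_gt0. Qed.

Lemma cderiv_cexp (w : C) : cderiv cexp w (cexp w).
Proof.
suff H : cderiv cexp 0 1.
  move=> e e0; have p0 : 0 < cabs (cexp w) by rewrite cabs_gt0 cexp_neq0.
  move: (H _ (divr_gt0 e0 p0)); apply: near0_imp => h.
  have E : cexp 0 = 1 by rewrite /cexp /= expR0 cos0 sin0 mulr0 mulr1.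
  rewrite E add0r mul1r cexpD => Hh.
  rewrite (_ : _ - _ = cexp w * (cexp h - 1 - h)); last by ring.
  by rewrite cabsM; apply: le_trans (ler_wpM2l (ltW p0) Hh) _; rewrite mulrA mulrCA divff ?gt_eqF // mulr1.
move=> e e0.
(* The errors of the real and imaginary parts are at most [4 k n] and [6 k n], hence the 10;
   [k <= 1] gives [expR a <= 3]. *)
have [k [k0 ke k1]] : exists k : R, [/\ 0 < k, k <= e / 10 & k <= 1].
  exists (Num.min (e / 10) 1).
  by rewrite lt_min ltr01 divr_gt0 // !ge_min !lexx orbT.
have [d1 d10 H1] := is_derive_rderiv (is_derive_expR (0 : R)) k0.
have [d2 d20 H2] := is_derive_rderiv (is_derive_cos (0 : R)) k0.
have [d3 d30 H3] := is_derive_rderiv (is_derive_sin (0 : R)) k0.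
exists (Num.min (Num.min d1 d2) (Num.min d3 k)); first by rewrite !lt_min d10 d20 d30 k0.
case=> a b; rewrite !lt_min => /andP[/andP[h1 h2] /andP[h3 h4]].
have Ha := cabs_le_Re (Complex a b); have Hb := cabs_le_Im (Complex a b).
move: Ha Hb h1 h2 h3 h4; set n := cabs _ => /= Ha Hb h1 h2 h3 h4.
have := H1 a (le_lt_trans Ha h1); have := H2 b (le_lt_trans Hb h2); have := H3 b (le_lt_trans Hb h3).
rewrite !add0r expR0 cos0 sin0 oppr0 mul0r !mul1r !subr0 ?addr0.
move=> S1 S2 S3.
apply: le_trans (cabs_le_ReIm _) _; rewrite /cexp /= expR0 cos0 sin0 mulr1 mulr0 subr0.
have an := normr_ge0 a; have bn := normr_ge0 b.
have E0 : expR a <= 3.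
  have : expR a - 1 - a <= k * `|a| by apply: le_trans S3; exact: ler_norm.
  have := ler_norm a; nra.
have E1 := expR_ge0 a.
have T1 : `|expR a * cos b - 1 - a| <= 4 * k * n.
  have -> : expR a * cos b - 1 - a = (expR a - 1 - a) + expR a * (cos b - 1) by ring.
  apply: le_trans (ler_normD _ _) _; rewrite normrM (ger0_norm E1).
  have : expR a * `|cos b - 1| <= 3 * (k * `|b|) by apply: ler_pM.
  nra.
have T2 : `|expR a * sin b - b| <= 6 * k * n.
  have -> : expR a * sin b - b = (expR a - 1 - a) * b + a * b + expR a * (sin b - b) by ring.
  apply: le_trans (ler_normD _ _) _; apply: le_trans (lerD (ler_normD _ _) (lexx _)) _.
  rewrite !normrM (ger0_norm E1).
  have : expR a * `|sin b - b| <= 3 * (k * `|b|) by apply: ler_pM.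
  have : `|expR a - 1 - a| * `|b| <= (k * `|a|) * `|b| by apply: ler_pM.
  have : `|a| * `|b| <= k * `|b| by apply: ler_pM => //; apply: le_trans Ha (ltW h4).
  have : (k * `|a|) * `|b| <= k * 1 * `|b|.
    by rewrite ler_wpM2r // ler_wpM2l ?(ltW k0) //; apply: le_trans Ha (le_trans (ltW h4) k1).
  nra.
apply: le_trans (lerD T1 T2) _.
have n0 : 0 <= n by exact: cabs_ge0.
nra.
Qed.

End ComplexExponential.

(** * Cauchy's formula for the derivative *)

Section CauchyDerivative.
Variable R : realType.
Local Notation C := R[i].

Definition circ (r t : R) : C := Complex (r * cos t) (r * sin t).

Lemma cabs_circ r t : 0 <= r -> cabs (circ r t) = r.
Proof.
move=> r0; rewrite /cabs /csqabs /= !exprMn -mulrDr cos2Dsin2 mulr1.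
by rewrite sqrtr_sqr ger0_norm.
Qed.

Lemma circ_neq0 r t : 0 < r -> circ r t != 0.
Proof. by move=> r0; rewrite -cabs_gt0 cabs_circ // ltW. Qed.

Lemma pcont_comp (g : R -> C) (F : C -> C) a b : pcont g a b ->
  (forall t, a <= t <= b -> ccont F (g t)) -> pcont (fun t => F (g t)) a b.
Proof.
move=> Hg HF x Hx e e0; have [d d0 Hd] := HF x Hx e e0.
have [d' d'0 Hd'] := Hg x Hx d d0; exists d' => // k /Hd' /Hd.
by rewrite [g x + _]addrC subrK.
Qed.

Lemma pcontZ (g : R -> C) (c : C) a b : pcont g a b -> pcont (fun t => c * g t) a b.
Proof.
move=> Hg; apply: (@pcont_comp g (fun x => c * x)) => // t _.
by apply: ccontM; [exact: ccont_cst|exact: ccont_id].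
Qed.

Lemma pcont_circ r a b : pcont (circ r) a b.
Proof.
move=> x _ e e0.
have K0 : 0 < 2 * `|r| + 1 by rewrite ltr_pwDr // mulr_ge0.
have e1 : 0 < e / (2 * `|r| + 1) by rewrite divr_gt0.
have /cvgrPdist_lt /(_ _ e1) [d1 /= d10 H1] := @continuous_cos R x.
have /cvgrPdist_lt /(_ _ e1) [d2 /= d20 H2] := @continuous_sin R x.
exists (Num.min d1 d2); first by rewrite lt_min d10.
move=> k; rewrite lt_min => /andP[k1 k2].
have := H1 (x + k); have := H2 (x + k); rewrite /ball /= opprD addNKr normrN => /(_ k2) h2 /(_ k1) h1.
apply: le_lt_trans (cabs_le_ReIm _) _; rewrite /circ /= -!mulrBr !normrM.
rewrite distrC [X in _ + _ * X]distrC -mulrDr.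
apply: (@le_lt_trans _ _ (`|r| * (2 * (e / (2 * `|r| + 1))))).
  by apply: ler_wpM2l => //; rewrite mulr_natl mulr2n; apply/ltW/ltrD.
have nr := normr_ge0 r; rewrite !mulrA ltr_pdivrMr //; move: (`|r|) nr e0 => u; nra.
Qed.

Variables (f : C -> C) (z : C).

Local Notation Q x := ((f (z + x) - f z) / x).

Lemma ccont_shift (g : C -> C) (w x : C) : ccont g (w + x) -> ccont (fun x => g (w + x)) x.
Proof. by move=> H e e0; move: (H e e0); apply: near0_imp => h; rewrite addrA. Qed.

Lemma ccont_slope x : x != 0 -> ccont f (z + x) -> ccont (fun x => Q x) x.
Proof.
move=> x0 H; apply: ccontM.
  by apply: ccontD; [exact: ccont_shift|exact: ccont_cst].
by apply: ccontV => //; exact: ccont_id.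
Qed.

(* The logarithmic change of variables [zeta = exp w] turns concentric circles
   into parallel segments, so that Goursat applies on a rectangle. *)
Lemma slope_circles (r s : R) : 0 < s < r ->
  (forall w, cabs (w - z) <= r -> exists l, cderiv f w l) ->
  cint 0 (2 * pi) (fun t => Q (circ r t)) = cint 0 (2 * pi) (fun t => Q (circ s t)).
Proof.
move=> /andP[s0 sr] df; have r0 := lt_trans s0 sr.
have p0 : 0 < 2 * pi :> R by rewrite mulr_gt0 // pi_gt0.
have l0 : 0 < ln r - ln s by rewrite subr_gt0 ltr_ln.
have := goursat (F := fun w => Q (cexp w)) (x0 := ln s) (y0 := 0) l0 p0.
rewrite /bdry /rect; have C0 : ln s + (ln r - ln s) = ln r by rewrite addrC subrK.
rewrite !add0r C0.
(* By periodicity the horizontal sides cancel, and only the two vertical sides, that is the two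
   circles, remain. *)
have per x : cexp (Complex x (2 * pi)) = cexp (Complex x 0).
  by rewrite /cexp /= mulr_natl cos2pi sin2pi cos0 sin0.
rewrite (_ : cint _ _ (fun s0 => Q (cexp (Complex s0 (2 * pi)))) =
  cint (ln s) (ln r) (fun t => Q (cexp (Complex t 0)))); last first.
  by apply: eq_cint => t _; rewrite per.
rewrite subrr add0r => H.
have Er t (u : R) : 0 < u -> cexp (Complex (ln u) t) = circ u t by move=> u0; rewrite /cexp /circ /= lnK.
apply/eqP; rewrite -subr_eq0.
have : 'i%C * (cint 0 (2 * pi) (fun t => Q (circ r t)) - cint 0 (2 * pi) (fun t => Q (circ s t))) = 0 :> C.
  rewrite -[RHS]H; last first.
    move=> w [/andP[Hx1 Hx2] _]; have [|l Hl] := df (z + cexp w).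
    - rewrite addrAC subrr add0r cabs_cexp -[X in _ <= X]lnK ?posrE // ler_expR //.
    exists ((l * 1) * cexp w / cexp w + (f (z + cexp w) - f z) * (- cexp w / cexp w ^+ 2)).
    apply: cderivM; last first.
      apply: cderivV; [exact: cderiv_cexp|exact: cexp_neq0].
    rewrite -[_ * _ * _]subr0; apply: cderivB; last exact: cderiv_cst.
    have Hz : cderiv (fun x => z + x) (cexp w) 1.
      by rewrite -[1]add0r; apply: cderivD; [exact: cderiv_cst|exact: cderiv_id].
    exact: (cderiv_comp (cderiv_cexp w) (cderiv_comp Hz Hl)).
  by congr (_ * (_ - _)); apply: eq_cint => t _; rewrite Er.
by move/eqP; rewrite mulf_eq0 eq_complex /= oner_eq0 andbF.
Qed.

(** The mean of the slope over a circle does not depend on the radius, by [slope_circles], and tends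
    to [l] as the radius shrinks. Working with the slope instead of [f] itself yields the derivative
    directly. *)
Lemma cauchy_derivative (r : R) (l : C) : 0 < r ->
  (forall w, cabs (w - z) <= r -> exists l, cderiv f w l) -> cderiv f z l ->
  cint 0 (2 * pi) (fun t => Q (circ r t)) = l * ((2 * pi)%:C)%C.
Proof.
move=> r0 df Hl.
have p0 : 0 < 2 * pi :> R by rewrite mulr_gt0 // pi_gt0.
apply/eqP; rewrite -subr_eq0 -cabs_eq0; apply/eqP/le_anti; rewrite cabs_ge0 andbT.
apply/ler_addgt0Pl => e e0; rewrite addr0.
have e1 : 0 < e / (2 * (2 * pi)) by rewrite divr_gt0 // mulr_gt0.
have [d d0 Hd] := Hl _ e1.
pose s := Num.min d r / 2.
have m0 : 0 < Num.min d r by rewrite lt_min d0.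
have s0 : 0 < s by rewrite divr_gt0.
have sm : s < Num.min d r by rewrite ltr_pdivrMr // mulr_natr mulr2n ltrDl.
move: (sm); rewrite lt_min => /andP[sd sr].
rewrite (@slope_circles r s) ?s0 //.
rewrite -[X in (X%:C)%C]subr0.
have -> : e = 2 * (e / (2 * (2 * pi))) * (2 * pi - 0).
  by move: (2 * pi) p0 => T T0; rewrite subr0; field; rewrite gt_eqF.
apply: cint_bnd; first exact: ltW.
  apply: (@pcont_comp (circ s) (fun x => Q x)); first exact: pcont_circ.
  move=> t _; apply: ccont_slope; first exact: circ_neq0.
  have [|m Hm] := df (z + circ s t); last exact: cderiv_cont Hm.
  by rewrite addrAC subrr add0r cabs_circ ltW.
move=> t _; have n0 := circ_neq0 t s0.
have := Hd (circ s t); rewrite cabs_circ ?(ltW s0) // => /(_ sd) H.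
rewrite (_ : _ - l = (f (z + circ s t) - f z - l * circ s t) / circ s t); last by field.
by rewrite cabsM cabsV cabs_circ ?(ltW s0) // ler_pdivrMr.
Qed.

End CauchyDerivative.

(** * Cauchy estimates, regularity and Liouville's theorem *)

Section Regularity.
Variable R : realType.
Local Notation C := R[i].

Let T : R := 2 * pi.
Let T0 : 0 < T. Proof. by rewrite mulr_gt0 // pi_gt0. Qed.

Lemma slope_pcont (f : C -> C) (z : C) (r : R) : 0 < r ->
  (forall w, cabs (w - z) <= r -> ccont f w) ->
  pcont (fun t => (f (z + circ r t) - f z) / circ r t) 0 (2 * pi).
Proof.
move=> r0 cf; apply: (@pcont_comp _ (circ r) (fun x => (f (z + x) - f z) / x)).
  exact: pcont_circ.
move=> t _; apply: ccont_slope; first exact: circ_neq0.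
by apply: cf; rewrite addrAC subrr add0r cabs_circ // ltW.
Qed.

(** The slope on the circle is at most [2 M / r]; the other factor 2 is that of [cint_bnd0]. *)
Lemma cauchy_estimate (f : C -> C) (z l : C) (r M : R) : 0 < r ->
  (forall w, cabs (w - z) <= r -> exists l, cderiv f w l) -> cderiv f z l ->
  (forall w, cabs (w - z) <= r -> cabs (f w) <= M) -> cabs l <= 4 * M / r.
Proof.
move=> r0 df Hl HM.
have H := cauchy_derivative r0 df Hl.
have cT : cabs ((T%:C)%C : C) = T by rewrite cabsR gtr0_norm.
rewrite -(ler_pM2r T0) -{1}cT -cabsM -H.
have -> : 4 * M / r * T = 2 * (2 * M / r) * (T - 0) by rewrite subr0; ring.
apply: cint_bnd0; first exact: ltW.
  by apply: slope_pcont => // w /df[m]; exact: cderiv_cont.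
move=> t _; rewrite cabsM cabsV cabs_circ ?(ltW r0) // ler_pM2r ?invr_gt0 //.
apply: le_trans (cabsB _ _) _; rewrite mulr_natl mulr2n; apply: lerD; apply: HM.
  by rewrite addrAC subrr add0r cabs_circ // ltW.
by rewrite subrr cabs0 ltW.
Qed.

Lemma cderiv_lip (f f' : C -> C) (a : C) (r M : R) :
  (forall w, cabs (w - a) <= r -> cderiv f w (f' w) /\ cabs (f' w) <= M) ->
  forall w w', cabs (w - a) <= r -> cabs (w' - a) <= r ->
  cabs (f w' - f w) <= M * cabs (w' - w).
Proof.
move=> H w w' Hw Hw'; rewrite (_ : f w' = f (w + (w' - w))); last by congr f; ring.
apply: (@cderiv_mvt _ f f') => s /andP[s0 s1]; apply: H.
have -> : w + (s%:C)%C * (w' - w) - a = (1 - s)%:C%C * (w - a) + s%:C%C * (w' - a).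
  by rewrite rmorphB rmorph1 /=; ring.
apply: le_trans (cabsD _ _) _; rewrite !cabsM !cabsR !ger0_norm ?subr_ge0 //.
have -> : r = (1 - s) * r + s * r by ring.
by apply: lerD; apply: ler_wpM2l => //; rewrite subr_ge0.
Qed.

(* Cauchy's formula makes [f'] locally bounded, hence [f] and then [f'] locally
   Lipschitz; differentiating under the integral sign then costs O(h^2). *)
Theorem holo_deriv2 (f f' : C -> C) (a : C) (r : R) : 0 < r ->
  (forall w, cabs (w - a) < r -> cderiv f w (f' w)) ->
  exists l : C, exists2 K : R, 0 <= K & forall h, cabs h <= r / 16 ->
    cabs (f' (a + h) - f' a - l * h) <= K * cabs h ^+ 2.
Proof.
(* Nested discs with room for circles of radius [4 p]: [f] is bounded on radius [12 p], [f'] on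
   [8 p], and [f'] is Lipschitz on [4 p], where [fquad] holds. The last formula uses circles of
   radius [p] only. *)
move=> r0 Hd; set p := r / 16; have p0 : 0 < p by rewrite divr_gt0.
have rp : r = 16 * p by rewrite /p; field.
have dfw (c : C) (k : R) : cabs (c - a) + k < r ->
    forall w, cabs (w - c) <= k -> exists l, cderiv f w l.
  move=> Hk w Hw; exists (f' w); apply: Hd; apply: le_lt_trans Hk.
  by apply: le_trans (cabs_distD c _ _) _; rewrite addrC lerD.
have [M M0 HM] : exists2 M, 0 <= M & forall t, cabs (t - a) <= 12 * p -> cabs (f t) <= M.
  apply: cball_bounded; first by lra.
  by move=> t Ht; apply: (cderiv_cont (Hd t _)); lra.
pose L := 4 * M / (4 * p).
have L0 : 0 <= L by rewrite divr_ge0 ?mulr_ge0 // ltW.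
have f'L w : cabs (w - a) <= 8 * p -> cabs (f' w) <= L.
  move=> Hw; apply: (@cauchy_estimate f w); first by lra.
  - by apply: dfw; lra.
  - by apply: Hd; lra.
  - move=> v Hv; apply: HM; apply: le_trans (cabs_distD w _ _) _; lra.
have fL : forall w w', cabs (w - a) <= 8 * p -> cabs (w' - a) <= 8 * p ->
    cabs (f w' - f w) <= L * cabs (w' - w).
  apply: (@cderiv_lip f f') => w Hw; split; last exact: f'L.
  by apply: Hd; lra.
pose K1 := 4 * L / (4 * p).
have K10 : 0 <= K1 by apply: divr_ge0; lra.
have cT : cabs ((T%:C)%C : C) = T by rewrite cabsR gtr0_norm.
have cball (w : C) k t : 0 < k -> cabs (w - a) <= k -> cabs (w + circ k t - a) <= 2 * k.
  move=> k0 Hw; rewrite addrAC; apply: le_trans (cabsD _ _) _.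
  by rewrite cabs_circ ?(ltW k0) //; lra.
have f'lip w w' : cabs (w - a) <= 4 * p -> cabs (w' - a) <= 4 * p ->
    cabs (f' w' - f' w) <= K1 * cabs (w' - w).
  move=> Hw Hw'; have q0 : 0 < 4 * p by lra.
  have dw : forall v, cabs (v - w) <= 4 * p -> exists l, cderiv f v l by apply: dfw; lra.
  have dw' : forall v, cabs (v - w') <= 4 * p -> exists l, cderiv f v l by apply: dfw; lra.
  have E1 := cauchy_derivative q0 dw (Hd w ltac:(lra)).
  have E2 := cauchy_derivative q0 dw' (Hd w' ltac:(lra)).
  rewrite -(ler_pM2r T0) -{1}cT -cabsM mulrBl -E1 -E2 -cintB; last 2 first.
  - by apply: slope_pcont => // v /dw'[m]; exact: cderiv_cont.
  - by apply: slope_pcont => // v /dw[m]; exact: cderiv_cont.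
  have -> : K1 * cabs (w' - w) * T = 2 * (2 * L * cabs (w' - w) / (4 * p)) * (T - 0).
    by rewrite subr0 /K1; field; rewrite gt_eqF.
  apply: cint_bnd0; first exact: ltW.
    by apply: pcontB; apply: slope_pcont => // v; [move/dw'|move/dw] => -[m]; exact: cderiv_cont.
  move=> t _; rewrite -mulrBl cabsM cabsV cabs_circ ?(ltW q0) // ler_pM2r ?invr_gt0 //.
  rewrite (_ : _ - (f (w + circ (4 * p) t) - f w) = (f (w' + circ (4 * p) t) - f (w + circ (4 * p) t)) - (f w' - f w)); last by ring.
  apply: le_trans (cabsB _ _) _.
  have -> : 2 * L * cabs (w' - w) = L * cabs (w' - w) + L * cabs (w' - w) by ring.
  apply: lerD; last first.
    by apply: fL; lra.
  rewrite (_ : w' - w = (w' + circ (4 * p) t) - (w + circ (4 * p) t)); last by ring.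
  by apply: fL; have := cball w (4 * p) t; have := cball w' (4 * p) t; lra.
have fquad w h : cabs (w - a) <= 4 * p -> cabs (w + h - a) <= 4 * p ->
    cabs (f (w + h) - f w - f' w * h) <= K1 * cabs h ^+ 2.
  move=> Hw Hh.
  have -> : f (w + h) - f w - f' w * h = (f (w + h) - f' w * (w + h)) - (f w - f' w * w) by ring.
  rewrite expr2 mulrA; apply: (@cderiv_mvt _ (fun x => f x - f' w * x) (fun x => f' x - f' w)).
  move=> s /andP[s0 s1].
  have Hs : cabs (w + (s%:C)%C * h - a) <= 4 * p.
    have -> : w + (s%:C)%C * h - a = (1 - s)%:C%C * (w - a) + s%:C%C * (w + h - a).
      by rewrite rmorphB rmorph1 /=; ring.
    apply: le_trans (cabsD _ _) _; rewrite !cabsM !cabsR !ger0_norm ?subr_ge0 //.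
    have -> : 4 * p = (1 - s) * (4 * p) + s * (4 * p) by ring.
    by apply: lerD; apply: ler_wpM2l => //; rewrite subr_ge0.
  split.
    apply: cderivB; first by apply: Hd; lra.
    exact: cderiv_scale.
  apply: le_trans (f'lip _ _ Hw Hs) _; apply: ler_wpM2l => //.
  rewrite addrAC subrr add0r cabsM cabsR ger0_norm //.
  by rewrite ler_piMl ?cabs_ge0.
have cf' w : cabs (w - a) < 4 * p -> ccont f' w.
  move=> Hw e e0; have K11 : 0 < K1 + 1 by lra.
  move: (near0_and (near0_ball Hw) (near0_small (divr_gt0 e0 K11))).
  apply: near0_imp => h [H1 H2].
  apply: le_lt_trans (f'lip _ _ (ltW Hw) (ltW H1)) _.
  rewrite addrAC subrr add0r; move: H2; rewrite ltr_pdivlMr //.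
  by have := cabs_ge0 h; nra.
(* The candidate for [f'' (a)]: Cauchy's formula for [f'] at [a], differentiated under the integral
   sign. *)
pose l := cint 0 T (fun t => (f' (a + circ p t) - f' a) / circ p t) / ((T%:C)%C).
have aa : cabs (a - a) = 0 by rewrite subrr cabs0.
have cTn : (T%:C)%C != 0 :> C by rewrite -cabs_eq0 cT gt_eqF.
exists l; exists (4 * K1 / p); first by apply: divr_ge0; lra.
move=> h Hh.
have dw : forall v, cabs (v - a) <= p -> exists l, cderiv f v l by apply: dfw; lra.
have aha : cabs (a + h - a) <= p by rewrite addrAC subrr add0r.
have dw' : forall v, cabs (v - (a + h)) <= p -> exists l, cderiv f v l by apply: dfw; lra.
have E1 := cauchy_derivative p0 dw (Hd a ltac:(lra)).
have E2 := cauchy_derivative p0 dw' (Hd (a + h) ltac:(lra)).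
have C1 : pcont (fun t => (f (a + circ p t) - f a) / circ p t) 0 T.
  by apply: slope_pcont => // v /dw[m]; exact: cderiv_cont.
have C2 : pcont (fun t => (f (a + h + circ p t) - f (a + h)) / circ p t) 0 T.
  by apply: slope_pcont => // v /dw'[m]; exact: cderiv_cont.
have C3 : pcont (fun t => (f' (a + circ p t) - f' a) / circ p t) 0 T.
  by apply: slope_pcont => // v Hv; apply: cf'; lra.
have C4 := pcontZ h C3.
rewrite -(ler_pM2r T0) -{1}cT -cabsM.
have -> : (f' (a + h) - f' a - l * h) * (T%:C)%C =
    cint 0 T (fun t => (f (a + h + circ p t) - f (a + h)) / circ p t -
       (f (a + circ p t) - f a) / circ p t - h * ((f' (a + circ p t) - f' a) / circ p t)).
  rewrite cintB //; last exact: pcontB.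
  rewrite cintB // cintZ // E1 E2 /l !mulrBl; congr (_ - _).
  by move: (cint _ _ _) (T%:C)%C cTn => J c cn; field.
have -> : 4 * K1 / p * cabs h ^+ 2 * T = 2 * (2 * (K1 * cabs h ^+ 2) / p) * (T - 0).
  by rewrite subr0; ring.
apply: cint_bnd0; first exact: ltW.
  by apply: pcontB => //; apply: pcontB.
move=> t _; rewrite mulrA -!mulrBl cabsM cabsV cabs_circ ?(ltW p0) // ler_pM2r ?invr_gt0 //.
rewrite (_ : _ - h * (f' (a + circ p t) - f' a) = (f (a + circ p t + h) - f (a + circ p t) - f' (a + circ p t) * h) -
  (f (a + h) - f a - f' a * h)); last by rewrite [a + h + _]addrAC; ring.
have c1 := cball a p t p0; have c2 := cball (a + h) p t p0.
apply: le_trans (cabsB _ _) _; rewrite mulr_natl mulr2n; apply: lerD; apply: fquad; try lra.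
by rewrite [a + circ p t + h]addrAC; lra.
Qed.

Lemma holo_deriv2_cderiv (f' : C -> C) (a l : C) (r K : R) : 0 < r -> 0 <= K ->
  (forall h, cabs h <= r -> cabs (f' (a + h) - f' a - l * h) <= K * cabs h ^+ 2) ->
  cderiv f' a l.
Proof.
move=> r0 K0 H e e0; have K1 : 0 < K + 1 by lra.
move: (near0_and (near0_small r0) (near0_small (divr_gt0 e0 K1))).
apply: near0_imp => h [h1 h2]; apply: le_trans (H h (ltW h1)) _.
rewrite expr2 mulrA ler_wpM2r ?cabs_ge0 //.
by move: h2; rewrite ltr_pdivlMr //; have := cabs_ge0 h; nra.
Qed.

Theorem holo_holo (f f' : C -> C) (a : C) (r : R) : 0 < r ->
  (forall w, cabs (w - a) < r -> cderiv f w (f' w)) -> exists l, cderiv f' a l.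
Proof.
move=> r0 /(holo_deriv2 r0)[l [K K0 H]]; exists l.
by apply: (holo_deriv2_cderiv _ K0 H); rewrite divr_gt0.
Qed.

(** The mean value inequality for [f] minus its quadratic polynomial: the derivative of the
    difference is the quadratic remainder of [f'] from [holo_deriv2], which gains one power of
    [|h|]. *)
Theorem holo_taylor2 (f f' : C -> C) (a : C) (r : R) : 0 < r ->
  (forall w, cabs (w - a) < r -> cderiv f w (f' w)) ->
  exists q : C, exists K d : R, [/\ 0 <= K, 0 < d & forall h, cabs h <= d ->
    cabs (f (a + h) - (f a + f' a * h + q * h ^+ 2)) <= K * cabs h ^+ 3].
Proof.
move=> r0 Hd; have [l [K K0 H]] := holo_deriv2 r0 Hd.
have p0 : 0 < r / 16 by rewrite divr_gt0.
exists (l / 2), K, (r / 16); split => // h Hh.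
have -> : f (a + h) - (f a + f' a * h + l / 2 * h ^+ 2) =
  (f (a + h) - (f' a * (a + h - a) + l / 2 * (a + h - a) ^+ 2)) -
  (f a - (f' a * (a - a) + l / 2 * (a - a) ^+ 2)) by ring.
rewrite (_ : K * cabs h ^+ 3 = K * cabs h ^+ 2 * cabs h); last by ring.
apply: (@cderiv_mvt _ (fun x => f x - (f' a * (x - a) + l / 2 * (x - a) ^+ 2))
   (fun x => f' x - f' a - l * (x - a))) => s /andP[s0 s1].
have sh : cabs ((s%:C)%C * h) <= cabs h.
  by rewrite cabsM cabsR ger0_norm // ler_piMl ?cabs_ge0.
have E : a + (s%:C)%C * h - a = (s%:C)%C * h by rewrite addrAC subrr add0r.
split.
  rewrite -addrA -opprD; apply: cderivB.
    by apply: Hd; rewrite E; lra.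
  apply: cderivD.
    by have := cderivZ (f' a) (cderiv_subc a (a + (s%:C)%C * h)); rewrite mulr1.
  set z := a + _.
  have -> : l * (z - a) = l / 2 * (1 * (z - a) + (z - a) * 1) by field.
  exact: cderivZ (cderivM (cderiv_subc a z) (cderiv_subc a z)).
rewrite E; apply: le_trans (H _ (le_trans sh Hh)) _; apply: ler_wpM2l => //.
by rewrite ler_pXn2r // nnegrE cabs_ge0.
Qed.

Definition entire (f : C -> C) : Prop := forall z, exists l, cderiv f z l.

Lemma entire_deriv (f : C -> C) : entire f -> exists2 f', (forall z, cderiv f z (f' z)) & entire f'.
Proof.
move=> /choice[f' Hf']; exists f' => // z.
exact: (holo_holo ltr01 (fun w _ => Hf' w)).
Qed.

Lemma cderiv0_cst (f : C -> C) (a : C) (r : R) :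
  (forall w, cabs (w - a) <= r -> cderiv f w 0) -> forall w, cabs (w - a) <= r -> f w = f a.
Proof.
move=> H w Hw; apply/eqP; rewrite -subr_eq0 -cabs_eq0; apply/eqP/le_anti.
rewrite cabs_ge0 andbT -(mul0r (cabs (w - a))).
apply: (cderiv_lip (f' := fun=> 0) (r := r) (a := a)) => //.
  by move=> v Hv; split; [exact: H|rewrite cabs0].
by rewrite subrr cabs0; apply: le_trans Hw; exact: cabs_ge0.
Qed.

Lemma entire_deriv0_cst (f : C -> C) : (forall w, cderiv f w 0) -> forall w, f w = f 0.
Proof.
by move=> H w; apply: (cderiv0_cst (r := cabs (w - 0))).
Qed.

Theorem liouville (f : C -> C) (M : R) : entire f -> (forall z, cabs (f z) <= M) ->
  forall z, f z = f 0.
Proof.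
move=> ef HM; apply: entire_deriv0_cst => w; have [l Hl] := ef w.
suff -> : 0 = l by [].
apply/esym/eqP; rewrite -cabs_eq0; apply/eqP/le_anti; rewrite cabs_ge0 andbT.
have M0 : 0 <= M by apply: le_trans (HM 0); exact: cabs_ge0.
apply/ler_addgt0Pl => e e0; rewrite addr0.
have M1 : 0 < 4 * (M + 1) by lra.
(* On a circle of radius [4 (M + 1) / e] the estimate reads [|l| <= e]. Passing from [M] to [M + 1]
   keeps the radius positive. *)
have := @cauchy_estimate f w l _ (M + 1) (divr_gt0 M1 e0).
rewrite invf_div mulrCA divff ?gt_eqF // mulr1; apply => // v _.
by apply: le_trans (HM v) _; rewrite lerDl.
Qed.

(* The slope is bounded by Cauchy's estimate, hence constant by Liouville. *)
Theorem entire_linear_growth (f : C -> C) (K : R) : entire f ->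
  (forall z, cabs (f z) <= K * (1 + cabs z)) -> exists a b, forall z, f z = a + b * z.
Proof.
move=> ef HK; have [f' Hf' ef'] := entire_deriv ef.
have K0 : 0 <= K.
  by have := HK 0; rewrite cabs0 addr0 mulr1; apply: le_trans; exact: cabs_ge0.
have f'c z : f' z = f' 0.
  apply: (liouville (M := 8 * K)) => // w; have w0 := cabs_ge0 w.
  have r0 : 0 < 1 + cabs w by lra.
  have -> : 8 * K = 4 * (2 * K * (1 + cabs w)) / (1 + cabs w) by field; rewrite gt_eqF.
  apply: (@cauchy_estimate f w) => // v Hv; apply: le_trans (HK v) _.
  have : cabs v <= cabs w + (1 + cabs w).
    by rewrite -[v in cabs v](subrK w) addrC; apply: le_trans (cabsD _ _) _; rewrite lerD2l.
  nra.
exists (f 0), (f' 0) => z.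
have H w : cderiv (fun z => f z - (0 + f' 0 * z)) w 0.
  by have := cderivB (Hf' w) (cderiv_affine 0 (f' 0) w); rewrite (f'c w) subrr.
have := entire_deriv0_cst H z.
by rewrite mulr0 addr0 subr0 add0r => <-; rewrite subrK.
Qed.

End Regularity.

(** * Second-order jets and the maximum principle *)

Section Jets.
Variable R : realType.
Local Notation C := R[i].

(* Second-order jet at [t]: [p] and [m] are the Wirtinger derivatives
   dv/dz and d^2v/(dz dzbar); the pure second derivative is quantified away. *)
Definition jet (v : C -> R) (t p : C) (m : R) : Prop :=
  exists q : C, exists K d : R, [/\ 0 <= K, 0 < d & forall h, cabs h <= d ->
   `|v (t + h) - (v t + 2 * complex.Re (p * h) + complex.Re (q * h ^+ 2) + m * csqabs h)|
     <= K * cabs h ^+ 3].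

(** [F2] is half of the second derivative. *)
Definition rtaylor (F : R -> R) (x F1 F2 : R) : Prop :=
  exists K d : R, [/\ 0 <= K, 0 < d & forall s, `|s| <= d ->
    `|F (x + s) - (F x + F1 * s + F2 * s ^+ 2)| <= K * `|s| ^+ 3].

Lemma jet_cst (c : R) t : jet (fun=> c) t 0 0.
Proof.
exists 0, 0, 1; split=> // h _.
by rewrite !mul0r /= mulr0 !addr0 subrr normr0.
Qed.

Lemma jetD v w t p m p' m' : jet v t p m -> jet w t p' m' ->
  jet (fun x => v x + w x) t (p + p') (m + m').
Proof.
move=> [q [K [d [K0 d0 H]]]] [q' [K' [d' [K'0 d'0 H']]]].
exists (q + q'), (K + K'), (Num.min d d'); split; first exact: addr_ge0.
  by rewrite lt_min d0.
move=> h; rewrite le_min => /andP[/H H1 /H' H2].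
rewrite [(K + K') * _]mulrDl; apply: le_trans _ (lerD H1 H2); apply: le_trans _ (ler_normD _ _).
rewrite le_eqVlt; apply/orP; left; apply/eqP; congr (`| _ |).
by rewrite !(mulrDl, raddfD) /=; ring.
Qed.

Lemma jetZ c v t p m : jet v t p m -> jet (fun x => c * v x) t ((c%:C)%C * p) (c * m).
Proof.
move=> [q [K [d [K0 d0 H]]]].
exists ((c%:C)%C * q), (`|c| * K), d; split; first by rewrite mulr_ge0.
  by [].
move=> h /H H1; rewrite -[`|c| * K * _]mulrA; apply: le_trans _ (ler_wpM2l (normr_ge0 c) H1).
rewrite -normrM; rewrite le_eqVlt; apply/orP; left; apply/eqP; congr (`| _ |).
have E (z : C) : complex.Re ((c%:C)%C * z) = c * complex.Re z by case: z => a b /=; rewrite mul0r subr0.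
by rewrite -!mulrA !E; ring.
Qed.

(** The square of the linear part of a jet splits into a pure part, which joins [q], and a mixed
    part, which is the [|v_z|^2] term of the chain rule. *)
Lemma Re_sqr2 (p h : C) : (2 * complex.Re (p * h)) ^+ 2 =
  complex.Re (2 * p ^+ 2 * h ^+ 2) + 2 * csqabs p * csqabs h.
Proof.
have -> : 2 * p ^+ 2 * h ^+ 2 = (p * h) ^+ 2 + (p * h) ^+ 2 by ring.
by rewrite -mulrA -csqabsM; case: (p * h) => a b; rewrite /csqabs /=; ring.
Qed.

(** The chain rule: the mixed derivative of [F o v] is [F' v_(z zbar) + F'' |v_z|^2]. All other jets
    are assembled from this one, sums and multiples. *)
Lemma jet_comp F F1 F2 v t p m : jet v t p m -> rtaylor F (v t) F1 F2 ->
  jet (fun x => F (v x)) t ((F1%:C)%C * p) (F1 * m + 2 * F2 * csqabs p).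
Proof.
move=> [q [K [d [K0 d0 H]]]] [L [e [L0 e0 HF]]].
pose A := cabs q + `|m| + K.
pose B := 2 * cabs p + A.
have A0 : 0 <= A by rewrite !addr_ge0 ?cabs_ge0.
have B0 : 0 <= B by rewrite addr_ge0 ?mulr_ge0 ?cabs_ge0.
have B1 : 0 < B + 1 by lra.
exists ((F1%:C)%C * q + (F2%:C)%C * (2 * p ^+ 2)), (`|F1| * K + `|F2| * (A * (B + 2 * cabs p)) + L * B ^+ 3),
  (Num.min (Num.min d 1) (e / (B + 1))); split.
- by rewrite !addr_ge0 ?mulr_ge0 ?exprn_ge0 ?addr_ge0 ?mulr_ge0 ?cabs_ge0.
- by rewrite !lt_min d0 ltr01 divr_gt0.
move=> h; rewrite !le_min => /andP[/andP[hd h1] he].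
have {H}H := H h hd; have n0 := cabs_ge0 h.
pose l := 2 * complex.Re (p * h).
pose P := l + complex.Re (q * h ^+ 2) + m * csqabs h.
pose eta := v (t + h) - v t.
have l1 : `|l| <= 2 * cabs p * cabs h.
  rewrite /l normrM ger0_norm // -mulrA ler_pM2l // -cabsM; exact: cabs_le_Re.
have H1 : `|eta - P| <= K * cabs h ^+ 3.
  by move: H; congr (`| _ | <= _); rewrite /eta /P /l; ring.
have h32 : cabs h ^+ 3 <= cabs h ^+ 2 by rewrite exprS ler_piMl ?exprn_ge0.
have h21 : cabs h ^+ 2 <= cabs h by rewrite expr2 ler_piMl.
have H2 : `|eta - l| <= A * cabs h ^+ 2.
  have -> : eta - l = (eta - P) + (complex.Re (q * h ^+ 2) + m * csqabs h) by rewrite /P; ring.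
  apply: le_trans (ler_normD _ _) _.
  have -> : A * cabs h ^+ 2 = K * cabs h ^+ 2 + (cabs q * cabs h ^+ 2 + `|m| * cabs h ^+ 2) by rewrite /A; ring.
  apply: lerD; first by apply: le_trans H1 _; rewrite ler_wpM2l.
  apply: le_trans (ler_normD _ _) _; apply: lerD.
    by rewrite -cabsX -cabsM; exact: cabs_le_Re.
  by rewrite normrM -sqr_cabs (ger0_norm (exprn_ge0 _ n0)).
have H3 : `|eta| <= B * cabs h.
  rewrite -[eta](subrK l); apply: le_trans (ler_normD _ _) _.
  have -> : B * cabs h = A * cabs h + 2 * cabs p * cabs h by rewrite /B; ring.
  by apply: lerD l1; apply: le_trans H2 _; rewrite ler_wpM2l.
have H4 : `|eta + l| <= (B + 2 * cabs p) * cabs h.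
  by rewrite mulrDl; apply: le_trans (ler_normD _ _) _; apply: lerD.
have H5 : `|eta| <= e.
  apply: le_trans H3 _; move: he; rewrite ler_pdivlMr //; nra.
have {HF}HF := HF eta H5.
rewrite /eta [v t + _]addrC subrK -/eta in HF.
(* Three errors of third order: [F1] times the remainder of [v], [F2] times the error of replacing
   [eta ^+ 2] by [l ^+ 2], and the remainder of [F]. *)
have -> : F (v (t + h)) - (F (v t) + 2 * complex.Re ((F1%:C)%C * p * h) +
    complex.Re (((F1%:C)%C * q + (F2%:C)%C * (2 * p ^+ 2)) * h ^+ 2) + (F1 * m + 2 * F2 * csqabs p) * csqabs h)
  = F1 * (eta - P) + F2 * ((eta - l) * (eta + l)) + (F (v (t + h)) - (F (v t) + F1 * eta + F2 * eta ^+ 2)).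
  have E c (z : C) : complex.Re ((c%:C)%C * z) = c * complex.Re z by case: z => a b /=; rewrite mul0r subr0.
  have -> : (eta - l) * (eta + l) = eta ^+ 2 - l ^+ 2 by ring.
  have -> : complex.Re ((F1%:C)%C * p * h) = F1 * complex.Re (p * h) by rewrite -mulrA E.
  have -> : complex.Re (((F1%:C)%C * q + (F2%:C)%C * (2 * p ^+ 2)) * h ^+ 2) =
    F1 * complex.Re (q * h ^+ 2) + F2 * complex.Re (2 * p ^+ 2 * h ^+ 2).
    by rewrite [(_ + _) * _]mulrDl raddfD /= -![_%:C%C * _ * _]mulrA !E.
  by rewrite /l Re_sqr2 /P /l; ring.
have -> : (`|F1| * K + `|F2| * (A * (B + 2 * cabs p)) + L * B ^+ 3) * cabs h ^+ 3 =
    `|F1| * (K * cabs h ^+ 3) + `|F2| * ((A * cabs h ^+ 2) * ((B + 2 * cabs p) * cabs h))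
    + L * (B * cabs h) ^+ 3 by ring.
apply: le_trans (ler_normD _ _) _; apply: lerD; last first.
  apply: le_trans HF _; rewrite ler_wpM2l // ler_pXn2r ?nnegrE //.
  by rewrite mulr_ge0.
apply: le_trans (ler_normD _ _) _; rewrite !normrM; apply: lerD; rewrite ler_wpM2l //.
by apply: ler_pM.
Qed.

Lemma eq_jet v t p m p' m' : p = p' -> m = m' -> jet v t p m -> jet v t p' m'.
Proof. by move=> -> ->. Qed.

Lemma rtaylor_sqr (x : R) : rtaylor (fun s => s ^+ 2) x (2 * x) 1.
Proof.
exists 0, 1; split => // s _.
have -> : (x + s) ^+ 2 - (x ^+ 2 + 2 * x * s + 1 * s ^+ 2) = 0 by ring.
by rewrite normr0 mul0r.
Qed.

(** Each use raises the order of a remainder by one; iterated, it gives the Taylor estimates of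
    [expR] and [ln]. *)
Lemma deriv_pow_bound (G G' : R -> R) (d K : R) (k : nat) : G 0 = 0 ->
  (forall s : R, `|s| <= d -> is_derive s 1 G (G' s)) ->
  (forall s, `|s| <= d -> `|G' s| <= K * `|s| ^+ k) ->
  forall s, `|s| <= d -> `|G s| <= K * `|s| ^+ k.+1.
Proof.
move=> G0 dG HG s sd.
have K0 : 0 <= K * `|s| ^+ k by apply: le_trans (HG s sd).
have key c : `|c| <= `|s| -> `|G' c| <= K * `|s| ^+ k.
  move=> cs; apply: le_trans (HG c (le_trans cs sd)) _.
  have [s0|s0] := eqVneq s 0.
    by move: cs; rewrite s0 normr0 normr_le0 => /eqP ->; rewrite normr0.
  have K1 : 0 <= K by move: K0; rewrite pmulr_lge0 // exprn_gt0 // normr_gt0.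
  by rewrite ler_wpM2l // lerXn2r ?nnegrE.
rewrite exprSr mulrA -[in X in X <= _](subr0 (G s)) -G0.
have [s0|s0] := leP 0 s.
  have [|c /andP[c0 cs] ->] := @rderiv_MVT _ G G' 0 s s0.
    move=> x /andP[x0 xs]; apply/is_derive_rderiv/dG; apply: le_trans sd.
    by rewrite !ger0_norm.
  rewrite subr0 normrM ler_wpM2r // key // !ger0_norm //.
have [|c /andP[c0 cs]] := @rderiv_MVT _ G G' s 0 (ltW s0).
  move=> x /andP[x0 xs]; apply/is_derive_rderiv/dG; apply: le_trans sd.
  by rewrite !ler0_norm ?lerN2 // ltW.
rewrite distrC => ->; rewrite sub0r normrM normrN ler_wpM2r // key //.
by rewrite !ler0_norm ?lerN2 // ltW.
Qed.

Lemma rtaylor_expR (x : R) : rtaylor expR x (expR x) (expR x / 2).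
Proof.
have b1 (s : R) : `|s| <= 1 -> `|expR s| <= expR 1 * `|s| ^+ 0.
  move=> s1; rewrite expr0 mulr1 ger0_norm ?expR_ge0 // ler_expR.
  by apply: le_trans s1; exact: ler_norm.
have b2 : forall s : R, `|s| <= 1 -> `|expR s - 1| <= expR 1 * `|s| ^+ 1.
  apply: (deriv_pow_bound (G := fun s => expR s - 1) _ _ b1); first by rewrite expR0 subrr.
  by move=> s _; apply: is_derive_eq; rewrite subr0.
have b3 : forall s : R, `|s| <= 1 -> `|expR s - 1 - s| <= expR 1 * `|s| ^+ 2.
  apply: (deriv_pow_bound (G := fun s => expR s - 1 - s) _ _ b2); first by rewrite expR0 !subrr.
  by move=> s _; apply: is_derive_eq; rewrite subr0.
have b4 : forall s : R, `|s| <= 1 -> `|expR s - 1 - s - s ^+ 2 / 2| <= expR 1 * `|s| ^+ 3.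
  apply: (deriv_pow_bound (G := fun s => expR s - 1 - s - s ^+ 2 / 2) _ _ b3).
    by rewrite expR0 !subrr expr0n mul0r subrr.
  move=> s _; apply: is_derive_eq.
  by rewrite /GRing.scale /=; field.
exists (expR x * expR 1), 1; split; rewrite ?mulr_ge0 ?expR_ge0 //.
move=> s /b4 H.
have -> : expR (x + s) - (expR x + expR x * s + expR x / 2 * s ^+ 2) =
  expR x * (expR s - 1 - s - s ^+ 2 / 2) by rewrite expRD; field.
by rewrite normrM ger0_norm ?expR_ge0 // -mulrA ler_wpM2l ?expR_ge0.
Qed.

Lemma rtaylor_ln (x : R) : 0 < x -> rtaylor (@ln R) x x^-1 (- (x ^+ 2)^-1 / 2).
Proof.
move=> x0.
have pos (s : R) : `|s| <= x / 2 -> x / 2 <= x + s.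
  by rewrite ler_norml => /andP[? ?]; lra.
have b (s : R) : `|s| <= x / 2 -> `|(x + s)^-1 - x^-1 + s / x ^+ 2| <= 2 / x ^+ 3 * `|s| ^+ 2.
  move=> Hs; have p := pos s Hs; have xs0 : 0 < x + s by apply: lt_le_trans p; rewrite divr_gt0.
  have -> : (x + s)^-1 - x^-1 + s / x ^+ 2 = s ^+ 2 * (x ^+ 2 * (x + s))^-1.
    by field; rewrite !gt_eqF.
  rewrite normrM normrX mulrC ler_wpM2r ?exprn_ge0 // ger0_norm; last first.
    by rewrite invr_ge0 mulr_ge0 ?exprn_ge0 // ltW.
  have -> : 2 / x ^+ 3 = (x ^+ 2 * (x / 2))^-1 by field; rewrite gt_eqF.
  rewrite lef_pV2 ?posrE ?mulr_gt0 ?exprn_gt0 ?invr_gt0 //.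
  by rewrite ler_pM2l // exprn_gt0.
exists (2 / x ^+ 3), (x / 2); split.
- by apply: divr_ge0 => //; exact/exprn_ge0/ltW.
- exact: divr_gt0.
move=> s Hs.
have := deriv_pow_bound (G := fun s => ln (x + s) - ln x - s / x + s ^+ 2 / (2 * x ^+ 2)) _ _ b Hs.
have -> : ln (x + s) - (ln x + x^-1 * s + - (x ^+ 2)^-1 / 2 * s ^+ 2) =
  ln (x + s) - ln x - s / x + s ^+ 2 / (2 * x ^+ 2) by field; rewrite gt_eqF.
apply; first by rewrite addr0 subrr expr0n !mul0r subrr addr0.
move=> r Hr; have p := pos r Hr; have xs0 : 0 < x + r by apply: lt_le_trans p; rewrite divr_gt0.
have D := is_derive1_ln xs0.
have D2 : is_derive r 1 (fun s => x + s) (1 : R).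
  apply: rderiv_is_derive => e e0; exists 1 => // h _.
  by rewrite (_ : _ - _ = 0) ?normr0 ?mulr_ge0 ?(ltW e0) //; ring.
have D3 : is_derive r 1 (fun s => ln (x + s)) ((x + r)^-1).
  by have := is_derive1_comp D D2; rewrite mulr1.
apply: is_derive_eq.
by rewrite /GRing.scale /=; field; rewrite !gt_eqF.
Qed.

(** Adding the expansions at the increments [s], [-s], [i s], [-i s] kills the linear and the pure
    quadratic terms, so that [m s^2 <= K s^3] for small [s]. *)
Lemma jet_max v t p m : jet v t p m -> near0 (fun h => v (t + h) <= v t) -> m <= 0.
Proof.
move=> [q [K [d [K0 d0 H]]]] [e e0 He].
apply/ler_addgt0Pr => x x0; rewrite add0r.
have K1 : 0 < K + 1 by lra.
pose s := Num.min (Num.min d (e / 2)) (x / (K + 1)).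
have s0 : 0 < s by rewrite !lt_min d0 !divr_gt0.
have : s <= s by []; rewrite {2}/s !le_min => /andP[/andP[sd se] sx].
have se' : s < e by apply: le_lt_trans se _; rewrite ltr_pdivrMr // mulr_natr mulr2n ltrDl.
have key h : cabs h = s -> 2 * complex.Re (p * h) + complex.Re (q * h ^+ 2) + m * s ^+ 2 <= K * s ^+ 3.
  move=> hs; have := H h; rewrite hs => /(_ sd); rewrite ler_norml => /andP[+ _].
  by have := He h; rewrite hs => /(_ se'); rewrite -sqr_cabs hs; lra.
have c1 : cabs ((s%:C)%C : C) = s by rewrite cabsR gtr0_norm.
have c2 : cabs (- (s%:C)%C : C) = s by rewrite cabsN.
have c3 : cabs (Complex 0 s) = s by rewrite /cabs /csqabs /= expr0n add0r sqrtr_sqr gtr0_norm.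
have c4 : cabs (- Complex 0 s) = s by rewrite cabsN.
have := key _ c1; have := key _ c2; have := key _ c3; have := key _ c4.
rewrite !sqrrN !mulrN !raddfN /=.
case: (p) => p1 p2; case: (q) => q1 q2 /=.
rewrite !(mulr0, mul0r, subr0, sub0r, addr0, add0r) => h1 h2 h3 h4.
have : m * s ^+ 2 <= K * s ^+ 3 by move: h1 h2 h3 h4; nra.
rewrite (_ : K * s ^+ 3 = K * s * s ^+ 2); last by ring.
rewrite ler_pM2r ?exprn_gt0 // => Hm.
by apply: le_trans Hm _; move: sx; rewrite ler_pdivlMr // ; nra.
Qed.

End Jets.

Section HolomorphicJets.
Variable R : realType.
Local Notation C := R[i].
Variables (f f' : C -> C) (a : C) (r : R).
Hypothesis r0 : 0 < r.
Hypothesis df : forall w, cabs (w - a) < r -> cderiv f w (f' w).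

Lemma jet_Re : jet (fun x => complex.Re (f x)) a (f' a / 2) 0.
Proof.
have [q [K [d [K0 d0 H]]]] := holo_taylor2 r0 df.
exists q, K, d; split => // h /H; apply: le_trans; apply: le_trans (cabs_le_Re _).
rewrite le_eqVlt; apply/orP; left; apply/eqP; congr (`| _ |).
have -> : f' a * h = (f' a / 2 * h) + (f' a / 2 * h) by field.
by rewrite !raddfB !raddfD /=; ring.
Qed.

Lemma jet_Im : jet (fun x => complex.Im (f x)) a (- 'i%C * (f' a / 2)) 0.
Proof.
have [q [K [d [K0 d0 H]]]] := holo_taylor2 r0 df.
exists (- 'i%C * q), K, d; split => // h /H; apply: le_trans; apply: le_trans (cabs_le_Im _).
rewrite le_eqVlt; apply/orP; left; apply/eqP; congr (`| _ |).
have -> : f' a * h = (f' a / 2 * h) + (f' a / 2 * h) by field.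
have E (z : C) : complex.Re (- 'i%C * z) = complex.Im z.
  by case: z => x y /=; rewrite oppr0 mul0r sub0r mulN1r opprK.
by rewrite -![- 'i%C * _ * _]mulrA !E !raddfB !raddfD /=; ring.
Qed.

Lemma jet_csqabs : jet (fun x => csqabs (f x)) a (f' a * conjc (f a)) (csqabs (f' a)).
Proof.
have j1 := jet_comp jet_Re (rtaylor_sqr _); have j2 := jet_comp jet_Im (rtaylor_sqr _).
apply: eq_jet (jetD j1 j2).
  case: (f a) => x y /=; rewrite (_ : (x -i* y)%C = (x%:C)%C - 'i%C * (y%:C)%C); last first.
    by apply/eqP; rewrite eq_complex /=; apply/andP; split; apply/eqP; ring.
  by rewrite !rmorphM /= !rmorph_nat; field.
have -> : csqabs (- 'i%C * (f' a / 2)) = csqabs (f' a / 2).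
  by case: (f' a / 2) => x y; rewrite /csqabs /=; ring.
have -> : csqabs (f' a) = csqabs (f' a / 2) * 4; last by ring.
have {1}-> : f' a = (f' a / 2) * 2 by field.
by rewrite csqabsM; congr (_ * _); rewrite /csqabs /=; ring.
Qed.

Lemma csqabs_conj (z : C) : z * conjc z = ((csqabs z)%:C)%C.
Proof. by case: z => x y; apply/eqP; rewrite eq_complex /csqabs /=; apply/andP; split; apply/eqP; ring. Qed.

(** The zero is harmonicity of [ln |f|^2]: the curvature of a metric [|W|^2 exp v] depends on the
    mixed derivative of [v] alone. *)
Lemma jet_ln_csqabs : f a != 0 -> jet (fun x => ln (csqabs (f x))) a (f' a / f a) 0.
Proof.
move=> fa0; have s0 : 0 < csqabs (f a) by rewrite csqabs_gt0.
apply: eq_jet (jet_comp jet_csqabs (rtaylor_ln s0)).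
  have -> : (((csqabs (f a))^-1)%:C)%C = (f a * conjc (f a))^-1.
    by rewrite csqabs_conj; exact: fmorphV.
  rewrite invfM.
  have c0 : conjc (f a) != 0 by rewrite conjc_eq0.
  by field; rewrite fa0 c0.
have -> : csqabs (f' a * conjc (f a)) = csqabs (f' a) * csqabs (f a).
  by rewrite csqabsM; congr (_ * _); case: (f a) => x y; rewrite /csqabs /= sqrrN.
by field; rewrite gt_eqF.
Qed.

End HolomorphicJets.

(** * The maximum principle and identity theorems *)

Section MaximumPrinciple.
Variable R : realType.
Local Notation C := R[i].

Lemma csqabs_cont (f : C -> C) z : ccont f z -> rcont (fun x => csqabs (f x)) z.
Proof.
move=> cf e e0; have k0 := cabs_ge0 (f z).
have K0 : 0 < 2 * cabs (f z) + 1 by lra.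
move: (near0_and (ccont_bnd cf) (cf _ (divr_gt0 e0 K0))).
apply: near0_imp => h [H1 H2]; rewrite ltr_pdivlMr // in H2.
rewrite -!sqr_cabs.
have : `|cabs (f (z + h)) - cabs (f z)| <= cabs (f (z + h) - f z).
  rewrite ler_norml; have := cabsD (f (z + h) - f z) (f z); rewrite subrK.
  have := cabsD (f z - f (z + h)) (f (z + h)); rewrite subrK [cabs (f z - _)]cabsBC.
  by move=> ? ?; apply/andP; split; lra.
move=> H3; have x0 := cabs_ge0 (f (z + h)).
have xy0 : 0 <= cabs (f (z + h)) + cabs (f z) by rewrite addr_ge0.
rewrite subr_sqr normrM (ger0_norm xy0); apply: le_lt_trans H2.
by apply: ler_pM => //; lra.
Qed.

Lemma rcontD (u v : C -> R) z : rcont u z -> rcont v z -> rcont (fun x => u x + v x) z.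
Proof.
move=> cu cv e e0; have e2 : 0 < e / 2 by rewrite divr_gt0.
move: (near0_and (cu _ e2) (cv _ e2)); apply: near0_imp => h [h1 h2].
rewrite (_ : _ - _ = (u (z + h) - u z) + (v (z + h) - v z)); last by ring.
by apply: le_lt_trans (ler_normD _ _) _; rewrite [e]splitr ltrD.
Qed.

Lemma rcont_lt (u : C -> R) p : rcont u p -> forall e : R, 0 < e ->
  exists2 d : R, 0 < d & forall t, cabs (t - p) < d -> u t < u p + e.
Proof.
move=> cu e e0; have [d d0 Hd] := cu e e0; exists d => // t /Hd.
by rewrite [p + _]addrC subrK ltr_norml => /andP[_]; rewrite ltrBlDl.
Qed.

Lemma rcont_closed (u : C -> R) p c : rcont u p ->
  (forall d : R, 0 < d -> exists2 t, u t <= c & cabs (t - p) < d) -> u p <= c.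
Proof.
move=> cu H; apply/ler_addgt0Pr => e e0; have [d d0 Hd] := cu e e0.
have [t Ht /Hd] := H d d0; rewrite [p + _]addrC subrK ltr_norml => /andP[? _]; lra.
Qed.

(* A strictly subharmonic perturbation by [e |z|^2] has no interior maximum. *)
Lemma annulus_max (f : C -> C) (lo hi M : R) :
  (forall z, lo <= csqabs z <= hi -> ccont f z) ->
  (forall z, lo < csqabs z < hi -> exists l, cderiv f z l) ->
  (forall z, lo <= csqabs z <= hi -> csqabs z = lo \/ csqabs z = hi -> csqabs (f z) <= M) ->
  forall z, lo <= csqabs z <= hi -> csqabs (f z) <= M.
Proof.
move=> cf df HM z0 Hz0; rewrite leNgt; apply/negP => Mz.
have hi0 : 0 <= hi by case/andP: Hz0 => _; apply: le_trans; exact: csqabs_ge0.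
(* The perturbation is so small that on the boundary [v <= M + e hi] stays below [|f z0|^2 <= v z0],
   hence the maximum is interior. *)
pose e := (csqabs (f z0) - M) / (2 * (hi + 1)).
have h1 : 0 < 2 * (hi + 1) by lra.
have e0 : 0 < e by rewrite divr_gt0 // subr_gt0.
have eE : csqabs (f z0) - M = 2 * (hi + 1) * e by rewrite /e; field; rewrite gt_eqF //; lra.
pose v z := csqabs (f z) + e * csqabs z.
pose S z := lo <= csqabs z <= hi.
have cid (z : C) : rcont (fun x => csqabs x) z by exact: (csqabs_cont (ccont_id _)).
have cv p : S p -> rcont v p.
  move=> Sp; apply: rcontD; first by apply: csqabs_cont; exact: cf.
  move=> d d0; have := cid p _ (divr_gt0 d0 e0); apply: near0_imp => h.
  by rewrite -mulrBr normrM gtr0_norm // ltr_pdivlMr // mulrC.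
have [||||p Sp Hp] := @compact_max _ S v (hi + 1).
- by exists z0.
- move=> t /andP[_ th]; rewrite cabs_le_csqabs; last by lra.
  by apply: le_trans th _; nra.
- move=> p Hp; apply/andP; split.
    rewrite -lerN2; apply: (@rcont_closed (fun x => - csqabs x)).
      move=> d d0; have := cid p _ d0; apply: near0_imp => h.
      by rewrite -opprD normrN.
    by move=> d /Hp[t /andP[? _] ?]; exists t => //; rewrite lerN2.
  by apply: rcont_closed (cid p) _ => d /Hp[t /andP[_ ?] ?]; exists t.
- by move=> p /cv/rcont_lt H d /H[x x0 Hx]; exists x => // t _; exact: Hx.
have v0 := Hp z0 Hz0; rewrite /v in v0.
have pb : lo < csqabs p < hi.
  have Hb : ~ (csqabs p = lo \/ csqabs p = hi).
    move=> /(HM p Sp); case/andP: (Sp) => _ ph.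
    have := csqabs_ge0 z0; have := csqabs_ge0 p; nra.
  case/andP: (Sp) => a b; rewrite !lt_neqAle a b !andbT; apply/andP; split; apply/eqP => E; apply: Hb.
    by left.
  by right.
have [d d0 Hd] : near0 (fun h => lo < csqabs (p + h) < hi).
  have [a b] := andP pb.
  have a0 : 0 < csqabs p - lo by rewrite subr_gt0.
  have b0 : 0 < hi - csqabs p by rewrite subr_gt0.
  have := near0_and (cid p _ a0) (cid p _ b0); apply: near0_imp => h [].
  by rewrite !ltr_norml => /andP[? ?] /andP[? ?]; apply/andP; split; lra.
have /choice[f' Hf'] : forall z, exists l, lo < csqabs z < hi -> cderiv f z l.
  move=> z; case: (pselect (lo < csqabs z < hi)) => [/df[l Hl]|H]; first by exists l.
  by exists 0.
have df' : forall w, cabs (w - p) < d -> cderiv f w (f' w).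
  by move=> w /Hd; rewrite [p + _]addrC subrK => /Hf'.
have j1 := jet_csqabs d0 df'.
have j2 := jetZ e (jet_csqabs (f := id) (f' := fun=> 1) (a := p) ltr01 (fun w _ => cderiv_id w)).
have := jet_max (jetD j1 j2).
have -> : csqabs (1 : C) = 1 by rewrite /csqabs /= expr1n expr0n addr0.
have : 0 < csqabs (f' p) + e * 1 by rewrite mulr1 ltr_wpDl ?csqabs_ge0.
rewrite ltNge => /negP H /(_ _)/H; apply.
exists d => // h /Hd /andP[/ltW a /ltW b]; apply: (Hp (p + h)).
by apply/andP.
Qed.

Lemma geometric_le0 (x M q : R) : 0 <= q < 1 -> (forall n : nat, x <= M * q ^+ n) -> x <= 0.
Proof.
move=> /andP[q0 q1] H; apply/ler_addgt0Pr => e e0; rewrite add0r.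
have qn : `|q| < 1 by rewrite ger0_norm.
have /cvgrPdist_lt /(_ e e0) [N _ /(_ N (leqnn N))] := @cvg_geometric R M q qn.
rewrite sub0r normrN /geometric /= => HN.
by apply: le_trans (H N) _; apply: le_trans (ler_norm _) _; exact: ltW.
Qed.

Lemma cderivX (f : C -> C) z l n : cderiv f z l -> exists m, cderiv (fun x => f x ^+ n) z m.
Proof.
move=> Hf; elim: n => [|n [m Hm]].
  by exists 0; apply: cderiv_sub (cderiv_cst 1 z) => x; rewrite expr0.
exists (l * f z ^+ n + f z * m); apply: cderiv_sub (cderivM Hf Hm) => x.
by rewrite exprS.
Qed.

Lemma csqabsX (x : C) n : csqabs (x ^+ n) = csqabs x ^+ n.
Proof. by rewrite -!sqr_cabs cabsX -!exprM mulnC. Qed.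

(* The maximum principle applied to [f(z) z^(-n)] for every [n]. *)
Lemma circle_identity_outer (f : C -> C) (lo hi : R) : 0 < lo ->
  (forall z, lo <= csqabs z <= hi -> exists l, cderiv f z l) ->
  (forall z, csqabs z = lo -> f z = 0) ->
  forall z, lo <= csqabs z < hi -> f z = 0.
Proof.
move=> lo0 df f0 z /andP[zlo zhi].
have hi0 : 0 < hi by apply: lt_trans lo0 (le_lt_trans zlo zhi).
have nz w : lo <= csqabs w <= hi -> w != 0.
  by move=> /andP[wl _]; rewrite -csqabs_gt0; exact: lt_le_trans wl.
have [M M0 HM] : exists2 M, 0 <= M & forall w, lo <= csqabs w <= hi -> csqabs (f w) <= M.
  have Hz : lo <= csqabs z <= hi by rewrite zlo ltW.
  have [||||p Sp Hp] := @compact_max _ (fun w => lo <= csqabs w <= hi) (fun w => csqabs (f w)) (hi + 1).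
  - by exists z.
  - move=> t /andP[_ th]; rewrite cabs_le_csqabs; last by lra.
    by apply: le_trans th _; nra.
  - have cid (w : C) : rcont (fun x => csqabs x) w by exact: (csqabs_cont (ccont_id _)).
    move=> p Hp; apply/andP; split.
      rewrite -lerN2; apply: (@rcont_closed (fun x => - csqabs x)).
        move=> d d0; have := cid p _ d0; apply: near0_imp => h.
        by rewrite -opprD normrN.
      by move=> d /Hp[t /andP[? _] ?]; exists t => //; rewrite lerN2.
    by apply: rcont_closed (cid p) _ => d /Hp[t /andP[_ ?] ?]; exists t.
  - move=> p /df[l Hl] d /(rcont_lt (csqabs_cont (cderiv_cont Hl)))[x x0 Hx].
    by exists x => // t _; exact: Hx.
  by exists (csqabs (f p)) => //; exact: csqabs_ge0.
have dg n w : lo <= csqabs w <= hi -> exists l, cderiv (fun x => f x * x^-1 ^+ n) w l.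
  move=> Hw; have [l Hl] := df w Hw; have wn := nz w Hw.
  have [m Hm] := cderivX n (cderivV (cderiv_id w) wn).
  by eexists; exact: cderivM Hl Hm.
apply/eqP; rewrite -cabs_eq0 -sqrf_eq0 sqr_cabs; apply/eqP/le_anti.
(* The quotient vanishes on the inner circle and its square modulus is at most [M / hi ^+ n] on the
   outer one, so [|f z|^2 <= M (|z|^2 / hi)^n], with ratio less than 1. *)
rewrite csqabs_ge0 andbT; apply: (@geometric_le0 _ M (csqabs z / hi)).
  by rewrite divr_ge0 ?csqabs_ge0 ?(ltW hi0) //= ltr_pdivrMr // mul1r.
move=> n; have z0 : 0 < csqabs z by apply: lt_le_trans zlo.
have := @annulus_max (fun x => f x * x^-1 ^+ n) lo hi (M / hi ^+ n) _ _ _ z.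
rewrite csqabsM csqabsX csqabsV => H.
have -> : M * (csqabs z / hi) ^+ n = M / hi ^+ n * csqabs z ^+ n by rewrite expr_div_n; ring.
have -> : csqabs (f z) = csqabs (f z) * (csqabs z)^-1 ^+ n * csqabs z ^+ n.
  by rewrite -mulrA -exprMn mulVf ?gt_eqF // expr1n mulr1.
apply: ler_wpM2r; first by rewrite exprn_ge0 // ltW.
apply: H; last by rewrite zlo ltW.
- by move=> w /(dg n)[l]; exact: cderiv_cont.
- by move=> w /andP[/ltW wl /ltW wh]; apply: dg; rewrite wl.
- move=> w Hw [E|E].
    by rewrite f0 // mul0r /csqabs /= expr0n addr0 divr_ge0 // exprn_ge0 // ltW.
  by rewrite csqabsM csqabsX csqabsV E exprVn ler_wpM2r ?HM // invr_ge0 exprn_ge0 // ltW.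
Qed.

(** Outside the circle this is [circle_identity_outer]; inside, the inversion [w |-> 1 / w] reduces
    to it, which is why [z != 0] is assumed. A negative [lo] is allowed and makes the region a
    disc. *)
Theorem annulus_identity (f : C -> C) (lo hi r : R) : 0 < r -> lo < r < hi ->
  (forall z, lo < csqabs z < hi -> exists l, cderiv f z l) ->
  (forall z, csqabs z = r -> f z = 0) ->
  forall z, z != 0 -> lo < csqabs z < hi -> f z = 0.
Proof.
move=> r0 /andP[lor rhi] df f0 z zn /andP[zlo zhi].
have z0 : 0 < csqabs z by rewrite csqabs_gt0.
have [rz|zr] := leP r (csqabs z).
  apply: (@circle_identity_outer f r ((csqabs z + hi) / 2)) => //.
    by move=> w /andP[w1 w2]; apply: df; apply/andP; split; lra.
  by rewrite rz; lra.
pose s := (Num.max lo 0 + csqabs z) / 2.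
have m0 : Num.max lo 0 < csqabs z by rewrite gt_max zlo.
have m1 : lo <= Num.max lo 0 by rewrite le_max lexx.
have m2 : 0 <= Num.max lo 0 by rewrite le_max lexx orbT.
have s0 : 0 < s by rewrite /s; lra.
have sz : s < csqabs z by rewrite /s; lra.
have slo : lo < s by rewrite /s; lra.
have := @circle_identity_outer (fun w => f w^-1) r^-1 s^-1 _ _ _ z^-1.
rewrite invrK; apply; rewrite ?invr_gt0 //.
- move=> w; rewrite -[csqabs w]invrK -csqabsV => /andP[w1 w2].
  have w0 : 0 < csqabs w^-1.
    by rewrite -invr_gt0; apply: lt_le_trans w1; rewrite invr_gt0.
  rewrite lef_pV2 ?posrE // in w1; rewrite lef_pV2 ?posrE // in w2.
  have [|l Hl] := df w^-1; first by apply/andP; split; lra.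
  have wn : w != 0 by rewrite -invr_eq0 -csqabs_gt0.
  have V : cderiv (fun x => x^-1) w (- 1 / w ^+ 2) := cderivV (cderiv_id w) wn.
  by exists (l * (- 1 / w ^+ 2)); exact: (cderiv_comp V Hl).
- by move=> w Hw; apply: f0; rewrite csqabsV Hw invrK.
- by rewrite csqabsV lef_pV2 ?posrE // ltf_pV2 ?posrE // (ltW zr).
Qed.

Lemma entire_identity (f : C -> C) (a : C) (r : R) : 0 < r -> entire f ->
  (forall z, cabs (z - a) < r -> f z = 0) -> forall z, f z = 0.
Proof.
move=> r0 ef H z; have [->|za] := eqVneq z a; first by apply: H; rewrite subrr cabs0.
rewrite (_ : f z = (fun x => f (a + x)) (z - a)); last by rewrite /= addrC subrK.
have r2 : 0 < r / 2 by rewrite divr_gt0.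
have rr : r / 2 < r by rewrite ltr_pdivrMr // mulr_natr mulr2n ltrDl.
(* The inner bound [-1] turns the annulus into a disc about [a] that contains [z]. *)
apply: (@annulus_identity (fun x => f (a + x)) (-1) ((r / 2) ^+ 2 + csqabs (z - a) + 1) ((r / 2) ^+ 2)).
- by rewrite exprn_gt0.
- have := csqabs_ge0 (z - a); have : 0 < (r / 2) ^+ 2 by rewrite exprn_gt0.
  by move=> ? ?; apply/andP; split; lra.
- move=> w _; have [l Hl] := ef (a + w); exists (l * 1).
  exact: (cderiv_comp (cderiv_addc a w) Hl).
- move=> w Hw; apply: H; rewrite addrAC subrr add0r cabs_lt_csqabs ?(ltW r0) // Hw.
  by rewrite ltr_pXn2r // nnegrE ltW.
- by rewrite subr_eq0.
- have := csqabs_ge0 (z - a); have : 0 < (r / 2) ^+ 2 by rewrite exprn_gt0.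
  by move=> ? ?; apply/andP; split; lra.
Qed.

End MaximumPrinciple.

Section JetProducts.
Variable R : realType.
Local Notation C := R[i].

(** Polarisation, [2 v w = (v + w)^2 - v^2 - w^2], reduces products to [jet_comp] with the
    square. *)
Lemma jetM v w (t p p' : C) (m m' : R) : jet v t p m -> jet w t p' m' ->
  jet (fun x => v x * w x) t ((v t)%:C%C * p' + (w t)%:C%C * p)
    (v t * m' + w t * m + 2 * complex.Re (p * conjc p')).
Proof.
move=> jv jw.
have jvw := jet_comp (jetD jv jw) (rtaylor_sqr _).
have jv2 := jet_comp jv (rtaylor_sqr _); have jw2 := jet_comp jw (rtaylor_sqr _).
have J := jetZ 2^-1 (jetD jvw (jetD (jetZ (-1) jv2) (jetZ (-1) jw2))).
have E : (fun x => 2^-1 * ((v x + w x) ^+ 2 + (-1 * v x ^+ 2 + -1 * w x ^+ 2))) = (fun x => v x * w x).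
  by apply: funext => x; field.
rewrite E in J; apply: eq_jet J.
  case: (p) => p1 p2; case: (p') => p3 p4; apply/eqP; rewrite eq_complex /=.
  by apply/andP; split; apply/eqP; field.
by case: (p) => p1 p2; case: (p') => p3 p4; rewrite /csqabs /=; field.
Qed.

Lemma jet_rcont v (t p : C) m : jet v t p m -> rcont v t.
Proof.
move=> [q [K [d [K0 d0 H]]]] e e0.
pose B := 2 * cabs p + cabs q + `|m| + K.
have B0 : 0 <= B by rewrite !addr_ge0 ?mulr_ge0 ?cabs_ge0.
have B1 : 0 < B + 1 by lra.
exists (Num.min (Num.min d 1) (e / (B + 1))); first by rewrite !lt_min d0 ltr01 divr_gt0.
move=> h; rewrite !lt_min => /andP[/andP[hd h1] he]; have n0 := cabs_ge0 h.
have := H h (ltW hd); have h1' := ltW h1.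
have h2 : cabs h ^+ 2 <= cabs h by rewrite expr2 ler_piMl.
have h3 : cabs h ^+ 3 <= cabs h.
  by apply: le_trans h2; rewrite exprS ler_piMl ?exprn_ge0.
set X := v t + _ + _ + _ => HX.
have -> : v (t + h) - v t = (v (t + h) - X) + (2 * complex.Re (p * h) + complex.Re (q * h ^+ 2) + m * csqabs h).
  by rewrite /X; ring.
apply: le_lt_trans (_ : B * cabs h < e); last by move: he; rewrite ltr_pdivlMr //; nra.
have -> : B * cabs h = K * cabs h + (2 * (cabs p * cabs h) + cabs q * cabs h + `|m| * cabs h) by rewrite /B; ring.
apply: le_trans (ler_normD _ _) _; apply: lerD.
  by apply: le_trans HX _; rewrite ler_wpM2l.
apply: le_trans (ler_normD _ _) _; apply: lerD; last first.
  by rewrite normrM ler_wpM2l // ger0_norm ?csqabs_ge0 // -sqr_cabs.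
apply: le_trans (ler_normD _ _) _; apply: lerD.
  by rewrite normrM ger0_norm // ler_pM2l // -cabsM; exact: cabs_le_Re.
apply: le_trans (cabs_le_Re _) _; rewrite cabsM cabsX.
by rewrite ler_wpM2l ?cabs_ge0.
Qed.

(* Compare Ahlfors' lemma: the hyperbolic potential [2 ln (r^2 - |z|^2)] of the disc
   contributes the right-hand side. *)
Lemma hyperbolic_max (W W' : C -> C) v (t p : C) (m r : R) :
  (forall z, cderiv W z (W' z)) -> jet v t p m -> cabs t < r -> W t != 0 ->
  near0 (fun h => csqabs (W (t + h)) * expR (v (t + h)) * (r ^+ 2 - csqabs (t + h)) ^+ 2 <=
    csqabs (W t) * expR (v t) * (r ^+ 2 - csqabs t) ^+ 2) ->
  m * (r ^+ 2 - csqabs t) ^+ 2 <= 2 * r ^+ 2.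
Proof.
move=> dW jv tr Wt Hmax; have r0 : 0 < r by apply: le_lt_trans tr; exact: cabs_ge0.
have D0 : 0 < r ^+ 2 - csqabs t by rewrite subr_gt0 -cabs_lt_csqabs // ltW.
have j1 := jet_ln_csqabs ltr01 (fun w _ => dW w) Wt.
have jid := jet_csqabs (f := id) (f' := fun=> 1) (a := t) ltr01 (fun w _ => cderiv_id w).
have jD : jet (fun x => r ^+ 2 + (-1) * csqabs x) t _ _ := jetD (jet_cst (r ^+ 2) t) (jetZ (-1) jid).
have D0' : 0 < r ^+ 2 + (-1) * csqabs t by rewrite mulN1r.
have j2 := jet_comp jD (rtaylor_ln D0').
(* The jet of the logarithm of the maximised product. Its mixed derivative is [0 + m - 2 r^2 / D^2]
   with [D = r^2 - |t|^2], and [jet_max] makes it nonpositive. *)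
have J := jetD (jetD j1 jv) (jetZ 2 j2).
have E1 : csqabs (1 : C) = 1 by rewrite /csqabs /= expr1n expr0n addr0.
have := jet_max J; move: D0' => _.
have cs : csqabs (0 + ((-1)%:C)%C * (1 * conjc t)) = csqabs t.
  by case: (t) => a b; rewrite /csqabs /=; ring.
rewrite cs E1 add0r !mulN1r.
set D := r ^+ 2 - csqabs t in D0 Hmax *.
have Er : r ^+ 2 = D + csqabs t by rewrite /D subrK.
have -> : m + 2 * (D^-1 * (0 - 1) + 2 * (- (D ^+ 2)^-1 / 2) * csqabs t) = m - 2 * r ^+ 2 / D ^+ 2.
  by rewrite Er; field; rewrite gt_eqF.
move=> H; rewrite -ler_pdivlMr ?exprn_gt0 // -subr_le0; apply: H.
have cW := cderiv_cont (dW t); have tr' : cabs (t - 0) < r by rewrite subr0.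
have := near0_and Hmax (near0_and (ccont_neq0 cW Wt) (near0_ball tr')).
apply: near0_imp => h [H1 [H2 H3]].
rewrite subr0 in H3.
have Wh : 0 < csqabs (W (t + h)).
  by rewrite csqabs_gt0 -cabs_gt0; apply: lt_trans H2; rewrite divr_gt0 // cabs_gt0.
have Dh : 0 < r ^+ 2 - csqabs (t + h) by rewrite subr_gt0 -cabs_lt_csqabs // ltW.
have lnE (x y z : R) : 0 < x -> 0 < z -> ln x + y + 2 * ln z = ln (x * expR y * z ^+ 2).
  move=> x0 z0; rewrite !lnM ?posrE ?mulr_gt0 ?expR_gt0 ?exprn_gt0 // expRK; ring.
have Wn : W (t + h) != 0 by rewrite -csqabs_gt0.
rewrite !mulN1r !lnE ?csqabs_gt0 // ler_ln // posrE !mulr_gt0 ?expR_gt0 ?exprn_gt0 //.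
by rewrite csqabs_gt0.
Qed.

End JetProducts.

(** * Entire curves in the domain *)

Section TwoRegions.
Variable R : realType.
Local Notation C := R[i].
Variables (S E1 E2 : C -> R) (r R0 R1 : R).
Hypothesis r0 : 0 <= r.
Hypothesis R01 : R0 <= R1.
Hypothesis cS : forall p, rcont S p.
Hypothesis cE1 : forall p, R0 <= S p -> rcont E1 p.
Hypothesis cE2 : forall p, rcont E2 p.
Hypothesis E1_ge0 : forall p, 0 <= E1 p.
Hypothesis E2_ge0 : forall p, 0 <= E2 p.

(** A nonnegative continuous function on a closed set stays upper semicontinuous when extended by
    0. *)
Let usc_if (P : C -> Prop) (b : C -> bool) (E : C -> R) p : (forall t, 0 <= E t) ->
  (b p -> rcont E p) -> (~~ b p -> near0 (fun h => ~~ b (p + h))) ->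
  forall e : R, 0 < e -> exists2 d : R, 0 < d & forall t, cabs (t - p) < d ->
    (if b t then E t else 0) < (if b p then E p else 0) + e.
Proof.
move=> Ege cE nb e e0; case: ifPn => bp.
  have [d d0 Hd] := rcont_lt (cE bp) e0; exists d => // t /Hd H.
  by case: ifP => // _; apply: le_lt_trans H.
have [d d0 Hd] := nb bp; exists d => // t /Hd; rewrite [p + _]addrC subrK => /negPf ->.
by rewrite add0r.
Qed.

(** Each function counts only on its own region, and the regions [R0 <= S] and [S <= R1] overlap.
    The disjunction names a function that attains the joint maximum at [p]. *)
Lemma two_region_max : exists2 p, cabs p <= r &
  (R0 <= S p /\ forall t, cabs t <= r ->
     (R0 <= S t -> E1 t <= E1 p) /\ (S t <= R1 -> E2 t <= E1 p)) \/
  (S p <= R1 /\ forall t, cabs t <= r ->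
     (R0 <= S t -> E1 t <= E2 p) /\ (S t <= R1 -> E2 t <= E2 p)).
Proof.
pose F1 t := if R0 <= S t then E1 t else 0.
pose F2 t := if S t <= R1 then E2 t else 0.
have u1 p : forall e : R, 0 < e -> exists2 d : R, 0 < d & forall t, cabs (t - p) < d -> F1 t < F1 p + e.
  apply: (@usc_if (fun=> True) (fun t => R0 <= S t)) => //; first exact: cE1.
  rewrite -ltNge -subr_gt0 => H; move: (cS p H); apply: near0_imp => h.
  by rewrite -ltNge ltr_norml => /andP[_]; lra.
have u2 p : forall e : R, 0 < e -> exists2 d : R, 0 < d & forall t, cabs (t - p) < d -> F2 t < F2 p + e.
  apply: (@usc_if (fun=> True) (fun t => S t <= R1)) => //.
  rewrite -ltNge -subr_gt0 => H; move: (cS p H); apply: near0_imp => h.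
  by rewrite -ltNge ltr_norml => /andP[+ _]; lra.
have [||||p Sp Hp] := @compact_max _ (fun t => cabs t <= r) (fun t => Num.max (F1 t) (F2 t)) r.
- by exists 0; rewrite cabs0.
- by [].
- move=> p Hp; apply/ler_addgt0Pr => e e0; have [t Ht /ltW tp] := Hp e e0.
  rewrite -[p](subrK t) addrC; apply: le_trans (cabsD _ _) _; apply: lerD => //.
  by rewrite cabsBC.
- move=> p _ e e0; have [d d0 Hd] := u1 p e e0; have [d' d'0 Hd'] := u2 p e e0.
  exists (Num.min d d'); first by rewrite lt_min d0.
  move=> t _; rewrite lt_min => /andP[/Hd H1 /Hd' H2].
  have a1 : F1 p <= Num.max (F1 p) (F2 p) by rewrite le_max lexx.
  have a2 : F2 p <= Num.max (F1 p) (F2 p) by rewrite le_max lexx orbT.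
  by rewrite gt_max; apply/andP; split; lra.
exists p => //.
have Hp1 t : cabs t <= r -> (R0 <= S t -> E1 t <= Num.max (F1 p) (F2 p)) /\
    (S t <= R1 -> E2 t <= Num.max (F1 p) (F2 p)).
  move=> /Hp; rewrite ge_max => /andP[h1 h2].
  by split=> Ht; [move: h1; rewrite [F1 t]/F1|move: h2; rewrite [F2 t]/F2]; rewrite Ht.
have [R0p|R0p] := leP R0 (S p); last first.
  have pR1 : S p <= R1 by apply: le_trans R01; exact: ltW.
  right; split => // t /Hp1; rewrite /F1 /F2 pR1 [R0 <= S p]leNgt R0p /=.
  by rewrite max_r.
have [pR1|pR1] := leP (S p) R1; last first.
  left; split => // t /Hp1; rewrite /F1 /F2 R0p [S p <= R1]leNgt pR1 /=.
  by rewrite max_l.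
have [E12|E12] := leP (E1 p) (E2 p).
  by right; split => // t /Hp1; rewrite /F1 /F2 R0p pR1 max_r.
by left; split => // t /Hp1; rewrite /F1 /F2 R0p pR1 max_l // ltW.
Qed.

End TwoRegions.

(** * Vanishing of the Wronskian *)

Section Wronskian.
Variable R : realType.
Local Notation C := R[i].
Variables (h g h' g' : C -> C) (a : R).
Hypothesis a0 : 0 < a.
Hypothesis dh : forall z, cderiv h z (h' z).
Hypothesis dg : forall z, cderiv g z (g' z).
Hypothesis hg : forall z, `|csqabs (h z) - csqabs (g z)| <= (csqabs (g z) + 1) `^ (- a).

Let W z := h z * g' z - g z * h' z.
Let S z := csqabs (g z).
Let y z := ln (S z).
Let eta z := csqabs (h z * (g z)^-1) - 1.
(* [exp v1] and [exp v2], times [|W|^2], are conformal metrics of negative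
   curvature where [|g|^2 >= 6], resp. [|g|^2 <= R1].  [K] makes the last term of
   [v1] absorb the mixed derivatives of the previous one; [lnA] gives
   [v1 < 0 <= v2] where [|g|^2 = 6], and [R1] gives [v2 <= 1 < 2 <= v1] where
   [|g|^2 = R1], so the larger metric is always one that is negatively curved. *)
Let b : R := 2 + a.
Let K : R := 3 * b ^+ 2 / a ^+ 2.
Let lnA : R := - (a * ln 6 + 2 + K).
Let v1 z := lnA + (a * y z + (eta z ^+ 2 * expR (b * y z) + K * expR (- a * y z))).

Let K0 : 0 <= K.
Proof. by apply: divr_ge0; [apply: mulr_ge0 => //; exact: sqr_ge0|exact: sqr_ge0]. Qed.

Let gap_le1 z : `|csqabs (h z) - S z| <= 1.
Proof.
apply: le_trans (hg z) _; rewrite -[leRHS](powRr0 (S z + 1)); apply: ler_powR.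
  by rewrite lerDr csqabs_ge0.
by rewrite oppr_le0 ltW.
Qed.

Let gap_le z : 0 < S z -> `|csqabs (h z) - S z| <= expR (- a * y z).
Proof.
move=> s0; apply: le_trans (hg z) _.
have s1 : 0 < S z + 1 by rewrite ltr_wpDl ?ltW.
rewrite /powR gt_eqF // ler_expR ler_nM2l ?oppr_lt0 // ler_ln ?posrE //.
by rewrite lerDl.
Qed.

Let etaE z : 0 < S z -> eta z = (csqabs (h z) - S z) / S z.
Proof. by move=> s0; rewrite /eta csqabsM csqabsV mulrBl divff // gt_eqF. Qed.

Let S_ge6 z : 6 <= S z -> 0 < S z.
Proof. by move=> H; apply: lt_le_trans H. Qed.

(** The gap [|h|^2 - |g|^2] is at most 1 and at most [S^(-a)] in absolute value; divided by [S], the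
    first bound gives the [1/6]. For the second, [expR (b y) = S^2 S^a] cancels the two divisions by
    [S] in [eta ^+ 2]. *)
Let eta_bnd z : 6 <= S z -> - 1 <= 6 * eta z /\ eta z ^+ 2 * expR (b * y z) <= expR (- a * y z).
Proof.
move=> H6; have s0 := S_ge6 H6; have g1 := gap_le1 z; have g2 := gap_le s0.
have He : `|eta z| * S z = `|csqabs (h z) - S z|.
  by rewrite etaE // normrM normfV (gtr0_norm s0) divfK // gt_eqF.
split.
  have : `|eta z| * 6 <= 1.
    by apply: le_trans g1; rewrite -He ler_wpM2l.
  have := ler_norm (- eta z); rewrite normrN; lra.
have Eb : expR (b * y z) = S z ^+ 2 * expR (a * y z).
  by rewrite /b mulrDl expRD; congr (_ * _); rewrite mulr_natl mulr2n expRD lnK ?posrE.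
rewrite Eb mulrA -real_normK ?num_real // -exprMn He.
have E1 : expR (- a * y z) ^+ 2 * expR (a * y z) = expR (- a * y z).
  by rewrite expr2 -!expRD; congr expR; ring.
rewrite -[leRHS]E1 ler_wpM2r ?expR_ge0 //.
by rewrite lerXn2r ?nnegrE ?expR_ge0.
Qed.

(** The two corrections create curvature but stay between 0 and [1 + K], so the metric remains
    comparable to [|W|^2 |g|^(2a)]. *)
Let v1_bnd z : 6 <= S z -> lnA + a * y z <= v1 z <= lnA + a * y z + (1 + K).
Proof.
move=> H6; have [_ H] := eta_bnd H6; have s0 := S_ge6 H6.
have y0 : 0 <= y z by apply: ln_ge0; apply: le_trans H6; rewrite ler1n.
have e1 : expR (- a * y z) <= 1.
  by rewrite -expR0 ler_expR mulNr oppr_le0 mulr_ge0 // ltW.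
have e0 := expR_ge0 (- a * y z).
have n0 : 0 <= eta z ^+ 2 * expR (b * y z) by rewrite mulr_ge0 ?sqr_ge0 ?expR_ge0.
have k1 : K * expR (- a * y z) <= K by rewrite ler_piMr.
have k0 : 0 <= K * expR (- a * y z) by rewrite mulr_ge0.
by rewrite /v1; apply/andP; split; lra.
Qed.

Let Re_mulconj_ge (z w : C) : - (csqabs z + csqabs w) <= 2 * complex.Re (z * conjc w).
Proof.
case: z => x1 x2; case: w => x3 x4; rewrite /csqabs /=.
have := sqr_ge0 (x1 + x3); have := sqr_ge0 (x2 + x4); nra.
Qed.

Let Re_scale (c d e : R) (z w : C) :
  e * (2 * complex.Re (z * conjc (((c * d)%:C)%C * w))) =
  2 * complex.Re ((c%:C)%C * (z + 0) * conjc ((e%:C)%C * ((d%:C)%C * w))).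
Proof. by case: z => ? ?; case: w => ? ? /=; ring. Qed.

(** As [y] is harmonic, only the last two terms of [v1] contribute. The product rule for
    [eta^2 expR (b y)] gives the main term [2 E mu (1 + 2 eta)], a positive term, and a cross term
    of unknown sign. *)
Let v1_jet t : 6 <= S t -> exists p m, jet v1 t p m /\ csqabs (W t) * expR (a * y t) / 2 <= m.
Proof.
move=> H6; have s0 := S_ge6 H6; have gt0 : g t != 0 by rewrite -csqabs_gt0.
have [r r0 Hr] := ccont_neq0 (cderiv_cont (dg t)) gt0.
have gn w : cabs (w - t) < r -> g w != 0.
  move=> /Hr; rewrite [t + _]addrC subrK -cabs_gt0; apply: le_lt_trans.
  by rewrite divr_ge0 ?cabs_ge0.
pose M x := h x * (g x)^-1.
pose M' x := h' x * (g x)^-1 + h x * (- g' x / g x ^+ 2).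
have dM w : cabs (w - t) < r -> cderiv M w (M' w).
  by move=> /gn gw; apply: cderivM => //; exact: cderivV.
have jM := jet_csqabs r0 dM.
have je := jetD jM (jet_cst (-1) t).
have je2 := jet_comp je (rtaylor_sqr _).
have jy := jet_ln_csqabs ltr01 (fun w _ => dg w) gt0.
have jE := jet_comp (jetZ b jy) (rtaylor_expR _).
have jEa := jet_comp (jetZ (- a) jy) (rtaylor_expR _).
have J := jetD (jet_cst lnA t) (jetD (jetZ a jy) (jetD (jetM je2 jE) (jetZ K jEa))).
eexists; eexists; split; first exact: J.
rewrite -/(S t) -/(y t).
have Ee : csqabs (M t) + -1 = eta t by [].
rewrite !Ee.
set E := expR (b * y t); set Ea := expR (- a * y t).
have [Hb1 Hb2] := eta_bnd H6; rewrite -/E -/Ea in Hb2.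
set mu := csqabs (M' t); set q := g' t / g t; set Q := csqabs q.
have cR (c : R) (z : C) : csqabs ((c%:C)%C * z) = c ^+ 2 * csqabs z.
  by rewrite csqabsM /csqabs /= expr0n addr0.
(* Here [M' = - W / g^2] enters, and [b = 2 + a] is what makes the powers of [|g|] match. *)
have Emu : E * mu = csqabs (W t) * expR (a * y t).
  have -> : mu = csqabs (W t) / S t ^+ 2.
    rewrite /mu /S -csqabsX -csqabsV -csqabsM.
    have -> : M' t = - (W t * (g t ^+ 2)^-1) by rewrite /M' /W; field.
    by rewrite -!sqr_cabs cabsN.
  have -> : E = S t ^+ 2 * expR (a * y t).
    by rewrite /E /b mulrDl expRD; congr (_ * _); rewrite mulr_natl mulr2n expRD lnK ?posrE.
  by field; rewrite gt_eqF.
rewrite -Emu !cR.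
(* The cross term is split so that its first part, [mu (1 + eta)], is about half of the main term,
   and its second part carries the small factor [eta ^+ 2]. *)
have X : 2 * complex.Re (((2 * eta t)%:C)%C * (M' t * conjc (M t) + 0) * conjc ((E%:C)%C * ((b%:C)%C * q)))
   >= - (E * (mu * (1 + eta t) + 4 * eta t ^+ 2 * b ^+ 2 * Q)).
  have := Re_mulconj_ge (M' t * conjc (M t)) (((2 * eta t * b)%:C)%C * q).
  rewrite cR csqabsM (_ : csqabs (conjc (M t)) = 1 + eta t); last first.
    by rewrite -Ee addrC addrNK; case: (M t) => ? ?; rewrite /csqabs /= sqrrN.
  rewrite -/mu -/Q => H.
  have E0 : 0 <= E by exact: expR_ge0.
  have := ler_wpM2l E0 H; set L := E * - _; set L' := - (E * _).
  have -> : L = L' by rewrite /L /L'; ring.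
  move=> /le_trans; apply; rewrite le_eqVlt; apply/orP; left; apply/eqP.
  exact: Re_scale.
rewrite -/mu -/q -/Q in X *.
have E0 : 0 <= E by exact: expR_ge0.
have Ea0 : 0 <= Ea by exact: expR_ge0.
have mu0 : 0 <= mu by exact: csqabs_ge0.
have Q0 : 0 <= Q by exact: csqabs_ge0.
have cP : csqabs (M' t * conjc (M t) + 0) = mu * (1 + eta t).
  rewrite addr0 csqabsM -/mu; congr (_ * _).
  by rewrite -Ee addrC addrNK; case: (M t) => ? ?; rewrite /csqabs /= sqrrN.
rewrite cP.
set Y := 2 * complex.Re _ in X *.
have KE : K * a ^+ 2 = 3 * b ^+ 2 by rewrite /K divfK // gt_eqF // exprn_gt0.
have Z1 : (3 * b ^+ 2 * Q) * (eta t ^+ 2 * E) <= (3 * b ^+ 2 * Q) * Ea.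
  by rewrite ler_wpM2l // mulr_ge0 // mulr_ge0 // sqr_ge0.
have Z2 : 0 <= (E * mu) * (6 * eta t + 1).
  by apply: mulr_ge0; [exact: mulr_ge0|lra].
(* Here [2 (1 + 2 eta) - (1 + eta) = 1 + 3 eta], at least [1/2] as [eta >= -1/6], and
   [b^2 - 4 b^2 = - 3 b^2], the origin of the 3 in [K]. *)
apply: le_trans (_ : E * mu * (3 * eta t + 1) - (3 * b ^+ 2 * Q) * (eta t ^+ 2 * E) + K * a ^+ 2 * Q * Ea <= _).
  rewrite KE; move: Z1 Z2; lra.
move: X; lra.
Qed.

Let eh : entire h. Proof. by move=> z; exists (h' z). Qed.
Let eg : entire g. Proof. by move=> z; exists (g' z). Qed.

Let entire_der (f f' : C -> C) : (forall z, cderiv f z (f' z)) -> entire f'.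
Proof. by move=> df z; apply: (holo_holo ltr01 (fun w _ => df w)). Qed.

Let eW : entire W.
Proof.
move=> z; have [l Hl] := entire_der dh z; have [m Hm] := entire_der dg z.
by eexists; exact: cderivB (cderivM (dh z) Hm) (cderivM (dg z) Hl).
Qed.

Let R1 : R := expR ((2 - lnA) / a).
(** Normalised so that [v2 <= 1] where [|g|^2 <= R1]: there [|h|^2 <= R1 + 1]. *)
Let kap : R := (2 * R1 + 1)^-1.
Let v2 z := kap * (csqabs (h z) + csqabs (g z)).

Let R1_ge6 : 6 <= R1.
Proof.
rewrite -[leLHS]lnK ?posrE // ler_expR ler_pdivlMr // /lnA; have := K0.
by rewrite mulrC; lra.
Qed.

Let den0 : 0 < 2 * R1 + 1. Proof. by have := R1_ge6; lra. Qed.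
Let kap0 : 0 < kap. Proof. by rewrite invr_gt0. Qed.

Let v2_ge0 z : 0 <= v2 z.
Proof. by apply: mulr_ge0; [exact: ltW|rewrite addr_ge0 ?csqabs_ge0]. Qed.

Let sum_le z : S z <= R1 -> csqabs (h z) + csqabs (g z) <= 2 * R1 + 1.
Proof. by move=> H; have := gap_le1 z; rewrite ler_norml /S in H * => /andP[_ ?]; lra. Qed.

Let v2_le1 z : S z <= R1 -> v2 z <= 1.
Proof.
by move=> /sum_le H; rewrite /v2 /kap mulrC ler_pdivrMr // mul1r.
Qed.

(** Lagrange's identity: the difference of the two sides is the square modulus of the Hermitian
    product of [(h, g)] and [(h', g')], whose real and imaginary parts give [X] and [Y]. *)
Let csqabs_W z : csqabs (W z) <= (csqabs (h z) + csqabs (g z)) * (csqabs (h' z) + csqabs (g' z)).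
Proof.
rewrite /W; case: (h z) => a1 a2; case: (g z) => b1 b2; case: (h' z) => c1 c2; case: (g' z) => d1 d2.
rewrite /csqabs /=.
have := sqr_ge0 (a1 * c1 + a2 * c2 + b1 * d1 + b2 * d2).
have := sqr_ge0 (a1 * c2 - a2 * c1 + b1 * d2 - b2 * d1).
set X := _ ^+ 2; set Y := _ ^+ 2; move=> X0 Y0.
rewrite -subr_ge0; apply: le_trans (addr_ge0 X0 Y0) _.
by rewrite /X /Y le_eqVlt; apply/orP; left; apply/eqP; ring.
Qed.

Let v2_jet t : S t <= R1 -> exists p m, jet v2 t p m /\ kap ^+ 2 * csqabs (W t) <= m.
Proof.
move=> H.
have jh := jet_csqabs ltr01 (fun w _ => dh w) (a := t).
have jg := jet_csqabs ltr01 (fun w _ => dg w) (a := t).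
eexists; eexists; split; first exact: (jetZ kap (jetD jh jg)).
rewrite expr2 -mulrA ler_pM2l //.
have X0 : 0 <= csqabs (h' t) + csqabs (g' t) by rewrite addr_ge0 ?csqabs_ge0.
apply: le_trans (ler_wpM2l (ltW kap0) (csqabs_W t)) _.
have k1 := v2_le1 H; rewrite /v2 in k1.
by rewrite mulrA; apply: le_trans (ler_wpM2r X0 k1) _; rewrite mul1r.
Qed.

(** Up to a constant, the ratio of the metric [|W|^2 exp v] to the hyperbolic metric of the disc of
    radius [r]. It vanishes on the boundary circle. *)
Let P v (r : R) z := csqabs (W z) * expR (v z) * (r ^+ 2 - csqabs z) ^+ 2.

Let P_rcont v r t p m : jet v t p m -> rcont (P v r) t.
Proof.
move=> jv; have /choice[W' dW] := eW.
have jW := jet_csqabs ltr01 (fun w _ => dW w) (a := t).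
have je := jet_comp jv (rtaylor_expR _).
have ji := jet_csqabs (f := id) (f' := fun=> 1) (a := t) ltr01 (fun w _ => cderiv_id w).
have jD := jet_comp (jetD (jet_cst (r ^+ 2) t) (jetZ (-1) ji)) (rtaylor_sqr _).
have := jet_rcont (jetM (jetM jW je) jD).
by congr rcont; apply: funext => x; rewrite /P mulN1r.
Qed.

Let P_ge0 v r z : 0 <= P v r z.
Proof. by apply: mulr_ge0 (sqr_ge0 _); apply: mulr_ge0 (csqabs_ge0 _) (expR_ge0 _). Qed.

Let rcont_S z : rcont S z.
Proof. exact: csqabs_cont (cderiv_cont (dg z)). Qed.

(** [c1] and [c2] are the curvature constants of the two metrics: they turn the bounds of [v1_jet]
    and [v2_jet] into multiples of [|W|^2 exp v], through [v1 <= lnA + a y + 1 + K] and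
    [v2 <= 1]. *)
Let c1 : R := expR (- (lnA + 1 + K)) / 2.
Let c2 : R := kap ^+ 2 * expR (- 1).
Let c : R := Num.min c1 c2.

Let P_pos v (r : R) t : 0 < P v r t -> cabs t <= r -> W t != 0 /\ cabs t < r.
Proof.
move=> P0 tr; split.
  by apply: contraTneq P0; rewrite /P => ->; rewrite /csqabs /= expr0n addr0 !mul0r ltxx.
rewrite lt_neqAle tr andbT; apply: contraTneq P0; rewrite /P => <-.
by rewrite sqr_cabs subrr expr0n mulr0 ltxx.
Qed.

Let P_bound v (t p : C) m (r ci : R) : 0 < r -> c <= ci -> 0 < P v r t ->
  jet v t p m -> ci * (csqabs (W t) * expR (v t)) <= m -> cabs t <= r ->
  near0 (fun h => cabs (t + h) <= r -> P v r (t + h) <= P v r t) -> c * P v r t <= 2 * r ^+ 2.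
Proof.
move=> r0 cci P0 jv Hm tr Hmax; have /choice[W' dW] := eW.
have [Wt tr'] := P_pos P0 tr.
have tr0 : cabs (t - 0) < r by rewrite subr0.
have Hmax' : near0 (fun h => P v r (t + h) <= P v r t).
  move: (near0_and Hmax (near0_ball tr0)); apply: near0_imp => x [H].
  by rewrite subr0 => /ltW.
have := hyperbolic_max dW jv tr' Wt Hmax'; apply: le_trans.
have D0 : 0 <= (r ^+ 2 - csqabs t) ^+ 2 by exact: sqr_ge0.
rewrite /P mulrA ler_wpM2r //; apply: le_trans Hm; rewrite ler_wpM2r //.
by rewrite mulr_ge0 ?csqabs_ge0 ?expR_ge0.
Qed.

Let c_gt0 : 0 < c.
Proof. by rewrite lt_min divr_gt0 ?mulr_gt0 ?exprn_gt0 ?expR_gt0. Qed.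

(** The joint maximum over the closed disc may be attained by either metric. At the edge of its
    region that metric is strictly smaller than the other, so a positive maximum lies off the edge.
    It is then a local maximum of one smooth function, and [P_bound] applies. *)
Let P_max_bound (r : R) : 0 < r ->
  (6 <= S 0 -> c * P v1 r 0 <= 2 * r ^+ 2) /\ (S 0 <= R1 -> c * P v2 r 0 <= 2 * r ^+ 2).
Proof.
move=> r0; have r0' := ltW r0.
have c10 : cabs (0 : C) <= r by rewrite cabs0.
have rr : 0 <= 2 * r ^+ 2 by rewrite mulr_ge0 ?sqr_ge0.
(* The equality clause covers the points where [W] or [r^2 - |z|^2] vanishes: there a strict
   inequality of exponents does not give one of metrics. *)
have lP v w z : v z < w z -> P v r z <= P w r z /\ (P v r z = P w r z -> P w r z = 0).
  move=> vw; have e : expR (v z) < expR (w z) by rewrite ltr_expR.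
  rewrite /P; set A := csqabs _; set D := _ ^+ 2.
  have A0 : 0 <= A by exact: csqabs_ge0.
  have D0 : 0 <= D by exact: sqr_ge0.
  split; first by rewrite ler_wpM2r // ler_wpM2l // ltW.
  move=> E; apply/eqP; rewrite mulf_eq0 mulf_eq0.
  move/eqP: E; rewrite -subr_eq0 -mulrBl -mulrBr !mulf_eq0 subr_eq0 (lt_eqF e) orbF.
  by move=> /orP[->|->]; rewrite ?orbT.
have [||||p pr] := @two_region_max _ S (P v1 r) (P v2 r) r 6 R1 r0' R1_ge6 rcont_S.
- by move=> q /v1_jet[p [m [j _]]]; exact: P_rcont j.
- move=> q; apply: P_rcont.
  exact: (jetZ kap (jetD (jet_csqabs ltr01 (fun w _ => dh w) (a := q)) (jet_csqabs ltr01 (fun w _ => dg w) (a := q)))).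
- exact: P_ge0.
- exact: P_ge0.
case=> -[Sp Hp].
- suff H : c * P v1 r p <= 2 * r ^+ 2.
    have [H1 H2] := Hp 0 c10.
    by split=> [/H1|/H2] h0; apply: le_trans H; rewrite ler_pM2l.
  have := P_ge0 v1 r p; rewrite le_eqVlt => /orP[/eqP <-|P0]; first by rewrite mulr0.
  have S6 : 6 < S p.
    rewrite lt_neqAle Sp andbT; apply/negP => /eqP E.
    have [_ /(_ _)] := Hp p pr; rewrite -E => /(_ R1_ge6) H.
    have v12 : v1 p < v2 p.
      apply: lt_le_trans (v2_ge0 p); have /andP[_ H1] := v1_bnd Sp.
      apply: le_lt_trans H1 _; rewrite /y -E /lnA; lra.
    have [L1 L2] := lP _ _ _ v12.
    by move: P0; rewrite (_ : P v1 r p = 0) ?ltxx // -L2 //; apply/le_anti; rewrite H L1.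
  have [q [m [j Hm]]] := v1_jet Sp.
  apply: (P_bound (ci := c1) r0 _ P0 j _ pr).
  - by rewrite ge_min lexx.
  - apply: le_trans Hm; rewrite mulrCA -mulrA ler_wpM2l ?csqabs_ge0 //.
    rewrite /c1 mulrAC ler_pM2r ?invr_gt0 // -expRD ler_expR.
    by have /andP[_] := v1_bnd Sp; lra.
  - have nb : near0 (fun h => 6 < S (p + h)).
      have := rcont_S p; move=> /(_ (S p - 6)); rewrite subr_gt0 => /(_ S6).
      by apply: near0_imp => x; rewrite ltr_norml => /andP[? _]; lra.
    by move: nb; apply: near0_imp => x /ltW H Hr; have [H1 _] := Hp _ Hr; exact: H1.
- suff H : c * P v2 r p <= 2 * r ^+ 2.
    have [H1 H2] := Hp 0 c10.
    by split=> [/H1|/H2] h0; apply: le_trans H; rewrite ler_pM2l.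
  have := P_ge0 v2 r p; rewrite le_eqVlt => /orP[/eqP <-|P0]; first by rewrite mulr0.
  have SR : S p < R1.
    rewrite lt_neqAle Sp andbT; apply/negP => /eqP E.
    have S6 : 6 <= S p by rewrite E R1_ge6.
    have [/(_ S6) H _] := Hp p pr.
    have v21 : v2 p < v1 p.
      apply: le_lt_trans (v2_le1 Sp) _; have /andP[H1 _] := v1_bnd S6.
      apply: lt_le_trans H1; rewrite /y E /R1 expRK.
      by rewrite mulrCA divff ?gt_eqF // mulr1; lra.
    have [L1 L2] := lP _ _ _ v21.
    by move: P0; rewrite (_ : P v2 r p = 0) ?ltxx // -L2 //; apply/le_anti; rewrite H L1.
  have [q [m [j Hm]]] := v2_jet Sp.
  apply: (P_bound (ci := c2) r0 _ P0 j _ pr).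
  - by rewrite ge_min lexx orbT.
  - apply: le_trans Hm; rewrite /c2 -mulrA ler_wpM2l ?sqr_ge0 //.
    rewrite mulrCA ler_piMr ?csqabs_ge0 // -expRD -[leRHS]expR0 ler_expR.
    by have := v2_le1 Sp; lra.
  - have nb : near0 (fun h => S (p + h) < R1).
      have := rcont_S p; move=> /(_ (R1 - S p)); rewrite subr_gt0 => /(_ SR).
      by apply: near0_imp => x; rewrite ltr_norml => /andP[_]; lra.
    by move: nb; apply: near0_imp => x /ltW H Hr; have [_ H2] := Hp _ Hr; exact: H2.
Qed.

(* Ahlfors' argument on the disc of radius [r], and [r -> oo]. *)
Theorem wronskian_eq0_at0 : h 0 * g' 0 - g 0 * h' 0 = 0.
Proof.
rewrite -/(W 0).
apply/eqP; apply: contrapT => /negP; rewrite -csqabs_gt0 => W0.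
(* A lower bound, independent of [r], for the weight at 0, whichever of the two metrics is used
   there. *)
pose e0 : R := Num.min 1 (expR lnA).
have e00 : 0 < e0 by rewrite lt_min ltr01 expR_gt0.
have key r : 0 < r -> c * (csqabs (W 0) * e0) * r ^+ 2 <= 2.
  move=> r0; have [H1 H2] := P_max_bound r0.
  have r2 : 0 < r ^+ 2 by rewrite exprn_gt0.
  have cs0 : csqabs (0 : C) = 0 by rewrite /csqabs /= expr0n addr0.
  have fin v : e0 <= expR (v 0) -> c * P v r 0 <= 2 * r ^+ 2 ->
      c * (csqabs (W 0) * e0) * r ^+ 2 <= 2.
    move=> ev H; rewrite -(ler_pM2r r2); apply: le_trans H; rewrite /P cs0 subr0.
    have -> : c * (csqabs (W 0) * e0) * r ^+ 2 * r ^+ 2 = c * csqabs (W 0) * (r ^+ 2) ^+ 2 * e0 by ring.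
    have -> : c * (csqabs (W 0) * expR (v 0) * (r ^+ 2) ^+ 2) =
      c * csqabs (W 0) * (r ^+ 2) ^+ 2 * expR (v 0) by ring.
    apply: ler_wpM2l ev; apply: mulr_ge0 (sqr_ge0 _).
    by apply: mulr_ge0 (csqabs_ge0 _); exact: ltW.
  have [S1|S1] := leP (S 0) R1.
    apply: fin (H2 S1); rewrite /e0 ge_min; apply/orP; left.
    by rewrite -expR0 ler_expR v2_ge0.
  have S6 : 6 <= S 0 by apply: le_trans R1_ge6 (ltW S1).
  apply: fin (H1 S6); rewrite /e0 ge_min; apply/orP; right.
  rewrite ler_expR; have /andP[+ _] := v1_bnd S6; apply: le_trans.
  by rewrite lerDl mulr_ge0 ?(ltW a0) // ln_ge0 // (le_trans _ S6) // ler1n.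
pose X := c * (csqabs (W 0) * e0).
have X0 : 0 < X by rewrite !mulr_gt0.
(* The radius [2 / X + 1] is at least 1, so [X r^2 >= X r = 2 + X > 2], against [key]. *)
have Y0 : 0 < 2 / X + 1 by rewrite ltr_wpDl // divr_ge0 // ltW.
have := key _ Y0; rewrite -/X => H.
have : X * (2 / X + 1) <= 2.
  apply: le_trans H; rewrite ler_pM2l // expr2 ler_pMr //.
  by rewrite lerDr divr_ge0 // ltW.
have -> : X * (2 / X + 1) = 2 + X by move: X X0 {Y0 H} => X X0; field; rewrite gt_eqF.
by lra.
Qed.

End Wronskian.

(** * Entire curves lie on lines *)

Section EntireCurves.
Variable R : realType.
Local Notation C := R[i].

Lemma cderiv_translate (f f' : C -> C) (z : C) : (forall w, cderiv f w (f' w)) ->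
  forall w, cderiv (fun x => f (z + x)) w (f' (z + w)).
Proof.
by move=> df w; have := cderiv_comp (cderiv_addc z w) (df (z + w)); rewrite mulr1.
Qed.

Variables (h g : C -> C) (a : R).
Hypothesis a0 : 0 < a.
Hypothesis eh : entire h.
Hypothesis eg : entire g.
Hypothesis hg : forall z, `|csqabs (h z) - csqabs (g z)| <= (csqabs (g z) + 1) `^ (- a).

(** Translating the curve moves the vanishing of the Wronskian from 0 to any point. Hence [h / g]
    has zero derivative near [t0], and the identity theorem extends [h = c g] past the zeros of
    [g]. *)
Lemma curve_proportional (t0 : C) : g t0 != 0 -> exists c, forall t, h t = c * g t.
Proof.
move=> gt0; have [h' dh eh'] := entire_deriv eh; have [g' dg eg'] := entire_deriv eg.
have W z : h z * g' z = g z * h' z.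
  have := @wronskian_eq0_at0 _ (fun x => h (z + x)) (fun x => g (z + x)) (fun x => h' (z + x))
     (fun x => g' (z + x)) a a0 (cderiv_translate z dh) (cderiv_translate z dg) (fun x => hg (z + x)).
  by rewrite !addr0 => /eqP; rewrite subr_eq0 => /eqP.
pose c := h t0 / g t0; exists c.
have [r r0 Hr] := ccont_neq0 (cderiv_cont (dg t0)) gt0.
have gn w : cabs (w - t0) < r -> g w != 0.
  move=> /Hr; rewrite [t0 + _]addrC subrK -cabs_gt0; apply: le_lt_trans.
  by rewrite divr_ge0 ?cabs_ge0.
pose M x := h x * (g x)^-1.
have r2 : 0 < r / 2 by rewrite divr_gt0.
have rr : r / 2 < r by rewrite ltr_pdivrMr // mulr_natr mulr2n ltrDl.
have dM w : cabs (w - t0) <= r / 2 -> cderiv M w 0.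
  move=> Hw; have gw := gn w (le_lt_trans Hw rr).
  have := cderivM (dh w) (cderivV (dg w) gw).
  rewrite (_ : h' w * _ + _ = (g w * h' w - h w * g' w) / g w ^+ 2); last by field.
  by rewrite W subrr mul0r.
have MC := cderiv0_cst dM.
suff H t : h t - c * g t = 0 by move=> t; apply/eqP; rewrite -subr_eq0 H.
apply: (entire_identity (f := fun t => h t - c * g t) (a := t0) r2).
  by move=> z; exists (h' z - c * g' z); exact: cderivB (dh z) (cderivZ c (dg z)).
move=> z Hz; have := MC z (ltW Hz); rewrite /M -/c => <-.
by rewrite divfK ?subrr // gn // (lt_trans Hz).
Qed.

(** The gap is [| |c|^2 - 1 | |g|^2], at most 1. If [|c|] differs from 1 this bounds [g], and
    Liouville makes [g] constant. *)
Lemma proportional_unimodular (c : C) : (forall t, h t = c * g t) ->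
  ~ (forall t, g t = g 0) -> csqabs c = 1.
Proof.
move=> hc ng; apply/eqP; apply: contraT => c1; exfalso; apply: ng.
have d0 : 0 < `|csqabs c - 1| by rewrite normr_gt0 subr_eq0.
apply: (liouville (M := `|csqabs c - 1|^-1 + 1)) => // z.
rewrite cabs_le_csqabs ?addr_ge0 ?invr_ge0 //.
have := hg z; rewrite hc csqabsM -[X in _ - X]mul1r -mulrBl normrM.
rewrite (ger0_norm (csqabs_ge0 (g z))) => H.
have {}H : `|csqabs c - 1| * csqabs (g z) <= 1.
  apply: le_trans H _; rewrite -[leRHS](powRr0 (csqabs (g z) + 1)); apply: ler_powR.
    by rewrite lerDr csqabs_ge0.
  by rewrite oppr_le0 ltW.
rewrite mulrC -ler_pdivlMr // mul1r in H; apply: le_trans H _.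
by have := ltW d0; rewrite -invr_ge0; move: (_^-1) => x; nra.
Qed.

End EntireCurves.

(** * Biholomorphisms of the plane *)

Section EntireInverse.
Variable R : realType.
Local Notation C := R[i].

(* [s / G(1/s)] extends to an entire function vanishing to second order at 0. *)
Lemma entire_inverse_growth (G K : C -> C) : entire G -> entire K ->
  (forall t, K (G t) = t) -> (forall s, G (K s) = s) -> G 0 = 0 ->
  exists B, forall s, cabs (K s) <= B * (1 + cabs s).
Proof.
move=> eG eK KG GK G0.
have Gn t : t != 0 -> G t != 0.
  by apply: contraNneq => E; rewrite -(KG t) E -{1}G0 KG.
pose H s := s * (G s^-1)^-1.
(* [K] is bounded on the disc of radius [1 / e], so [G] maps all points of large modulus outside
   that disc: [|G (1 / s)| > 1 / e] for small [s], whence [|H s| <= e |s|]. *)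
have dH0 : cderiv H 0 0.
  move=> e e0.
  have [B B0 HB] : exists2 B, 0 <= B & forall t, cabs (t - 0) <= e^-1 -> cabs (K t) <= B.
    apply: cball_bounded; first by rewrite invr_ge0 ltW.
    by move=> t _; have [l] := eK t; exact: cderiv_cont.
  have B1 : 0 < B + 1 by lra.
  exists (B + 1)^-1; first by rewrite invr_gt0.
  move=> s Hs; rewrite /H !add0r !mul0r !subr0 cabsM mulrC ler_wpM2r ?cabs_ge0 //.
  have [->|s0] := eqVneq s 0; first by rewrite invr0 G0 invr0 cabs0 ltW.
  rewrite cabsV invf_ple ?posrE ?cabs_gt0 ?Gn ?invr_eq0 //.
  rewrite leNgt; apply/negP => HG.
  have := HB (G s^-1); rewrite subr0 KG => /(_ (ltW HG)); rewrite cabsV.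
  have : B + 1 < (cabs s)^-1 by rewrite -[B + 1]invrK ltf_pV2 ?posrE ?invr_gt0 ?cabs_gt0.
  lra.
have eH : entire H.
  move=> s; have [->|s0] := eqVneq s 0; first by exists 0.
  have [l Hl] := eG s^-1.
  have V : cderiv (fun x => x^-1) s (- 1 / s ^+ 2) := cderivV (cderiv_id s) s0.
  have D := cderiv_comp V Hl.
  have Gs : G s^-1 != 0 by rewrite Gn // invr_eq0.
  by eexists; exact: cderivM (cderiv_id s) (cderivV D Gs).
have [H' dH _] := entire_deriv eH.
have H'0 : H' 0 = 0 by exact: cderiv_uniq (dH 0) dH0.
have [q [M [d [M0 d0 HM]]]] := holo_taylor2 ltr01 (fun w (_ : cabs (w - 0) < 1) => dH w).
(* At [1 / t] the Taylor bound reads [1 / |t G t| = O(1 / |t|^2)]. With [t = K s] this is the growth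
   bound, up to the values [|K s| < 1 / d + 1]. *)
have big t : d^-1 + 1 <= cabs t -> cabs t <= (cabs q + M * d) * cabs (G t).
  move=> Ht; have di : 0 < d^-1 by rewrite invr_gt0.
  have t0 : 0 < cabs t by lra.
  have tn : t != 0 by rewrite -cabs_gt0.
  have td : cabs t^-1 <= d by rewrite cabsV invf_ple ?posrE //; lra.
  have := HM t^-1 td; rewrite H'0 /H !add0r !mul0r !add0r invrK => Hx.
  have {}Hx : cabs (t^-1 * (G t)^-1) <= (cabs q + M * d) * cabs t^-1 ^+ 2.
    rewrite -[X in cabs X](subrK (q * t^-1 ^+ 2)); apply: le_trans (cabsD _ _) _.
    have -> : (cabs q + M * d) * cabs t^-1 ^+ 2 = M * d * cabs t^-1 ^+ 2 + cabs q * cabs t^-1 ^+ 2 by ring.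
    apply: lerD; last by rewrite cabsM cabsX.
    apply: le_trans Hx _; have -> : M * cabs t^-1 ^+ 3 = M * cabs t^-1 * cabs t^-1 ^+ 2 by ring.
    by rewrite ler_wpM2r ?exprn_ge0 ?cabs_ge0 // ler_wpM2l.
  have g0 : 0 < cabs (G t) by rewrite cabs_gt0 Gn.
  move: Hx; rewrite cabsM !cabsV; move: (cabs q + M * d) => X Hx.
  have := ler_wpM2r (ltW (mulr_gt0 (exprn_gt0 2 t0) g0)) Hx.
  rewrite (_ : _^-1 * _^-1 * _ = cabs t); last by field; rewrite !gt_eqF.
  by rewrite (_ : X * _ * _ = X * cabs (G t)) //; field; rewrite gt_eqF.
exists (cabs q + M * d + d^-1 + 1) => s.
have E := GK s.
have q0 := cabs_ge0 q; have s0 := cabs_ge0 s; have di : 0 < d^-1 by rewrite invr_gt0.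
have md : 0 <= M * d by rewrite mulr_ge0 // ltW.
have [H1|H1] := leP (d^-1 + 1) (cabs (K s)).
  by have := big _ H1; rewrite E; move: (M * d) md => X; nra.
by move: (M * d) md => X; nra.
Qed.

(** The growth lemma bounds the second map of a pair, the first one fixing 0. It is therefore
    applied to [K - K 0] and its inverse [G (K 0 + t)], which is then affine by linear growth. *)
Theorem entire_inverse_affine (G K : C -> C) : entire G -> entire K ->
  (forall t, K (G t) = t) -> (forall s, G (K s) = s) ->
  exists x y, forall t, G t = x + y * t.
Proof.
move=> eG eK KG GK.
pose G1 s := K s - K 0; pose K1 t := G (K 0 + t).
have eG1 : entire G1.
  by move=> s; have [l Hl] := eK s; exists (l - 0); exact: cderivB Hl (cderiv_cst _ _).
have eK1 : entire K1.
  move=> t; have [l Hl] := eG (K 0 + t); exists (l * 1).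
  exact: (cderiv_comp (cderiv_addc _ _) Hl).
have KG1 t : K1 (G1 t) = t by rewrite /K1 /G1 [K 0 + _]addrC subrK GK.
have GK1 s : G1 (K1 s) = s by rewrite /K1 /G1 KG addrAC subrr add0r.
have [B HB] := entire_inverse_growth eG1 eK1 KG1 GK1 (subrr _).
have [x [y Hxy]] := entire_linear_growth eK1 HB.
exists (x - y * K 0), y => t; have := Hxy (t - K 0); rewrite /K1 [K 0 + _]addrC subrK => ->.
by ring.
Qed.

End EntireInverse.

(** * Automorphisms of the domain *)

Section Slices.
Variables (R : realType) (n : nat).
Local Notation C := R[i].
Local Notation V := 'rV[R[i]]_n.

Lemma cabs_le_vnorm (x : V) k : cabs (x ord0 k) <= vnorm x.
Proof.
by rewrite /vnorm (bigD1 k) //= lerDl sumr_ge0 // => i _; exact: cabs_ge0.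
Qed.

Lemma vnorm_ge0 (x : V) : 0 <= vnorm x.
Proof. by rewrite sumr_ge0 // => i _; exact: cabs_ge0. Qed.

Lemma vnormZ (s : C) (x : V) : vnorm (s *: x) = cabs s * vnorm x.
Proof. by rewrite /vnorm mulr_sumr; apply: eq_bigr => i _; rewrite mxE cabsM. Qed.

Lemma slice_cderiv (f : V -> V) (p v : V) (t : C) (k : 'I_n) (L : 'M[C]_n) :
  (forall eps : R, 0 < eps -> exists2 delta : R, 0 < delta & forall h : V, vnorm h < delta ->
     vnorm (f (p + t *: v + h) - f (p + t *: v) - h *m L) <= eps * vnorm h) ->
  cderiv (fun x => f (p + x *: v) ord0 k) t ((v *m L) ord0 k).
Proof.
move=> HL e e0; have N0 := vnorm_ge0 v; have N1 : 0 < vnorm v + 1 by lra.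
have [d d0 Hd] := HL _ (divr_gt0 e0 N1).
exists (d / (vnorm v + 1)); first by rewrite divr_gt0.
move=> s; rewrite ltr_pdivlMr // => Hs; have s0 := cabs_ge0 s.
have := Hd (s *: v); rewrite vnormZ => /(_ _)/le_trans Hn.
apply: le_trans (_ : e / (vnorm v + 1) * (cabs s * vnorm v) <= _); last first.
  rewrite mulrAC -mulrA -[leRHS]mulr1 -!mulrA ler_wpM2l ?(ltW e0) // ler_wpM2l //.
  by rewrite ler_pdivrMr // mul1r lerDl.
apply: le_trans (Hn _ _ (lexx _)); last by apply: le_lt_trans Hs; rewrite ler_wpM2l // lerDl.
apply: le_trans _ (cabs_le_vnorm _ k); rewrite -scalemxAl !mxE scalerDl addrA.
by rewrite [s * _]mulrC.
Qed.

End Slices.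

(** * Lines in the domain and their images *)

Section Domain.
Variables (R : realType) (n : nat) (a : R).
Local Notation C := R[i].
Local Notation V := 'rV[R[i]]_n.
Hypothesis n2 : (1 < n)%N.
Hypothesis a0 : 0 < a.
Local Notation D := (@Dom R n a).

Let last_proof : (n.-1 < n)%N. Proof. by case: n n2. Qed.
Let l : 'I_n := Ordinal last_proof.
Let first : 'I_n := Ordinal (ltnW n2).

Let first_neq : first != l.
Proof. by rewrite -val_eqE /=; case: n n2 => [|[|m]]. Qed.

Let DomP (z : V) : D z <-> forall k, k != l ->
  `|csqabs (z ord0 k) - csqabs (z ord0 l)| < (csqabs (z ord0 l) + 1) `^ (- a).
Proof.
split=> [H k kl|H k j jl kl].
  apply: H => //; move: kl; rewrite -val_eqE /= => kl.
  by rewrite ltn_neqAle kl -ltnS prednK ?(ltnW n2) ?ltn_ord.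
have -> : j = l by apply/val_inj.
by apply: H; rewrite -val_eqE /= ltn_eqF.
Qed.

Let width_gt0 (x : R) : 0 <= x -> 0 < (x + 1) `^ (- a).
Proof. by move=> x0; rewrite powR_gt0 // ltr_wpDl. Qed.

Definition torus (v : V) : Prop := forall k, csqabs (v ord0 k) = 1.

Lemma torus_line (v : V) (t : C) : torus v -> D (t *: v).
Proof.
move=> Tv; apply/DomP => k _; rewrite !mxE !csqabsM !Tv subrr normr0.
by rewrite width_gt0 // mulr1 csqabs_ge0.
Qed.

Lemma Dom_slice (f : V -> V) (p v : V) (t : C) (k : 'I_n) : holomorphic_on D f ->
  D (p + t *: v) -> exists m, cderiv (fun x => f (p + x *: v) ord0 k) t m.
Proof.
by move=> hf /hf[L HL]; exists ((v *m L) ord0 k); exact: slice_cderiv.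
Qed.

Lemma torus_curve_entire (f : V -> V) (v : V) k : holomorphic_on D f -> torus v ->
  entire (fun t => f (t *: v) ord0 k).
Proof.
move=> hf Tv t.
have [|m Hm] := @Dom_slice f 0 v t k hf; first by rewrite add0r; exact: torus_line.
by exists m; apply: cderiv_sub Hm => x; rewrite add0r.
Qed.

Lemma torus_neq0 (v : V) k : torus v -> v ord0 k != 0.
Proof. by move=> Tv; rewrite -csqabs_gt0 Tv. Qed.

Lemma Dom0 : D 0.
Proof.
apply/DomP => k _; rewrite !mxE subrr normr0 width_gt0 //; exact: csqabs_ge0.
Qed.

(** If the last coordinate of the image curve were constant, the inequalities of the domain would
    bound the others, and by Liouville [f] would be constant on the line, against injectivity. So
    every coordinate is a unimodular multiple of the last one. The statement covers both the
    automorphism and its inverse. *)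
Lemma torus_curve (f : V -> V) (v : V) : holomorphic_on D f ->
  (forall z, D z -> D (f z)) -> (forall z w, D z -> D w -> f z = f w -> z = w) -> torus v ->
  exists g w, [/\ entire g, torus w, w ord0 l = 1 & forall t, f (t *: v) = g t *: w].
Proof.
move=> hf fD finj Tv; pose F k t := f (t *: v) ord0 k.
have eF k : entire (F k) by exact: torus_curve_entire.
have gap k t : `|csqabs (F k t) - csqabs (F l t)| <= (csqabs (F l t) + 1) `^ (- a).
  have [->|kl] := eqVneq k l; first by rewrite subrr normr0 ltW // width_gt0 // csqabs_ge0.
  by have /DomP /(_ k kl) := fD _ (torus_line t Tv); move/ltW.
have ncst : ~ (forall t, F l t = F l 0).
  move=> cst.
  have : f (0 *: v) = f (1 *: v).
    apply/rowP => k; rewrite -!/(F k _); apply/esym.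
    apply: (liouville (M := csqabs (F l 0) + 2) (eF k)) => t.
    have := csqabs_ge0 (F l 0); have := gap k t; rewrite cst => H c0.
    have {}H : `|csqabs (F k t) - csqabs (F l 0)| <= 1.
      apply: le_trans H _; rewrite -[leRHS](powRr0 (csqabs (F l 0) + 1)); apply: ler_powR.
        by rewrite lerDr csqabs_ge0.
      by rewrite oppr_le0 ltW.
    rewrite cabs_le_csqabs; last by lra.
    by move: H; rewrite ler_norml => /andP[_ H]; nra.
  move/(finj _ _ (torus_line 0 Tv) (torus_line 1 Tv)).
  rewrite scale0r scale1r => /rowP/(_ l); rewrite mxE => E.
  by have := torus_neq0 l Tv; rewrite -E eqxx.
have [t0 Ft0] : exists t0, F l t0 != 0.
  apply: contrapT => /forallNP H; apply: ncst => t.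
  by have /negP/negPn/eqP -> := H t; have /negP/negPn/eqP -> := H 0.
have /choice[c Hc] : forall k, exists c, forall t, F k t = c * F l t.
  by move=> k; exact: (curve_proportional a0 (eF k) (eF l) (gap k) Ft0).
exists (F l), (\row_k c k); split => //.
- move=> k; rewrite mxE; exact: (proportional_unimodular a0 (eF l) (gap k) (Hc k) ncst).
- rewrite mxE; have := Hc l t0; rewrite -{1}[F l t0]mul1r => /(mulIf Ft0) ->.
  by [].
- by move=> t; apply/rowP => k; rewrite !mxE mulrC -Hc.
Qed.

(** * Linearity of automorphisms *)

Section Automorphism.
Variables phi psi : V -> V.
Hypothesis hphi : holomorphic_on D phi.
Hypothesis hpsi : holomorphic_on D psi.
Hypothesis phiD : forall z, D z -> D (phi z).
Hypothesis psiD : forall z, D z -> D (psi z).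
Hypothesis phiK : forall z, D z -> psi (phi z) = z.
Hypothesis psiK : forall z, D z -> phi (psi z) = z.

Let phi_inj z w : D z -> D w -> phi z = phi w -> z = w.
Proof. by move=> Dz Dw E; rewrite -(phiK Dz) E phiK. Qed.

Let psi_inj z w : D z -> D w -> psi z = psi w -> z = w.
Proof. by move=> Dz Dw E; rewrite -(psiK Dz) E psiK. Qed.

(** The inverse carries the image line back to a line that meets [C v] in more than the origin; the
    normalisation [v ord0 l = 1] makes the directions equal. The two parameter functions are then
    mutually inverse entire functions. *)
Lemma torus_affine (v : V) : torus v -> v ord0 l = 1 ->
  exists x y w, [/\ torus w, w ord0 l = 1, y != 0 & forall t, phi (t *: v) = (x + y * t) *: w].
Proof.
move=> Tv vl.
have [g [w [eg Tw wl Hg]]] := torus_curve hphi phiD phi_inj Tv.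
have [k [u [ek Tu ul Hk]]] := torus_curve hpsi psiD psi_inj Tw.
have E1 t : k (g t) *: u = t *: v by rewrite -Hk -Hg phiK //; exact: torus_line.
have kg t : k (g t) = t.
  by have /rowP/(_ l) := E1 t; rewrite !mxE ul vl !mulr1.
have uv : u = v by have := E1 1; rewrite kg !scale1r.
have gk s : g (k s) = s.
  have : phi (psi (s *: w)) = s *: w by rewrite psiK //; exact: torus_line.
  by rewrite Hk uv Hg => /rowP/(_ l); rewrite !mxE wl !mulr1.
have [x [y Hxy]] := entire_inverse_affine eg ek kg gk.
exists x, y, w; split => //; last by move=> t; rewrite Hg Hxy.
apply/eqP => y0; have := kg 0; have := kg 1; rewrite !Hxy y0 !mul0r => -> /eqP.
by rewrite oner_eq0.
Qed.

(** All these lines pass through 0, so every image line contains [phi 0]. If it is nonzero, every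
    image line also contains [2 phi 0], attained at a nonzero parameter. Two different lines then
    share a value of [phi] away from the origin, their only common point. *)
Lemma phi0 : phi 0 = 0.
Proof.
apply/eqP; apply: contraT => c0; exfalso.
have key (v : V) : torus v -> v ord0 l = 1 ->
    exists t, t != 0 /\ phi (t *: v) = 2 *: phi 0.
  move=> Tv vl; have [x [y [w [Tw wl y0 H]]]] := torus_affine Tv vl.
  have E0 : phi 0 = x *: w by rewrite -(scale0r v) H mulr0 addr0.
  have x0 : x != 0 by apply: contraNneq c0 => x0; rewrite E0 x0 scale0r.
  exists (x / y); split; first by rewrite mulf_neq0 ?invr_eq0.
  by rewrite H mulrC divfK // E0 scalerA mulr_natl mulr2n.
pose v1 : V := \row_k 1; pose v2 : V := \row_k (if k == first then -1 else 1).
have c1 : csqabs (1 : C) = 1 by rewrite /csqabs /= expr1n expr0n addr0.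
have T1 : torus v1 by move=> k; rewrite mxE.
have T2 : torus v2.
  by move=> k; rewrite mxE; case: ifP => _; rewrite // -sqr_cabs cabsN sqr_cabs.
have [|t1 [t10 H1]] := key v1 T1; first by rewrite mxE.
have [|t2 [t20 H2]] := key v2 T2.
  by rewrite mxE eq_sym (negPf first_neq).
have E : t1 *: v1 = t2 *: v2.
  by apply: phi_inj; [exact: torus_line|exact: torus_line|rewrite H1 H2].
have /rowP/(_ l) := E; rewrite !mxE eq_sym (negPf first_neq) !mulr1 => Et.
have /rowP/(_ first) := E; rewrite !mxE eqxx Et mulr1 mulrN1 => /eqP.
by rewrite -subr_eq0 opprK -mulr2n -mulr_natl mulf_eq0 (negPf t20) pnatr_eq0.
Qed.

Variable L : 'M[C]_n.
Hypothesis HL : forall eps : R, 0 < eps -> exists2 delta : R, 0 < delta & forall h : V,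
  vnorm h < delta -> vnorm (phi (0 + h) - phi 0 - h *m L) <= eps * vnorm h.

(** As [phi 0 = 0], the affine parametrisation is [t |-> (y t) w]; comparing derivatives at 0 gives
    [y w = v L]. *)
Lemma phi_torus (v : V) t : torus v -> v ord0 l = 1 -> phi (t *: v) = (t *: v) *m L.
Proof.
move=> Tv vl; have [x [y [w [Tw wl y0 H]]]] := torus_affine Tv vl.
have x0 : x = 0.
  have := H 0; rewrite scale0r phi0 mulr0 addr0 => /rowP/(_ l).
  by rewrite !mxE wl mulr1.
rewrite H x0 add0r -scalemxAl; apply/rowP => k; rewrite !mxE [y * t]mulrC -mulrA.
congr (t * _).
have D1 : cderiv (fun x => phi (0 + x *: v) ord0 k) 0 ((v *m L) ord0 k).
  by apply: slice_cderiv; rewrite scale0r addr0.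
have D2 : cderiv (fun x => phi (0 + x *: v) ord0 k) 0 (w ord0 k * y).
  apply: cderiv_sub (cderiv_scale (w ord0 k * y) 0) => s.
  by rewrite add0r H x0 add0r mxE; ring.
have := cderiv_uniq D2 D1; rewrite mulrC => ->.
by rewrite mxE.
Qed.

Lemma phi_equal_moduli (z : V) : (forall k, csqabs (z ord0 k) = csqabs (z ord0 l)) ->
  z ord0 l != 0 -> phi z = z *m L.
Proof.
move=> Hz zl.
have -> : z = z ord0 l *: ((z ord0 l)^-1 *: z) by rewrite scalerA divff // scale1r.
apply: phi_torus => [k|]; rewrite mxE ?mulVf // csqabsM csqabsV Hz mulVf //.
by rewrite gt_eqF // csqabs_gt0.
Qed.

Let subst (z : V) (i : 'I_n) (x : C) : V := \row_k (if k == i then x else z ord0 k).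

(** Induction on the number [m] of leading coordinates whose modulus is free. To free the coordinate
    of index [m], let it vary over the annulus that the domain allows, the others being fixed. On
    the circle [|x| = |z_l|] the induction hypothesis applies, and [annulus_identity] extends the
    equality. Coordinates are nonzero because that theorem excludes 0. *)
Lemma phi_nonzero (m : nat) (z : V) : D z -> (forall k, z ord0 k != 0) ->
  (forall k : 'I_n, (m <= k)%N -> csqabs (z ord0 k) = csqabs (z ord0 l)) -> phi z = z *m L.
Proof.
elim: m z => [|m IH] z Dz zn Hz; first by apply: phi_equal_moduli => // k; exact: Hz.
(* From index [n.-1] on there is nothing to free: only [l] itself is left. *)
have [mn|mn] := leqP n.-1 m.
  apply: IH => // k mk; have [kl|kl] := eqVneq k l; first by rewrite kl.
  move: kl; rewrite -val_eqE /= => kl.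
  have : (k < n.-1)%N by rewrite ltn_neqAle kl -ltnS prednK ?(ltnW n2) ?ltn_ord.
  by rewrite ltnNge (leq_trans mn mk).
have mn' : (m < n)%N by apply: leq_trans mn (leq_pred n).
pose i : 'I_n := Ordinal mn'.
have il : i != l by rewrite -val_eqE /= ltn_eqF.
have li : (l == i) = false by rewrite eq_sym (negPf il).
have S0 : 0 < csqabs (z ord0 l) by rewrite csqabs_gt0.
pose w := (csqabs (z ord0 l) + 1) `^ (- a).
have w0 : 0 < w by rewrite width_gt0 // ltW.
have Dsub x : csqabs (z ord0 l) - w < csqabs x < csqabs (z ord0 l) + w -> D (subst z i x).
  move=> Hx; apply/DomP => k kl; rewrite !mxE li; case: eqP => [_|_].
    by rewrite -/w ltr_norml; move: Hx => /andP[? ?]; apply/andP; split; lra.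
  by have /DomP := Dz; apply.
pose e : V := delta_mx 0 i.
have subE x : subst z i x = subst z i 0 + x *: e.
  apply/rowP => k; rewrite !mxE eqxx /=; case: eqP => _; first by rewrite add0r mulr1.
  by rewrite mulr0 addr0.
have subz : subst z i (z ord0 i) = z.
  by apply/rowP => k; rewrite mxE; case: eqP => [->|].
apply/rowP => j; rewrite -subz; apply/eqP; rewrite -subr_eq0; apply/eqP.
apply: (@annulus_identity _ (fun x => phi (subst z i x) ord0 j - (subst z i x *m L) ord0 j)
  (csqabs (z ord0 l) - w) (csqabs (z ord0 l) + w) (csqabs (z ord0 l))) => //.
- by apply/andP; split; lra.
- move=> x Hx; have := @Dom_slice phi (subst z i 0) e x j hphi.
  rewrite -subE => /(_ (Dsub x Hx))[d Hd].
  exists (d - (e *m L) ord0 j).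
  apply: cderiv_sub (cderivB Hd (cderiv_affine ((subst z i 0 *m L) ord0 j) _ x)) => y.
  rewrite [subst z i y]subE mulmxDl -scalemxAl; congr (_ - _).
  by rewrite [RHS]mxE; congr (_ + _); rewrite [RHS]mxE mulrC.
- move=> x Hx; rewrite IH ?subrr //.
  + by apply: Dsub; rewrite Hx; apply/andP; split; lra.
  + move=> k; rewrite mxE; case: (k == i) => //.
    by rewrite -csqabs_gt0 Hx.
  + move=> k mk; rewrite !mxE li; case: eqP => // ki.
    apply: Hz; rewrite ltn_neqAle mk andbT; apply/eqP => mk'.
    by apply: ki; apply/val_inj.
- by have /DomP /(_ i il) := Dz; rewrite -/w ltr_norml => /andP[? ?]; apply/andP; split; lra.
Qed.

Lemma near0_all (P : 'I_n -> C -> Prop) : (forall k, near0 (P k)) -> near0 (fun h => forall k, P k h).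
Proof.
move=> HP; have : forall s : seq 'I_n, near0 (fun h => forall k, k \in s -> P k h).
  elim=> [|k s IH]; first exact: near0_true.
  move: (near0_and (HP k) IH); apply: near0_imp => h [Hk Hs] j.
  by rewrite inE => /orP[/eqP ->|/Hs].
move=> /(_ (enum 'I_n)); apply: near0_imp => h H k; apply: H.
by rewrite mem_enum.
Qed.

(** Both sides of the defining inequalities are continuous in [t]; this is read off their jets, the
    power being written through [expR] and [ln]. *)
Lemma Dom_near (z v : V) : D z -> near0 (fun t => D (z + t *: v)).
Proof.
move=> Dz.
pose S k t := csqabs (z ord0 k + v ord0 k * t).
have jS k : jet (S k) 0 _ _ := jet_csqabs ltr01 (fun w (_ : cabs (w - 0) < 1) => cderiv_affine (z ord0 k) (v ord0 k) w).
have cS k : rcont (S k) 0 by exact: jet_rcont (jS k).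
pose W t := expR (- a * ln (S l t + 1)).
have cW : rcont W 0.
  have s1 : 0 < S l 0 + 1 by rewrite ltr_wpDl ?csqabs_ge0.
  exact: jet_rcont (jet_comp (jetZ (- a) (jet_comp (jetD (jS l) (jet_cst 1 0)) (rtaylor_ln s1))) (rtaylor_expR _)).
have WE t : (S l t + 1) `^ (- a) = W t.
  by rewrite /powR gt_eqF // ltr_wpDl ?csqabs_ge0.
have : near0 (fun t => forall k, k != l -> `|S k t - S l t| < W t).
  apply: near0_all => k; have [->|kl] := eqVneq k l; first exact: near0_true.
  have gap0 : 0 < (W 0 - `|S k 0 - S l 0|) / 3.
    rewrite divr_gt0 // subr_gt0 -WE /S !mulr0 !addr0.
    by have /DomP := Dz; apply.
  move: (near0_and (cS k _ gap0) (near0_and (cS l _ gap0) (cW _ gap0))).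
  apply: near0_imp => h; rewrite add0r => -[H1 [H2 H3]] _.
  move: gap0 H1 H2 H3; rewrite !ltr_norml.
  have [e0|e0] := leP 0 (S k 0 - S l 0); [rewrite (ger0_norm e0)|rewrite (ltr0_norm e0)];
    by move=> ? /andP[? ?] /andP[? ?] /andP[? ?]; apply/andP; split; lra.
apply: near0_imp => t H; apply/DomP => k kl.
have E j : (z + t *: v) ord0 j = z ord0 j + v ord0 j * t by rewrite !mxE mulrC.
by rewrite !E WE; exact: H.
Qed.

(** Adding a small [t] to the vanishing coordinates, which is the direction [v], leads to points
    covered by [phi_nonzero]; continuity at [t = 0] concludes. *)
Lemma phi_linear (z : V) : D z -> phi z = z *m L.
Proof.
move=> Dz; pose v : V := \row_k (if z ord0 k == 0 then 1 else 0).
apply/rowP => j; apply/eqP; rewrite -subr_eq0 -cabs_eq0; apply/eqP/le_anti.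
rewrite cabs_ge0 andbT; apply/ler_addgt0Pl => e e0; rewrite addr0.
pose F t := phi (z + t *: v) ord0 j - ((z *m L) ord0 j + (v *m L) ord0 j * t).
have [m Hm] : exists m, cderiv (fun t => phi (z + t *: v) ord0 j) 0 m.
  by apply: Dom_slice => //; rewrite scale0r addr0.
have cF : ccont F 0 := cderiv_cont (cderivB Hm (cderiv_affine _ _ 0)).
have F0 : phi z ord0 j - (z *m L) ord0 j = F 0 by rewrite /F scale0r addr0 mulr0 addr0.
have [d d0 Hd] := near0_and (Dom_near v Dz) (cF e e0).
pose t : C := ((d / 2)%:C)%C.
have dt : cabs t = d / 2 by rewrite cabsR gtr0_norm // divr_gt0.
have [|Dt Ht] := Hd t; first by rewrite dt ltr_pdivrMr // mulr_natr mulr2n ltrDl.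
have t0 : t != 0 by rewrite -cabs_gt0 dt divr_gt0.
rewrite F0 -cabsN; suff Ft : F t = 0 by move: Ht; rewrite add0r Ft sub0r => /ltW.
have zt k : (z + t *: v) ord0 k != 0.
  by rewrite !mxE; case: (eqVneq (z ord0 k) 0) => [->|zk]; rewrite ?mulr1 ?add0r // mulr0 addr0.
rewrite /F (@phi_nonzero n (z + t *: v) Dt zt); last first.
  by move=> k; rewrite leqNgt ltn_ord.
by rewrite mulmxDl -scalemxAl mxE [X in _ + X - _]mxE [t * _]mulrC subrr.
Qed.

End Automorphism.
End Domain.

Theorem theorem4p3 (R : realType) (n : nat) (a : R) :
  (2 <= n)%N ->
  2 / (n.-1)%:R < a -> a <= 3 / (n.-1)%:R ->
  forall phi : 'rV[R[i]]_n -> 'rV[R[i]]_n,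
    is_automorphism (@Dom R n a) phi -> linear_on (@Dom R n a) phi.
Proof.
move=> n2 a2 _ phi [hphi [phiD [psi [hpsi psiD phiK psiK]]]].
have a0 : 0 < a by apply: le_lt_trans a2; rewrite divr_ge0.
have [L HL] := hphi 0 (Dom0 a n2).
by exists L => z; exact: (phi_linear n2 a0 hphi hpsi phiD psiD phiK psiK HL).
Qed.
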